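(* Let $f\in C(I,I)$. The following are equivalent: (1) $h(f)>0$; (2) $\mathrm{Prox}_f$ is not an equivalence relation; (3) there exist two maximal scrambled sets of $f$ which are neither equivalent nor separable; (4) $f$ has a $3$-scrambled tuple; (5) $f$ has a subsystem that is transitive and $3$-sensitive; (6) $f$ has an essential $3$-IN-tuple.
   Context: $I=[0,1]$, $C(I,I)$ continuous self-maps of $I$, $h(f)$ topological entropy. A pair $\langle x,y\rangle$ is proximal if $\liminf_n|f^n(x)-f^n(y)|=0$; $\mathrm{Prox}_f$ is the set of proximal pairs. A pair is scrambled if proximal and $\limsup_n|f^n(x)-f^n(y)|>0$; a set is scrambled if all pairs of distinct points in it are scrambled; a maximal scrambled set is one not properly contained in another scrambled set. Sets $S,R$ are equivalent if there is a bijection $\phi:S\to R$ with $\lim_n|f^n\phi(x)-f^nx|=0$ for all $x\in S$; separable if there is $\delta>0$ with $\liminf_n|f^nx-f^ny|\ge\delta$ for all $x\in S,y\in R$. A tuple $\langle x_1,x_2,x_3\rangle$ is $3$-scrambled if $\liminf_k\max_{i<j}|f^k x_i-f^k x_j|=0$ and $\limsup_k\min_{i<j}|f^kx_i-f^kx_j|>0$. A subsystem is a nonempty closed $Y\subset I$ with $f(Y)\subset Y$; it is transitive if for all nonempty relatively open $U,V\subset Y$ some $n\ge0$ has $f^nU\cap V\ne\emptyset$, and $3$-sensitive if there is $\delta>0$ such that every nonempty relatively open $U\subset Y$ contains distinct $x_1,x_2,x_3$ and some $k\ge1$ with $\min_{i<j}|f^kx_i-f^kx_j|\ge\delta$. For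 $A_1,\dots,A_k\subset I$, $J\subset\mathbb Z_+$ is an independence set if $\bigcap_{i\in F}f^{-i}A_{s(i)}\ne\emptyset$ for every nonempty finite $F\subset J$ and $s\in\{1,\dots,k\}^F$. A tuple $\langle x_1,x_2,x_3\rangle$ is an IN-tuple if for all neighborhoods $U_j\ni x_j$, $(U_1,U_2,U_3)$ has arbitrarily long finite independence sets; it is essential if the $x_j$ are pairwise distinct. *)

(* Defs.v *)
From Stdlib Require Import Reals Lra Lia List.
From Stdlib Require Export Rtopology.
Import ListNotations.
Open Scope R_scope.

Definition inI (x : R) : Prop := 0 <= x <= 1.

Definition CII (f : R -> R) : Prop :=
  (forall x, inI x -> inI (f x)) /\
  (forall x, inI x -> forall eps, 0 < eps -> exists delta, 0 < delta /\
     forall y, inI y -> Rabs (y - x) < delta -> Rabs (f y - f x) < eps).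

Fixpoint iter (n : nat) (f : R -> R) (x : R) : R :=
  match n with O => x | S m => f (iter m f x) end.

Definition liminf_zero (a : nat -> R) : Prop :=          (* liminf a_n = 0, a_n >= 0 *)
  forall eps, 0 < eps -> forall N, exists n, (n >= N)%nat /\ a n < eps.
Definition limsup_pos (a : nat -> R) : Prop :=
  exists delta, 0 < delta /\ forall N, exists n, (n >= N)%nat /\ delta <= a n.
Definition lim_zero (a : nat -> R) : Prop :=
  forall eps, 0 < eps -> exists N, forall n, (n >= N)%nat -> Rabs (a n) < eps.
Definition liminf_ge (a : nat -> R) (d : R) : Prop :=
  forall eps, 0 < eps -> exists N, forall n, (n >= N)%nat -> d - eps <= a n.

Definition dist_n (f : R -> R) (x y : R) (n : nat) : R :=
  Rabs (iter n f x - iter n f y).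

Definition separated (f : R -> R) (n : nat) (eps : R) (E : list R) : Prop :=
  NoDup E /\ (forall x, In x E -> inI x) /\
  forall x y, In x E -> In y E -> x <> y ->
    exists k, (k < n)%nat /\ eps < dist_n f x y k.

(** h(f) > 0, where h(f) = lim_{eps->0} limsup_n (1/n) log s_n(eps) and
    s_n(eps) is the maximal cardinality of an (n,eps)-separated set. Since the
    inner limsup is nonincreasing in eps, h(f) > 0 iff for some eps > 0 the
    limsup is > 0, i.e. for some c > 0, s_n(eps) >= exp(c n) for infinitely many n. *)
Definition pos_entropy (f : R -> R) : Prop :=
  exists eps, 0 < eps /\ exists c, 0 < c /\
    forall N, exists n, (n >= N)%nat /\ exists E, separated f n eps E /\
      exp (c * INR n) <= INR (length E).

Definition proximal (f : R -> R) (x y : R) : Prop :=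
  inI x /\ inI y /\ liminf_zero (dist_n f x y).
Definition scrambled_pair (f : R -> R) (x y : R) : Prop :=
  proximal f x y /\ limsup_pos (dist_n f x y).

Definition is_equivalence_on_I (Rel : R -> R -> Prop) : Prop :=
  (forall x, inI x -> Rel x x) /\
  (forall x y, inI x -> inI y -> Rel x y -> Rel y x) /\
  (forall x y z, inI x -> inI y -> inI z -> Rel x y -> Rel y z -> Rel x z).

Definition subset_I (S : R -> Prop) : Prop := forall x, S x -> inI x.

Definition scrambled_set (f : R -> R) (S : R -> Prop) : Prop :=
  subset_I S /\ forall x y, S x -> S y -> x <> y -> scrambled_pair f x y.

Definition maximal_scrambled (f : R -> R) (S : R -> Prop) : Prop :=
  scrambled_set f S /\
  forall S', scrambled_set f S' -> (forall x, S x -> S' x) -> (forall x, S' x -> S x).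

Definition equivalent_sets (f : R -> R) (S T : R -> Prop) : Prop :=
  exists phi : R -> R,
    (forall x, S x -> T (phi x)) /\
    (forall x y, S x -> S y -> phi x = phi y -> x = y) /\
    (forall z, T z -> exists x, S x /\ phi x = z) /\
    (forall x, S x -> lim_zero (fun n => Rabs (iter n f (phi x) - iter n f x))).

Definition separable_sets (f : R -> R) (S T : R -> Prop) : Prop :=
  exists delta, 0 < delta /\
    forall x y, S x -> T y -> liminf_ge (dist_n f x y) delta.

Definition max3 (a b c : R) := Rmax a (Rmax b c).
Definition min3 (a b c : R) := Rmin a (Rmin b c).
Definition scrambled3 (f : R -> R) (x1 x2 x3 : R) : Prop :=
  inI x1 /\ inI x2 /\ inI x3 /\
  liminf_zero (fun k => max3 (dist_n f x1 x2 k) (dist_n f x1 x3 k) (dist_n f x2 x3 k)) /\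
  limsup_pos (fun k => min3 (dist_n f x1 x2 k) (dist_n f x1 x3 k) (dist_n f x2 x3 k)).

(** subsystems; relatively open subsets of Y are Y ∩ O with O open in R *)
Definition subsystem (f : R -> R) (Y : R -> Prop) : Prop :=
  subset_I Y /\ (exists y, Y y) /\ closed_set Y /\ (forall y, Y y -> Y (f y)).

Definition transitive_sub (f : R -> R) (Y : R -> Prop) : Prop :=
  forall O1 O2, open_set O1 -> open_set O2 ->
    (exists y, Y y /\ O1 y) -> (exists y, Y y /\ O2 y) ->
    exists n x, Y x /\ O1 x /\ Y (iter n f x) /\ O2 (iter n f x).

Definition sensitive3_sub (f : R -> R) (Y : R -> Prop) : Prop :=
  exists delta, 0 < delta /\
    forall O, open_set O -> (exists y, Y y /\ O y) ->
      exists x1 x2 x3 k,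
        Y x1 /\ O x1 /\ Y x2 /\ O x2 /\ Y x3 /\ O x3 /\
        x1 <> x2 /\ x1 <> x3 /\ x2 <> x3 /\ (k >= 1)%nat /\
        delta <= min3 (dist_n f x1 x2 k) (dist_n f x1 x3 k) (dist_n f x2 x3 k).

(** independence sets for (A 0, A 1, A 2); finite J given as a duplicate-free list;
    s : F -> {1,2,3} encoded as s : nat -> nat with values < 3 on F. *)
Definition indep_set (f : R -> R) (A : nat -> R -> Prop) (J : list nat) : Prop :=
  forall (F : list nat) (s : nat -> nat),
    F <> [] -> (forall i, In i F -> In i J) -> (forall i, In i F -> (s i < 3)%nat) ->
    exists x, inI x /\ forall i, In i F -> A (s i) (iter i f x).

(** IN-tuple: for all neighborhoods U_j of x_j, (U_1,U_2,U_3) has arbitrarily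
    long finite independence sets. Neighborhoods are taken relative to I. *)
Definition IN_tuple3 (f : R -> R) (x1 x2 x3 : R) : Prop :=
  inI x1 /\ inI x2 /\ inI x3 /\
  forall U1 U2 U3, neighbourhood U1 x1 -> neighbourhood U2 x2 -> neighbourhood U3 x3 ->
    forall m, exists J, NoDup J /\ (length J >= m)%nat /\
      indep_set f (fun j y => inI y /\
                     match j with 0%nat => U1 y | 1%nat => U2 y | _ => U3 y end) J.

Definition essential_IN_tuple3 (f : R -> R) (x1 x2 x3 : R) : Prop :=
  IN_tuple3 f x1 x2 x3 /\ x1 <> x2 /\ x1 <> x3 /\ x2 <> x3.

(* Main.v *)
From mathcomp Require classical_sets.
From Stdlib Require Import Reals Lra Lia List ZArith FinFun Cantor Classical ClassicalEpsilon.
Require Import Defs.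
Open Scope R_scope.

(** Everything is compared with turbulence of iterates: some [f^n] has two intervals with at most
    one common point each of which covers their union.

    If no iterate is turbulent, every orbit of every iterate converges or eventually alternates
    around a fixed point. Applied to all [f^(2^k)], this places any orbit that is not asymptotically
    periodic into a binary tree of residue classes modulo [2^k], cut out by separating periodic points.
    Two such orbits are proximal exactly when they are cut by the same separators in the same phase,
    which makes proximality transitive and controls maximal scrambled sets; at most two limit points
    of an orbit are never cut apart, which excludes 3-scrambled tuples and 3-sensitive transitive
    subsystems. Large independence sets of three disjoint neighbourhoods produce a
    periodic point next to the middle one together with two orbits which leave it to opposite sides and
    then change sides, which is impossible. Positive entropy yields such patterns through the
    Karpovsky-Milman lemma.

    If some iterate is turbulent, a power of it has four disjoint intervals each covering them all, and
    every required object is obtained by following prescribed chains of intervals; small intervals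
    that still spread over everything exist by repeated halving. *)

(** * Orbits of maps without turbulent iterates *)

(** Turbulence is a convenient pivot because finitely many inequalities between orbit points witness
    it: its absence is contradicted by naming three points, usually one or two fixed points and a
    point of a wandering orbit. Powers of two enter because an orbit of [g] that alternates around a
    fixed point eventually stays on one side of it under [g^2], so the dichotomy for [g^2] has to
    cut it at a new point, and so on. Alternation alone is qualitative; the obstacle is to extract
    distances from it. The separator of level [k+1] supplies them: it keeps the orbit away from the
    separator of level [k], with a bound that depends on the map, the two separators and their
    phases, but not on the orbit. This uniformity turns one non-proximal pair into separability of
    two whole scrambled sets. In the turbulent case two disjoint pairs of intervals carry two orbits
    that stay apart forever, while a third orbit approaches both in turn; maximal scrambled sets
    that share this third point are then neither equivalent nor separable. *)

Lemma iter_add (m n : nat) (f : R -> R) (x : R) :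
  iter (m + n) f x = iter m f (iter n f x).
Proof. induction m as [|m IH]; simpl; congruence. Qed.

Lemma iter_mul (n m : nat) (f : R -> R) (x : R) :
  iter n (iter m f) x = iter (n * m) f x.
Proof.
  induction n as [|n IH]; simpl; [reflexivity|].
  rewrite iter_add. congruence.
Qed.

Lemma iter_inI f n x : CII f -> inI x -> inI (iter n f x).
Proof.
  intros [H _] Hx. induction n as [|n IH]; simpl; auto.
Qed.

Lemma iter_fixed f n x : f x = x -> iter n f x = x.
Proof. intros H. induction n as [|n IH]; simpl; congruence. Qed.

(** Retraction of the line onto I. Composing with it extends a map of I continuously to all of R,
    the setting in which the intermediate value, Heine and extreme value theorems are applied. *)
Definition clamp (t : R) : R := Rmax 0 (Rmin 1 t).

Lemma clamp_inI t : inI (clamp t).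
Proof. unfold clamp, inI, Rmax, Rmin. destruct (Rle_dec 1 t); destruct (Rle_dec 0 _); lra. Qed.

Lemma clamp_id t : inI t -> clamp t = t.
Proof. unfold clamp, inI, Rmax, Rmin. intros. destruct (Rle_dec 1 t); destruct (Rle_dec 0 _); lra. Qed.

Lemma clamp_lip s t : Rabs (clamp s - clamp t) <= Rabs (s - t).
Proof.
  unfold clamp, Rmax, Rmin.
  destruct (Rle_dec 1 s); destruct (Rle_dec 0 _); destruct (Rle_dec 1 t); destruct (Rle_dec 0 _);
  unfold Rabs; repeat destruct (Rcase_abs _); lra.
Qed.

Lemma clamp_cont f : CII f -> continuity (fun t => f (clamp t)).
Proof.
  intros [_ H] t eps He.
  destruct (H (clamp t) (clamp_inI t) eps He) as [d [Hd H1]].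
  exists d; split; [exact Hd|]. intros s [_ Hs]. simpl in *. unfold Rdist in *.
  apply H1; [apply clamp_inI|]. eapply Rle_lt_trans; [apply clamp_lip|exact Hs].
Qed.

Lemma ivt_aux f u v c : CII f -> inI u -> inI v -> u <= v ->
  (f u - c) * (f v - c) <= 0 -> exists t, u <= t <= v /\ f t = c.
Proof.
  intros Hf Hu Hv Huv H.
  destruct (IVT_cor (fun t => f (clamp t) - c) u v) as [t [Ht E]].
  - change (continuity ((fun t => f (clamp t)) - (fun _ => c))%F).
    apply continuity_minus; [apply clamp_cont, Hf|].
    apply continuity_const. intros ? ?; reflexivity.
  - exact Huv.
  - rewrite !clamp_id by assumption. exact H.
  - exists t. split; [exact Ht|]. rewrite clamp_id in E; [lra|].
    unfold inI in *; lra.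
Qed.

Lemma ivt f u v c : CII f -> inI u -> inI v -> u <= v ->
  (f u <= c <= f v \/ f v <= c <= f u) -> exists t, u <= t <= v /\ f t = c.
Proof. intros Hf Hu Hv Huv H. apply ivt_aux; try assumption. nra. Qed.

Lemma unif_cont f eps : CII f -> 0 < eps ->
  exists d, 0 < d /\ forall x y, inI x -> inI y -> Rabs (x - y) < d -> Rabs (f x - f y) < eps.
Proof.
  intros Hf He.
  assert (Hc : forall x, 0 <= x <= 1 -> continuity_pt (fun t => f (clamp t)) x)
    by (intros x _; apply clamp_cont, Hf).
  destruct (Heine_cor2 Hc (mkposreal eps He)) as [d Hd]. simpl in Hd.
  exists d. split; [apply cond_pos|]. intros x y Hx Hy H.
  specialize (Hd x y Hx Hy H). rewrite !clamp_id in Hd by assumption. exact Hd.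
Qed.

Lemma unif_cont_iter f M eps : CII f -> 0 < eps ->
  exists d, 0 < d /\ forall x y, inI x -> inI y -> Rabs (x - y) < d ->
    forall m, (m <= M)%nat -> Rabs (iter m f x - iter m f y) < eps.
Proof.
  intros Hf He. induction M as [|M [d [Hd IH]]].
  - exists eps. split; [exact He|]. intros x y _ _ H m Hm.
    replace m with 0%nat by lia. exact H.
  - destruct (unif_cont f (Rmin d eps) Hf) as [d' [Hd' H']]; [apply Rmin_pos; assumption|].
    exists (Rmin d' eps). split; [apply Rmin_pos; assumption|].
    intros x y Hx Hy H m Hm.
    pose proof (Rmin_l d' eps). pose proof (Rmin_r d' eps).
    destruct m as [|m]; [simpl; lra|].
    replace (S m) with (m + 1)%nat by lia. rewrite !iter_add. simpl.
    pose proof (Rmin_l d eps).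
    apply IH; [apply Hf, Hx|apply Hf, Hy| |lia].
    assert (Rabs (f x - f y) < Rmin d eps) by (apply H'; try assumption; lra). lra.
Qed.

Lemma CII_iter f n : CII f -> CII (iter n f).
Proof.
  intros Hf. split; [intros; apply iter_inI; assumption|].
  intros x Hx eps He.
  destruct (unif_cont_iter f n eps Hf He) as [d [Hd H]].
  exists d. split; [exact Hd|]. intros y Hy Hyx. apply (H y x Hy Hx Hyx n). lia.
Qed.

(* The covering relations [g([a,b]) >= [a,c]] and [g([b,c]) >= [a,c]] are recorded through
   witness points; continuity recovers the coverings. *)
Definition turb (g : R -> R) : Prop :=
  exists a b c, inI a /\ inI c /\ a < b < c /\
    (exists s, a <= s <= b /\ g s <= a) /\ (exists s, a <= s <= b /\ c <= g s) /\
    (exists s, b <= s <= c /\ g s <= a) /\ (exists s, b <= s <= c /\ c <= g s).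

Definition NT (f : R -> R) : Prop := forall n, (1 <= n)%nat -> ~ turb (iter n f).

Lemma turb_ext g h : (forall x, inI x -> g x = h x) -> turb g -> turb h.
Proof.
  intros E (a & b & c & Ha & Hc & Hab & (s1 & H1 & E1) & (s2 & H2 & E2) & (s3 & H3 & E3) & (s4 & H4 & E4)).
  exists a, b, c. unfold inI in *.
  repeat split; try lra.
  - exists s1. rewrite <- E by lra. auto.
  - exists s2. rewrite <- E by lra. auto.
  - exists s3. rewrite <- E by lra. auto.
  - exists s4. rewrite <- E by lra. auto.
Qed.

Lemma NT_iter f m : (1 <= m)%nat -> NT f -> NT (iter m f).
Proof.
  intros Hm H n Hn T. apply (H (n * m)%nat); [nia|].
  eapply turb_ext; [|exact T]. intros x _. apply iter_mul.
Qed.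

(** Conjugation by the reflection [x -> 1 - x]. It exchanges left and right, so each one-sided lemma
    yields its mirror image. *)
Definition rf (f : R -> R) : R -> R := fun x => 1 - f (1 - x).

Lemma rf_iter f n x : iter n (rf f) x = 1 - iter n f (1 - x).
Proof.
  induction n as [|n IH]; simpl; [lra|]. rewrite IH. unfold rf.
  do 2 f_equal. lra.
Qed.

Lemma CII_rf f : CII f -> CII (rf f).
Proof.
  intros [H1 H2]. unfold rf. split.
  - intros x Hx. assert (inI (f (1 - x))) by (apply H1; unfold inI in *; lra). unfold inI in *; lra.
  - intros x Hx eps He. destruct (H2 (1 - x) ltac:(unfold inI in *; lra) eps He) as [d [Hd H]].
    exists d. split; [exact Hd|]. intros y Hy Hyx.
    replace (1 - f (1 - y) - (1 - f (1 - x))) with (- (f (1 - y) - f (1 - x))) by lra.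
    rewrite Rabs_Ropp. apply H; [unfold inI in *; lra|].
    replace (1 - y - (1 - x)) with (- (y - x)) by lra. rewrite Rabs_Ropp. exact Hyx.
Qed.

Lemma turb_rf g : turb (rf g) -> turb g.
Proof.
  intros (a & b & c & Ha & Hc & Hab & (s1 & H1 & E1) & (s2 & H2 & E2) & (s3 & H3 & E3) & (s4 & H4 & E4)).
  unfold rf in *. exists (1 - c), (1 - b), (1 - a). unfold inI in *.
  repeat split; try lra.
  - exists (1 - s4); split; lra.
  - exists (1 - s3); split; lra.
  - exists (1 - s2); split; lra.
  - exists (1 - s1); split; lra.
Qed.

Lemma NT_rf f : NT f -> NT (rf f).
Proof.
  intros H n Hn T. apply (H n Hn). apply turb_rf.
  eapply turb_ext; [|exact T]. intros x _. rewrite rf_iter. reflexivity.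
Qed.

Lemma lub_pt (A : R -> Prop) : (exists x, A x) -> (forall x, A x -> inI x) ->
  exists s, inI s /\ (forall x, A x -> x <= s) /\ (forall e, 0 < e -> exists x, A x /\ s - e < x).
Proof.
  intros [x0 H0] HI.
  destruct (completeness A) as [s [Hub Hl]].
  - exists 1. intros x Hx. apply HI in Hx. unfold inI in Hx; lra.
  - exists x0; exact H0.
  - exists s. assert (0 <= s) by (pose proof (HI x0 H0) as [? ?]; pose proof (Hub x0 H0); lra).
    assert (s <= 1) by (apply Hl; intros x Hx; apply HI in Hx; unfold inI in Hx; lra).
    repeat split; try assumption.
    intros e He. apply NNPP. intros C. assert (s <= s - e); [|lra].
    apply Hl. intros x Hx. destruct (Rle_lt_dec x (s - e)); [assumption|].
    exfalso. apply C. exists x. split; assumption.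
Qed.

Lemma lub_below_image f (A : R -> Prop) s : CII f -> inI s -> (forall x, A x -> inI x) ->
  (forall x, A x -> x <= f x) -> (forall x, A x -> x <= s) ->
  (forall e, 0 < e -> exists x, A x /\ s - e < x) -> s <= f s.
Proof.
  intros Hf Hs HI HA Hub Happ. destruct (Rle_lt_dec s (f s)) as [|Hlt]; [assumption|]. exfalso.
  destruct (proj2 Hf s Hs ((s - f s) / 2)) as [d [Hd H]]; [lra|].
  destruct (Happ (Rmin d ((s - f s) / 2))) as [t [Ht Hst]]; [apply Rmin_pos; lra|].
  pose proof (Rmin_l d ((s - f s) / 2)). pose proof (Rmin_r d ((s - f s) / 2)).
  specialize (HA t Ht). specialize (Hub t Ht).
  assert (Hd' : Rabs (t - s) < d) by (apply Rabs_def1; lra).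
  apply H in Hd'; [|apply HI, Ht]. apply Rabs_def2 in Hd'. lra.
Qed.

(** The point is the supremum of the [t <= x] with [t <= f t]. If [f] moved it strictly upwards,
    continuity would do the same to points slightly to its right, which descend. *)
Lemma last_fixed_below f x : CII f -> inI x -> f x < x ->
  exists y, 0 <= y < x /\ f y = y /\ forall t, y < t <= x -> f t < t.
Proof.
  intros Hf Hx Hfx.
  destruct (lub_pt (fun t => 0 <= t <= x /\ t <= f t)) as [y [Hy [Hub Happ]]].
  - exists 0. unfold inI in Hx. split; [lra|]. apply Hf. unfold inI; lra.
  - unfold inI in *; intros t [Ht _]; lra.
  - assert (Hyx : y <= x).
    { destruct (Rle_lt_dec y x); [assumption|]. destruct (Happ (y - x)) as [t [[Ht _] Ht']]; lra. }
    assert (H1 : y <= f y).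
    { apply (lub_below_image f (fun t => 0 <= t <= x /\ t <= f t)); auto; [|tauto].
      unfold inI in *; intros t [Ht _]; lra. }
    assert (Hlt : y < x) by (destruct (Req_dec y x); [subst; lra|lra]).
    assert (Hab : forall t, y < t <= x -> f t < t).
    { intros t Ht. destruct (Rlt_le_dec (f t) t); [assumption|].
      assert (t <= y) by (apply Hub; unfold inI in *; split; lra). lra. }
    exists y. unfold inI in Hy. split; [lra|]. split; [|exact Hab].
    destruct (Rle_lt_dec (f y) y) as [|Hgt]; [lra|]. exfalso.
    destruct (proj2 Hf y Hy ((f y - y) / 2)) as [d [Hd H]]; [lra|].
    set (t := y + Rmin (Rmin (d / 2) (x - y)) ((f y - y) / 2)).
    assert (0 < Rmin (Rmin (d / 2) (x - y)) ((f y - y) / 2)) by (repeat apply Rmin_pos; lra).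
    pose proof (Rmin_l (Rmin (d / 2) (x - y)) ((f y - y) / 2)).
    pose proof (Rmin_r (Rmin (d / 2) (x - y)) ((f y - y) / 2)).
    pose proof (Rmin_l (d / 2) (x - y)). pose proof (Rmin_r (d / 2) (x - y)).
    assert (Ht : f t < t) by (apply Hab; unfold t; lra).
    assert (Hd' : Rabs (t - y) < d) by (unfold t, Rabs; destruct (Rcase_abs _); lra).
    specialize (H t ltac:(unfold inI, t in *; lra) Hd'). unfold t in *.
    unfold Rabs in H; destruct (Rcase_abs _); lra.
Qed.

(* The orbit of [x] first decreases, so it can only jump above [zeta] after passing below the last
   fixed point under [x]; this makes [f^m] turbulent. *)
Lemma down_no_jump f x m zeta : CII f -> NT f -> inI x -> f x < x -> f zeta = zeta ->
  x < zeta -> zeta < iter m f x -> False.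
Proof.
  intros Hf HN Hx Hfx Hz Hxz Hm.
  destruct (last_fixed_below f x Hf Hx Hfx) as [y [Hy [Hfy Hlt]]].
  assert (Hw := iter_inI f m x Hf Hx).
  assert (Hex : exists l, (l <= m)%nat /\ iter l f x <= y).
  { apply NNPP. intros C.
    assert (Hall : forall l, (l <= m)%nat -> y < iter l f x <= x).
    { induction l as [|l IH]; intros Hl; [simpl; lra|].
      specialize (IH ltac:(lia)). simpl. pose proof (Hlt _ IH). split; [|lra].
      destruct (Rle_lt_dec (f (iter l f x)) y); [|assumption].
      exfalso. apply C. exists (S l). split; [lia|assumption]. }
    specialize (Hall m ltac:(lia)). lra. }
  destruct Hex as [l [Hl Hly]].
  assert (m <> 0)%nat by (intros ->; simpl in Hm; lra).
  apply (HN m); [lia|].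
  (* On [[y, x]] the fixed point [y] and the jump of [x] beyond [zeta] give both ends. On
     [[x, zeta]] the [l]-th iterate takes the value [y], which later iterates keep, and [zeta] is
     fixed. *)
  unfold inI in *. exists y, x, zeta. unfold inI. repeat split; try lra.
  - exists y. rewrite iter_fixed by assumption. lra.
  - exists x. lra.
  - destruct (ivt (iter l f) x zeta y) as [t [Ht Et]].
    + apply CII_iter, Hf.
    + unfold inI; lra.
    + unfold inI; lra.
    + lra.
    + left. rewrite (iter_fixed f l zeta) by assumption. lra.
    + exists t. split; [exact Ht|]. replace m with ((m - l) + l)%nat by lia.
      rewrite iter_add, Et, iter_fixed by assumption. lra.
  - exists zeta. rewrite iter_fixed by assumption. lra.
Qed.

Lemma up_no_jump f x m zeta : CII f -> NT f -> inI x -> x < f x -> f zeta = zeta ->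
  zeta < x -> iter m f x < zeta -> False.
Proof.
  intros Hf HN Hx Hfx Hz Hxz Hm.
  apply (down_no_jump (rf f) (1 - x) m (1 - zeta)).
  - apply CII_rf, Hf.
  - apply NT_rf, HN.
  - unfold inI in *; lra.
  - unfold rf. replace (1 - (1 - x)) with x by lra. lra.
  - unfold rf. replace (1 - (1 - zeta)) with zeta by lra. lra.
  - lra.
  - rewrite rf_iter. replace (1 - (1 - x)) with x by lra. lra.
Qed.

Lemma fixed_between f u v : CII f -> inI u -> inI v -> u < v ->
  (f u < u /\ v < f v) \/ (u < f u /\ f v < v) -> exists z, u < z < v /\ f z = z.
Proof.
  intros Hf Hu Hv Huv H.
  destruct (IVT_cor (fun t => f (clamp t) - t) u v) as [t [Ht E]].
  - change (continuity ((fun t => f (clamp t)) - id)%F).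
    apply continuity_minus; [apply clamp_cont, Hf|].
    intros x. apply derivable_continuous_pt, derivable_pt_id.
  - lra.
  - rewrite !clamp_id by assumption. nra.
  - rewrite clamp_id in E by (unfold inI in *; lra).
    exists t. split; [|lra].
    assert (t <> u) by (intros ->; lra). assert (t <> v) by (intros ->; lra). lra.
Qed.

(** * Convergence or alternation of a single orbit *)

Definition conv (g : R -> R) (x : R) : Prop := exists q, Un_cv (fun n => iter n g x) q.

Lemma Un_cv_shift (u : nat -> R) N q : Un_cv (fun n => u (n + N)%nat) q -> Un_cv u q.
Proof.
  intros H eps He. destruct (H eps He) as [M HM]. exists (M + N)%nat.
  intros n Hn. specialize (HM (n - N)%nat ltac:(lia)). simpl in HM.
  replace (n - N + N)%nat with n in HM by lia. exact HM.
Qed.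

Lemma monotone_conv g x N : CII g -> inI x ->
  (forall n, (n >= N)%nat -> iter n g x <= iter (S n) g x) -> conv g x.
Proof.
  intros Hg Hx Hm.
  destruct (growing_cv (fun n => iter (n + N) g x)) as [q Hq].
  - intros n. apply (Hm (n + N)%nat). lia.
  - exists 1. intros t [n ->]. apply (iter_inI g (n + N) x Hg Hx).
  - exists q. apply (Un_cv_shift _ N). exact Hq.
Qed.

Lemma conv_rf g x : conv (rf g) (1 - x) -> conv g x.
Proof.
  intros [q Hq]. exists (1 - q). intros eps He. destruct (Hq eps He) as [N HN].
  exists N. intros n Hn. specialize (HN n Hn). rewrite rf_iter in HN.
  replace (1 - (1 - x)) with x in HN by lra. unfold Rdist in *.
  replace (iter n g x - (1 - q)) with (- (1 - iter n g x - q)) by lra.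
  rewrite Rabs_Ropp. exact HN.
Qed.

(** Some point of [[p, q]] is sent to the fixed point [z] in one step and stays there, while [q] is
    sent below [p]. Hence [p < q < z] witnesses turbulence of [f^k]. *)
Lemma fold_turb f k p q z : CII f -> NT f -> inI p -> inI z -> (1 <= k)%nat ->
  p < q < z -> f z = z -> f p <= z <= f q -> iter k f q <= p -> False.
Proof.
  intros Hf HN Hp Hz Hk Hpq Hfz Hpz Hq.
  apply (HN k Hk). unfold inI in *. exists p, q, z. unfold inI. repeat split; try lra.
  - exists q; lra.
  - destruct (ivt f p q z) as [t [Ht Et]]; unfold inI; try lra; [exact Hf|].
    exists t. split; [exact Ht|]. replace k with ((k - 1) + 1)%nat by lia.
    rewrite iter_add. simpl. rewrite Et, iter_fixed by assumption. lra.
  - exists q; lra.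
  - exists z. rewrite iter_fixed by assumption. lra.
Qed.

(* If the orbit makes two consecutive visits to the left of [z] infinitely often, then [fold_turb]
   forces those visits to increase towards [z]. *)
Lemma left_visits_tend f x z : CII f -> NT f -> inI x -> inI z -> f z = z ->
  (forall n, iter n f x < z -> iter n f x < f (iter n f x)) ->
  (forall n, iter n f x <> z) ->
  (forall N, exists n, (n >= N)%nat /\ iter n f x < z /\ iter (S n) f x < z) ->
  (forall N, exists n, (n >= N)%nat /\ z < iter n f x) ->
  forall e, 0 < e -> exists N, forall n, (n >= N)%nat -> z - e < iter n f x.
Proof.
  intros Hf HN Hx Hz Hfz HU Hne HUU HD e He.
  set (X := fun n => iter n f x) in *.
  assert (HXI : forall n, inI (X n)) by (intros n; apply iter_inI; assumption).
  assert (HXS : forall n, X (S n) = f (X n)) by reflexivity.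
  assert (HXadd : forall k n, iter k f (X n) = X (k + n)%nat)
    by (intros k n; unfold X; rewrite iter_add; reflexivity).
  (* [W n] marks the last two visits of a run on the left of [z], just before the orbit crosses.
     Such a fold recurs because runs of length two recur and the orbit returns to the right. *)
  pose (W := fun n => X n < z /\ X (S n) < z /\ z < X (S (S n))).
  assert (HW : forall N, exists n, (n >= N)%nat /\ W n).
  { intros N. destruct (HUU N) as [n [Hn [H1 H2]]]. apply NNPP. intros C.
    destruct (HD n) as [d [Hd Hdz]].
    assert (Hall : forall i, X (i + n)%nat < z /\ X (S (i + n)) < z).
    { induction i as [|i [I1 I2]]; [split; assumption|]. split; [exact I2|].
      destruct (Rtotal_order (X (S (S i + n))) z) as [?|[E|G]]; [assumption| |].
      - exfalso. exact (Hne _ E).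
      - exfalso. apply C. exists (i + n)%nat. split; [lia|]. repeat split; assumption. }
    destruct (Hall (d - n)%nat) as [I1 _]. replace (d - n + n)%nat with d in I1 by lia.
    unfold X in I1. lra. }
  (* Both claims come from [fold_turb] with [q = X (S n)]. With [p = X n] no later iterate falls
     back to [X n]; with [p = X m] the folds are ordered, the whole of fold [n] lying left of fold
     [m]. *)
  assert (Ha : forall n l, W n -> (l > S n)%nat -> X n < X l).
  { intros n l [W1 [W2 W3]] Hl. destruct (Rlt_le_dec (X n) (X l)); [assumption|]. exfalso.
    apply (fold_turb f (l - S n) (X n) (X (S n)) z); auto; try lia.
    - split; [|assumption]. rewrite HXS. apply HU. assumption.
    - rewrite <- !HXS. lra.
    - rewrite HXadd. replace (l - S n + S n)%nat with l by lia. assumption. }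
  assert (Hb : forall n m, W n -> W m -> (m > S n)%nat -> X (S n) <= X m).
  { intros n m [W1 [W2 W3]] [V1 [V2 V3]] Hl. destruct (Rle_lt_dec (X (S n)) (X m)); [assumption|]. exfalso.
    apply (fold_turb f (m - S n) (X m) (X (S n)) z); auto; try lia.
    - rewrite <- !HXS. lra.
    - rewrite HXadd. replace (m - S n + S n)%nat with m by lia. lra. }
  destruct (lub_pt (fun t => exists n, W n /\ t = X n)) as [s [Hs [Hub Happ]]].
  { destruct (HW 0%nat) as [n [_ Hn]]. exists (X n), n. auto. }
  { intros t [n [_ ->]]. apply HXI. }
  assert (Hsz : s <= z).
  { destruct (Rle_lt_dec s z); [assumption|]. destruct (Happ (s - z)) as [t [[n [[W1 _] ->]] Ht]]; lra. }
  assert (Es : s = z).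
  { destruct (Req_dec s z) as [|Hn]; [assumption|]. exfalso.
    destruct (proj2 Hf s Hs ((z - s) / 2)) as [d [Hd H]]; [lra|].
    destruct (Happ d Hd) as [t [[n [Wn ->]] Ht]].
    destruct (HW (S (S n))) as [m [Hm Wm]].
    assert (X (S n) <= X m) by (apply Hb; auto).
    assert (X m <= s) by (apply Hub; exists m; auto).
    assert (X n < X (S n)) by (rewrite HXS; apply HU; apply Wn).
    assert (A1 : Rabs (X n - s) < d) by (unfold Rabs; destruct (Rcase_abs _); lra).
    assert (A2 : Rabs (X (S n) - s) < d) by (unfold Rabs; destruct (Rcase_abs _); lra).
    apply H in A1; [|apply HXI]. apply H in A2; [|apply HXI].
    rewrite <- HXS in A1, A2. destruct Wn as [W1 [W2 W3]].
    unfold Rabs in A1, A2; repeat destruct (Rcase_abs _); lra. }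
  subst s. destruct (Happ e He) as [t [[n [Wn ->]] Ht]].
  exists (S (S n)). intros l Hl. assert (X n < X l) by (apply Ha; auto). unfold X in *. lra.
Qed.

Lemma right_visits_tend f x z : CII f -> NT f -> inI x -> inI z -> f z = z ->
  (forall n, z < iter n f x -> f (iter n f x) < iter n f x) ->
  (forall n, iter n f x <> z) ->
  (forall N, exists n, (n >= N)%nat /\ z < iter n f x /\ z < iter (S n) f x) ->
  (forall N, exists n, (n >= N)%nat /\ iter n f x < z) ->
  forall e, 0 < e -> exists N, forall n, (n >= N)%nat -> iter n f x < z + e.
Proof.
  intros Hf HN Hx Hz Hfz HU Hne HUU HD e He.
  assert (E : forall n, iter n (rf f) (1 - x) = 1 - iter n f x).
  { intros n. rewrite rf_iter. do 2 f_equal. lra. }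
  destruct (left_visits_tend (rf f) (1 - x) (1 - z)) with (e := e) as [N HN'].
  - apply CII_rf, Hf.
  - apply NT_rf, HN.
  - unfold inI in *; lra.
  - unfold inI in *; lra.
  - unfold rf. replace (1 - (1 - z)) with z by lra. lra.
  - intros n. rewrite E. unfold rf. replace (1 - (1 - iter n f x)) with (iter n f x) by lra.
    intros H. assert (z < iter n f x) by lra. apply HU in H0. lra.
  - intros n. rewrite E. intros H. apply (Hne n). lra.
  - intros N. destruct (HUU N) as [n Hn]. exists n. rewrite !E. repeat split; lra || apply Hn.
  - intros N. destruct (HD N) as [n Hn]. exists n. rewrite !E. repeat split; lra || apply Hn.
  - exact He.
  - exists N. intros n Hn. specialize (HN' n Hn). rewrite E in HN'. lra.
Qed.

(** The boolean is the phase: [b = true] puts the even times on the left of [z] and the odd times on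
    the right. *)
Definition alt (g : R -> R) (z : R) (b : bool) (x : R) : Prop :=
  exists N, forall n, (n >= N)%nat ->
    if xorb b (Nat.odd n) then iter n g x < z else z < iter n g x.

Lemma alt_of_steps g z x N : 
  (forall n, (n >= N)%nat -> iter n g x < z -> z < iter (S n) g x) ->
  (forall n, (n >= N)%nat -> z < iter n g x -> iter (S n) g x < z) ->
  iter N g x <> z -> exists b, alt g z b x.
Proof.
  intros H1 H2 Hne.
  assert (Hg : forall (c : bool), (if c then iter N g x < z else z < iter N g x) ->
     alt g z (xorb c (Nat.odd N)) x).
  { intros c Hc. exists N. intros n Hn.
    replace n with ((n - N) + N)%nat by lia. generalize (n - N)%nat. clear n Hn. intros k.
    rewrite Nat.odd_add.
    replace (xorb (xorb c (Nat.odd N)) (xorb (Nat.odd k) (Nat.odd N))) with (xorb c (Nat.odd k))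
      by (destruct c, (Nat.odd k), (Nat.odd N); reflexivity).
    induction k as [|k IH]; [simpl; rewrite Bool.xorb_false_r; exact Hc|].
    rewrite Nat.odd_succ, <- Nat.negb_odd.
    replace (S k + N)%nat with (S (k + N)) by lia.
    destruct c, (Nat.odd k); simpl xorb in *; cbv iota in *;
      first [apply H1; [lia|exact IH] | apply H2; [lia|exact IH]]. }
  destruct (Rtotal_order (iter N g x) z) as [L|[E|G]].
  - exists (xorb true (Nat.odd N)). apply Hg. exact L.
  - contradiction.
  - exists (xorb false (Nat.odd N)). apply Hg. exact G.
Qed.

(** A non-convergent orbit ascends and descends infinitely often. All its ascending points lie left
    of all its descending ones, so a fixed point [z] separates them. If two consecutive visits to
    one side recur, the visits to that side tend to [z], then those to the other side as well, and
    the orbit converges. Otherwise the sides finally alternate. *)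
Theorem conv_or_alt f x : CII f -> NT f -> inI x ->
  conv f x \/ exists z b, inI z /\ f z = z /\ alt f z b x.
Proof.
  intros Hf HN Hx.
  destruct (classic (conv f x)) as [|HC]; [left; assumption|right].
  set (X := fun n => iter n f x) in *.
  assert (HXI : forall n, inI (X n)) by (intros n; apply iter_inI; assumption).
  assert (HXS : forall n, X (S n) = f (X n)) by reflexivity.
  assert (HXadd : forall k n, iter k f (X n) = X (k + n)%nat)
    by (intros k n; unfold X; rewrite iter_add; reflexivity).
  assert (Hnf : forall n, X (S n) <> X n).
  { intros n E. apply HC. apply (monotone_conv f x n Hf Hx). intros m Hm.
    assert (E' : forall j, X (j + n)%nat = X n).
    { intros j. rewrite <- HXadd. apply iter_fixed. rewrite <- HXS. exact E. }
    change (X m <= X (S m)). replace m with ((m - n) + n)%nat by lia.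
    replace (S (m - n + n)) with (S (m - n) + n)%nat by lia. rewrite !E'. lra. }
  assert (HDio : forall N, exists n, (n >= N)%nat /\ X (S n) < X n).
  { intros N. apply NNPP. intros C. apply HC. apply (monotone_conv f x N Hf Hx).
    intros n Hn. change (X n <= X (S n)). destruct (Rle_lt_dec (X n) (X (S n))); [assumption|].
    exfalso. apply C. exists n. auto. }
  assert (HUio : forall N, exists n, (n >= N)%nat /\ X n < X (S n)).
  { intros N. apply NNPP. intros C. apply HC. apply conv_rf.
    apply (monotone_conv (rf f) (1 - x) N (CII_rf f Hf)); [unfold inI in *; lra|].
    intros n Hn. rewrite !rf_iter. replace (1 - (1 - x)) with x by lra.
    change (1 - X n <= 1 - X (S n)). destruct (Rle_lt_dec (X (S n)) (X n)); [lra|].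
    exfalso. apply C. exists n. auto. }
  (* An ascending point to the right of a descending one leaves a fixed point between them.
     Whichever of the two is visited first, the orbit then crosses this fixed point in the direction
     opposite to its first move. *)
  assert (HUD : forall i j, X i < X (S i) -> X (S j) < X j -> X i < X j).
  { intros i j Hi Hj.
    assert (X i <> X j) by (intros E; rewrite !HXS, E in *; lra).
    destruct (Rlt_le_dec (X i) (X j)) as [|Hle]; [assumption|]. exfalso.
    assert (Hlt : X j < X i) by lra.
    rewrite !HXS in Hi, Hj.
    destruct (fixed_between f (X j) (X i) Hf (HXI j) (HXI i) Hlt) as [ze [Hze Efz]];
      [left; split; assumption|].
    destruct (Nat.lt_trichotomy i j) as [L|[E|G]].
    - apply (up_no_jump f (X i) (j - i) ze); auto; try lra.
      rewrite HXadd. replace (j - i + i)%nat with j by lia. lra.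
    - subst. lra.
    - apply (down_no_jump f (X j) (i - j) ze); auto; try lra.
      rewrite HXadd. replace (i - j + j)%nat with i by lia. lra. }
  assert (Hz : exists z, inI z /\ f z = z /\ (forall n, X n < X (S n) -> X n < z) /\
                        (forall n, X (S n) < X n -> z < X n)).
  { destruct (lub_pt (fun t => exists n, X n < X (S n) /\ t = X n)) as [s [Hs [Hub Happ]]].
    { destruct (HUio 0%nat) as [n [_ Hn]]. exists (X n), n. auto. }
    { intros t [n [_ ->]]. apply HXI. }
    assert (HsD : forall j, X (S j) < X j -> s <= X j).
    { intros j Hj. destruct (Rle_lt_dec s (X j)); [assumption|].
      destruct (Happ (s - X j)) as [t [[i [Hi ->]] Ht]]; [lra|]. specialize (HUD i j Hi Hj). lra. }
    assert (Hfs : s <= f s).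
    { apply (lub_below_image f (fun t => exists n, X n < X (S n) /\ t = X n)); auto.
      - intros t [n [_ ->]]. apply HXI.
      - intros t [n [Hn ->]]. rewrite HXS in Hn. lra. }
    destruct (Req_dec (f s) s) as [Es|Es].
    - exists s. split; [exact Hs|]. split; [exact Es|]. split.
      + intros n Hn. assert (X n <= s) by (apply Hub; exists n; auto).
        assert (X n <> s) by (intros E; rewrite HXS, E in Hn; lra). lra.
      + intros n Hn. specialize (HsD n Hn).
        assert (X n <> s) by (intros E; rewrite HXS, E in Hn; lra). lra.
    - (* [1 - d0] is the infimum of the descending points *)
      destruct (HDio 0%nat) as [j0 [_ Hj0]].
      destruct (lub_pt (fun t => exists n, X (S n) < X n /\ t = 1 - X n)) as [d0 [Hd0 [Hub' Happ']]].
      { exists (1 - X j0), j0. auto. }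
      { intros t [n [_ ->]]. specialize (HXI n). unfold inI in *; lra. }
      set (q := 1 - d0). assert (Hq : inI q) by (unfold q, inI in *; lra).
      assert (Hqf : f q <= q).
      { assert (H : d0 <= rf f d0); [|unfold rf, q in *; lra].
        apply (lub_below_image (rf f) (fun t => exists n, X (S n) < X n /\ t = 1 - X n)); auto.
        - apply CII_rf, Hf.
        - intros t [n [_ ->]]. specialize (HXI n). unfold inI in *; lra.
        - intros t [n [Hn ->]]. rewrite HXS in Hn. unfold rf. replace (1 - (1 - X n)) with (X n) by lra. lra. }
      assert (Hsq : s <= q).
      { destruct (Rle_lt_dec s q) as [|Hlt]; [assumption|]. exfalso. unfold q in *.
        destruct (Happ' (s - (1 - d0))) as [t [[i [Hi ->]] Ht]]; [lra|]. specialize (HsD i Hi). lra. }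
      assert (Hz : exists z, s <= z <= q /\ f z = z).
      { destruct (Req_dec (f q) q); [exists q; split; [lra|assumption]|].
        assert (s <> q) by (intros E; rewrite E in *; lra).
        destruct (fixed_between f s q) as [z [Hz Ez]]; auto; [lra|right; lra|].
        exists z. split; [lra|assumption]. }
      destruct Hz as [z [Hz Ez]].
      exists z. split; [unfold inI in *; lra|]. split; [exact Ez|]. split.
      + intros n Hn. assert (X n <= s) by (apply Hub; exists n; auto).
        assert (X n <> z) by (intros E; rewrite HXS, E in Hn; lra). lra.
      + intros n Hn. assert (1 - X n <= d0) by (apply Hub'; exists n; auto).
        assert (X n <> z) by (intros E; rewrite HXS, E in Hn; lra). unfold q in *. lra. }
  destruct Hz as [z [Hz [Efz [HUz HDz]]]].
  assert (Hne : forall n, X n <> z) by (intros n E; apply (Hnf n); rewrite HXS, E; exact Efz).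
  assert (HU' : forall n, X n < z -> X n < X (S n)).
  { intros n Hn. specialize (Hnf n). destruct (Rlt_le_dec (X n) (X (S n))); [assumption|].
    assert (z < X n) by (apply HDz; lra). lra. }
  assert (HD' : forall n, z < X n -> X (S n) < X n).
  { intros n Hn. specialize (Hnf n). destruct (Rlt_le_dec (X (S n)) (X n)); [assumption|].
    assert (X n < z) by (apply HUz; lra). lra. }
  assert (Hlow : forall N, exists n, (n >= N)%nat /\ X n < z)
    by (intros N; destruct (HUio N) as [n [Hn1 Hn2]]; exists n; auto).
  assert (Hhigh : forall N, exists n, (n >= N)%nat /\ z < X n)
    by (intros N; destruct (HDio N) as [n [Hn1 Hn2]]; exists n; auto).
  assert (HLT := left_visits_tend f x z Hf HN Hx Hz Efz HU' Hne).
  assert (HRT := right_visits_tend f x z Hf HN Hx Hz Efz HD' Hne).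
  assert (Hcv : (forall e, 0 < e -> exists N, forall n, (n >= N)%nat -> z - e < X n) ->
                (forall e, 0 < e -> exists N, forall n, (n >= N)%nat -> X n < z + e) -> False).
  { intros C1 C2. apply HC. exists z. intros e He.
    destruct (C1 e He) as [N1 H1]. destruct (C2 e He) as [N2 H2].
    exists (N1 + N2)%nat. intros n Hn. specialize (H1 n ltac:(lia)). specialize (H2 n ltac:(lia)).
    unfold Rdist. change (iter n f x) with (X n). unfold Rabs; destruct (Rcase_abs _); lra. }
  assert (HfcL : forall e, 0 < e -> exists d, 0 < d /\ forall t, inI t -> Rabs (t - z) < d -> Rabs (f t - z) < e).
  { intros e He. destruct (proj2 Hf z Hz e He) as [d [Hd H]]. exists d. rewrite Efz in H. auto. }
  destruct (classic (forall N, exists n, (n >= N)%nat /\ X n < z /\ X (S n) < z)) as [UU|UU];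
  destruct (classic (forall N, exists n, (n >= N)%nat /\ z < X n /\ z < X (S n))) as [DD|DD].
  - exfalso. apply Hcv; [apply HLT|apply HRT]; assumption.
  (* Eventually each right visit immediately follows a left visit. Left visits tend to [z], so
     continuity at [z] makes the right visits tend to [z] too. *)
  - exfalso. apply Hcv; [apply HLT; assumption|].
    apply not_all_ex_not in DD. destruct DD as [N0 DD].
    intros e He. destruct (HfcL e He) as [d [Hd H]].
    destruct (HLT UU Hhigh d Hd) as [N1 H1].
    exists (S (N0 + N1)). intros n Hn. destruct n as [|n]; [lia|].
    destruct (Rlt_le_dec z (X (S n))) as [Hz1|]; [|lra].
    assert (X n < z).
    { destruct (Rtotal_order (X n) z) as [?|[E|G]]; [assumption|exfalso; exact (Hne _ E)|].
      exfalso. apply DD. exists n. repeat split; [lia|assumption|assumption]. }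
    specialize (H1 n ltac:(lia)). change (iter n f x) with (X n) in H1.
    assert (A1 : Rabs (X n - z) < d) by (unfold Rabs; destruct (Rcase_abs _); lra).
    apply H in A1; [|apply HXI]. rewrite <- HXS in A1. unfold Rabs in A1; destruct (Rcase_abs _); lra.
  - exfalso. apply Hcv; [|apply HRT; assumption].
    apply not_all_ex_not in UU. destruct UU as [N0 UU].
    intros e He. destruct (HfcL e He) as [d [Hd H]].
    destruct (HRT DD Hlow d Hd) as [N1 H1].
    exists (S (N0 + N1)). intros n Hn. destruct n as [|n]; [lia|].
    destruct (Rlt_le_dec (X (S n)) z) as [Hz1|]; [|lra].
    assert (z < X n).
    { destruct (Rtotal_order (X n) z) as [L|[E|G]]; [|exfalso; exact (Hne _ E)|assumption].
      exfalso. apply UU. exists n. repeat split; [lia|assumption|assumption]. }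
    specialize (H1 n ltac:(lia)). change (iter n f x) with (X n) in H1.
    assert (A1 : Rabs (X n - z) < d) by (unfold Rabs; destruct (Rcase_abs _); lra).
    apply H in A1; [|apply HXI]. rewrite <- HXS in A1. unfold Rabs in A1; destruct (Rcase_abs _); lra.
  - apply not_all_ex_not in UU. destruct UU as [N0 UU].
    apply not_all_ex_not in DD. destruct DD as [N1 DD].
    destruct (alt_of_steps f z x (N0 + N1)) as [b Hb].
    + intros n Hn Hlt. destruct (Rtotal_order (X (S n)) z) as [L|[E|G]]; [|exfalso; exact (Hne _ E)|assumption].
      exfalso. apply UU. exists n. repeat split; [lia|assumption|assumption].
    + intros n Hn Hlt. destruct (Rtotal_order (X (S n)) z) as [L|[E|G]]; [assumption|exfalso; exact (Hne _ E)|].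
      exfalso. apply DD. exists n. repeat split; [lia|assumption|assumption].
    + apply Hne.
    + exists z, b. auto.
Qed.

(** * Independence sets *)

(** Turbulence of [f^t] with triple [a < x < c]. The end that [x] reaches only at time [s] is
    recovered by [Hpull]: a point sent to a fixed end at time [s] is still there at time [t], since
    [f^(t-s)] fixes that end. *)
Lemma two_fixed_turb f s t a x c : CII f -> NT f -> inI a -> inI c -> a < x < c -> (s < t)%nat ->
  iter s f a = a -> iter t f a = a -> iter s f c = c -> iter t f c = c ->
  (iter s f x <= a /\ c <= iter t f x) \/ (c <= iter s f x /\ iter t f x <= a) -> False.
Proof.
  intros Hf HN Ha Hc Hx Hst Hsa Hta Hsc Htc H.
  assert (Hfix : forall y, iter s f y = y -> iter t f y = y -> iter (t - s) f y = y).
  { intros y E1 E2. rewrite <- E2 at 2. replace t with ((t - s) + s)%nat at 2 by lia.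
    rewrite iter_add, E1. reflexivity. }
  assert (Hxi : inI x) by (unfold inI in *; lra).
  assert (Hpull : forall u v w, inI u -> inI v -> u <= v -> iter s f w = w -> iter t f w = w ->
     (iter s f u <= w <= iter s f v \/ iter s f v <= w <= iter s f u) ->
     exists p, u <= p <= v /\ iter t f p = w).
  { intros u v w Hu Hv Huv E1 E2 Hw.
    destruct (ivt (iter s f) u v w) as [p [Hp Ep]]; auto; [apply CII_iter, Hf|].
    exists p. split; [exact Hp|]. replace t with ((t - s) + s)%nat by lia.
    rewrite iter_add, Ep. auto. }
  apply (HN t); [lia|]. exists a, x, c. split; [exact Ha|]. split; [exact Hc|]. split; [exact Hx|]. repeat split.
  - destruct H as [[H1 H2]|[H1 H2]].
    + exists a; lra.
    + exists x; lra.
  - destruct H as [[H1 H2]|[H1 H2]].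
    + exists x; lra.
    + destruct (Hpull a x c) as [p [Hp Ep]]; auto; try lra. exists p; lra.
  - destruct H as [[H1 H2]|[H1 H2]].
    + destruct (Hpull x c a) as [p [Hp Ep]]; auto; try lra. exists p; lra.
    + exists x; lra.
  - exists c; lra.
Qed.

(** Under [g = f^(2^v)] the point returns after an odd number [e] of steps. A convergent periodic
    orbit is constant, and an alternating one would put the same point on both sides of the
    separator. *)
Lemma periodic_two_power f v e w : CII f -> NT f -> inI w ->
  Nat.odd e = true -> iter (2 ^ v * e) f w = w -> iter (2 ^ v) f w = w.
Proof.
  intros Hf HN Hw He Hp.
  set (g := iter (2 ^ v) f) in *.
  assert (Hpow : (2 ^ v <> 0)%nat) by (apply Nat.pow_nonzero; lia).
  assert (Hg : CII g) by (apply CII_iter, Hf).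
  assert (HNg : NT g) by (apply NT_iter; [lia|exact HN]).
  assert (Hgp : iter e g w = w) by (unfold g; rewrite iter_mul, Nat.mul_comm; exact Hp).
  assert (Hgm : forall k, iter (k * e) g w = w).
  { induction k as [|k IH]; [reflexivity|]. simpl. rewrite iter_add, IH. exact Hgp. }
  assert (e <> 0)%nat by (intros ->; discriminate).
  change (g w = w).
  destruct (conv_or_alt g w Hg HNg Hw) as [[q Hq]|[z [b [Hz [Ez [N HA]]]]]].
  - assert (Hall : forall i, iter i g w = q).
    { intros i. apply cond_eq. intros eps Heps. destruct (Hq eps Heps) as [M HM].
      specialize (HM (i + M * e)%nat ltac:(nia)). unfold Rdist in HM.
      rewrite iter_add, Hgm in HM. exact HM. }
    pose proof (Hall 0%nat). pose proof (Hall 1%nat). simpl in *.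
    congruence.
  - exfalso. pose proof (HA (N * 2 * e)%nat ltac:(nia)) as A1.
    pose proof (HA ((N * 2 + 1) * e)%nat ltac:(nia)) as A2.
    rewrite Hgm in A1, A2.
    rewrite !Nat.odd_mul, He, !Bool.andb_true_r in *.
    rewrite Nat.odd_add, Nat.odd_mul in A2. simpl in A1, A2.
    rewrite Bool.andb_false_r in *. destruct b; simpl in *; lra.
Qed.

Lemma two_adic_pair n : forall s t, (s + t <= n)%nat -> (0 < s)%nat -> (0 < t)%nat ->
  exists v s' t', s = (2 ^ v * s')%nat /\ t = (2 ^ v * t')%nat /\
    (Nat.odd s' = true \/ Nat.odd t' = true).
Proof.
  induction n as [|n IH]; intros s t Hn Hs Ht; [lia|].
  destruct (Nat.odd s) eqn:Es; [exists 0%nat, s, t; simpl; repeat split; try lia; auto|].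
  destruct (Nat.odd t) eqn:Et; [exists 0%nat, s, t; simpl; repeat split; try lia; auto|].
  rewrite <- Nat.negb_even in Es, Et. apply Bool.negb_false_iff, Nat.even_spec in Es, Et.
  destruct Es as [s1 ->], Et as [t1 ->].
  destruct (IH s1 t1) as (v & s' & t' & E1 & E2 & E3); try lia.
  exists (S v), s', t'. rewrite Nat.pow_succ_r'. repeat split; [nia|nia|exact E3].
Qed.

(* Periods are powers of two, so the delay with the smaller dyadic valuation has the smaller set
   of fixed points. *)
Lemma common_fixed f s t : CII f -> NT f -> (0 < s)%nat -> (0 < t)%nat ->
  exists d, (d = s \/ d = t) /\ forall w, inI w -> iter d f w = w -> iter s f w = w /\ iter t f w = w.
Proof.
  intros Hf HN Hs Ht.
  destruct (two_adic_pair (s + t) s t) as (v & s' & t' & E1 & E2 & E3); try lia.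
  assert (H : forall w m, iter (2 ^ v) f w = w -> iter (2 ^ v * m) f w = w).
  { intros w m E. rewrite Nat.mul_comm, <- iter_mul. apply iter_fixed, E. }
  destruct E3 as [E3|E3].
  - exists s. split; [auto|]. intros w Hw E. rewrite E1 in E.
    apply periodic_two_power in E; auto. rewrite E1, E2. auto.
  - exists t. split; [auto|]. intros w Hw E. rewrite E2 in E.
    apply periodic_two_power in E; auto. rewrite E1, E2. auto.
Qed.

(** One of the two delays has only fixed points common to both. Under it [u] and [u'] move in
    opposite directions, so a common fixed point [y] lies between them. Then [y], the larger of
    [u, u'], and [z] fall under [two_fixed_turb]. *)
Lemma swap_right_turb f s t z u u' : CII f -> NT f -> (0 < s < t)%nat ->
  inI z -> inI u -> inI u' -> iter s f z = z -> iter t f z = z -> u < z -> u' < z ->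
  iter s f u < Rmin u u' -> z <= iter t f u -> z <= iter s f u' -> iter t f u' < Rmin u u' -> False.
Proof.
  intros Hf HN Hst Hz Hu Hu' Ezs Ezt Huz Huz' H1 H2 H3 H4.
  pose proof (Rmin_l u u'). pose proof (Rmin_r u u').
  destruct (common_fixed f s t Hf HN) as [d [Hd Hfix]]; try lia.
  assert (Hy : exists y, Rmin u u' < y /\ y < Rmax u u' /\ iter d f y = y).
  { assert (Hc : CII (iter d f)) by (apply CII_iter, Hf).
    assert (Hcase : (iter d f u < u /\ u' < iter d f u') \/ (u < iter d f u /\ iter d f u' < u'))
      by (destruct Hd as [->| ->]; [left|right]; lra).
    destruct (Rtotal_order u u') as [L|[E|G]].
    - destruct (fixed_between (iter d f) u u' Hc Hu Hu' L Hcase) as [y [Hy Ey]].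
      exists y. rewrite Rmin_left, Rmax_right by lra. repeat split; lra || assumption.
    - subst u'. lra.
    - destruct (fixed_between (iter d f) u' u Hc Hu' Hu G) as [y [Hy Ey]]; [tauto|].
      exists y. rewrite Rmin_right, Rmax_left by lra. repeat split; lra || assumption. }
  destruct Hy as [y [Hy1 [Hy2 Ey]]].
  assert (Hyi : inI y).
  { unfold inI in *. pose proof (Rmin_glb _ _ _ (proj1 Hu) (proj1 Hu')).
    pose proof (Rmax_lub _ _ _ (proj2 Hu) (proj2 Hu')). lra. }
  destruct (Hfix y Hyi Ey) as [Eys Eyt].
  unfold Rmax in Hy2. destruct (Rle_dec u u').
  - apply (two_fixed_turb f s t y u' z); auto; try lia; try lra.
  - apply (two_fixed_turb f s t y u z); auto; try lia; try lra.
Qed.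

Lemma swap_left_turb f s t z u u' : CII f -> NT f -> (0 < s < t)%nat ->
  inI z -> inI u -> inI u' -> iter s f z = z -> iter t f z = z -> z < u -> z < u' ->
  Rmax u u' < iter s f u -> iter t f u <= z -> iter s f u' <= z -> Rmax u u' < iter t f u' -> False.
Proof.
  intros Hf HN Hst Hz Hu Hu' Ezs Ezt Huz Huz' H1 H2 H3 H4.
  assert (Em : Rmin (1 - u) (1 - u') = 1 - Rmax u u').
  { unfold Rmin, Rmax. destruct (Rle_dec (1 - u) (1 - u')), (Rle_dec u u'); lra. }
  assert (E : forall n y, iter n (rf f) (1 - y) = 1 - iter n f y).
  { intros n y. rewrite rf_iter. do 2 f_equal. lra. }
  apply (swap_right_turb (rf f) s t (1 - z) (1 - u) (1 - u')); rewrite ?E, ?Em;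
    try apply CII_rf; try apply NT_rf; auto; unfold inI in *; try lra.
Qed.

Lemma pigeonhole3 {A B : Type} (h : A -> B) (lB : list B) : forall l : list A,
  NoDup l -> (forall a, In a l -> In (h a) lB) -> (length l > 2 * length lB)%nat ->
  exists a b c, In a l /\ In b l /\ In c l /\ a <> b /\ a <> c /\ b <> c /\ h a = h b /\ h a = h c.
Proof.
  induction lB as [|b0 lB IH]; intros l Hnd Hin Hlen.
  - destruct l as [|a l]; simpl in Hlen; [lia|]. destruct (Hin a (or_introl eq_refl)).
  - set (p := fun a => if excluded_middle_informative (h a = b0) then true else false).
    assert (Hsplit : (length l = length (filter p l) + length (filter (fun a => negb (p a)) l))%nat)
      by (symmetry; apply filter_length).
    assert (Hp : forall a, p a = true <-> h a = b0).
    { intros a. unfold p. destruct (excluded_middle_informative (h a = b0)); split; congruence. }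
    destruct (Compare_dec.le_lt_dec 3 (length (filter p l))) as [H3|H3].
    + assert (Hnd' := NoDup_filter p Hnd).
      assert (Hin' : forall a, In a (filter p l) -> In a l /\ h a = b0)
        by (intros a Ha; apply filter_In in Ha; rewrite Hp in Ha; exact Ha).
      destruct (filter p l) as [|x [|y [|z r]]]; simpl in H3; try lia.
      destruct (Hin' x) as [X1 X2]; [simpl; auto|].
      destruct (Hin' y) as [Y1 Y2]; [simpl; auto|].
      destruct (Hin' z) as [Z1 Z2]; [simpl; auto|].
      inversion Hnd' as [|? ? N1 N2]; subst. inversion N2 as [|? ? N3 N4]; subst. simpl in N1, N3.
      exists x, y, z. repeat split; auto; try congruence; intros ->; tauto.
    + destruct (IH (filter (fun a => negb (p a)) l)) as (a & b & c & Ha & Hb & Hc & H).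
      * apply NoDup_filter, Hnd.
      * intros a Ha. apply filter_In in Ha. destruct Ha as [Ha Hpa].
        destruct (Hin a Ha) as [E|]; [|assumption].
        symmetry in E. apply Hp in E. rewrite E in Hpa. discriminate.
      * simpl in Hlen. lia.
      * apply filter_In in Ha, Hb, Hc. exists a, b, c. tauto.
Qed.

Lemma pigeonhole3_nat {B : Type} (h : nat -> B) (lB : list B) (l : list nat) :
  NoDup l -> (forall a, In a l -> In (h a) lB) -> (length l > 2 * length lB)%nat ->
  exists a b c, In a l /\ In b l /\ In c l /\ (a < b < c)%nat /\ h a = h b /\ h a = h c.
Proof.
  intros H1 H2 H3. destruct (pigeonhole3 h lB l H1 H2 H3) as (a & b & c & Ha & Hb & Hc & N1 & N2 & N3 & E1 & E2).
  destruct (Nat.lt_total a b) as [?|[?|?]]; destruct (Nat.lt_total a c) as [?|[?|?]];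
  destruct (Nat.lt_total b c) as [?|[?|?]]; try lia.
  - exists a, b, c. repeat split; auto; congruence.
  - exists a, c, b. repeat split; auto; congruence.
  - exists c, a, b. repeat split; auto; congruence.
  - exists b, a, c. repeat split; auto; congruence.
  - exists b, c, a. repeat split; auto; congruence.
  - exists c, b, a. repeat split; auto; congruence.
Qed.

Lemma indep_three f A J t1 t2 t3 l1 l2 l3 : indep_set f A J ->
  In t1 J -> In t2 J -> In t3 J -> (t1 < t2 < t3)%nat -> (l1 < 3)%nat -> (l2 < 3)%nat -> (l3 < 3)%nat ->
  exists x, inI x /\ A l1 (iter t1 f x) /\ A l2 (iter t2 f x) /\ A l3 (iter t3 f x).
Proof.
  intros HJ H1 H2 H3 Ht L1 L2 L3.
  set (s := fun i => if Nat.eqb i t1 then l1 else if Nat.eqb i t2 then l2 else l3).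
  assert (E1 : s t1 = l1) by (unfold s; rewrite Nat.eqb_refl; reflexivity).
  assert (E2 : s t2 = l2).
  { unfold s. destruct (Nat.eqb_spec t2 t1); [lia|]. rewrite Nat.eqb_refl; reflexivity. }
  assert (E3 : s t3 = l3).
  { unfold s. destruct (Nat.eqb_spec t3 t1); [lia|]. destruct (Nat.eqb_spec t3 t2); [lia|]. reflexivity. }
  destruct (HJ (t1 :: t2 :: t3 :: nil) s) as [x [Hx H]].
  - discriminate.
  - intros i [<-|[<-|[<-|[]]]]; assumption.
  - intros i _. unfold s. destruct (Nat.eqb i t1), (Nat.eqb i t2); assumption.
  - exists x. split; [exact Hx|]. rewrite <- E1, <- E2, <- E3 at 1.
    repeat split; apply H; simpl; auto.
Qed.

Definition ball (x e : R) : R -> Prop := fun y => Rabs (y - x) < e.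

Lemma neigh_ball x e : 0 < e -> neighbourhood (ball x e) x.
Proof. intros He. exists (mkposreal e He). intros y Hy. exact Hy. Qed.

Lemma ball_bounds x e y : ball x e y -> x - e < y < x + e.
Proof. unfold ball, Rabs. destruct (Rcase_abs _); lra. Qed.

(** Among [2d + 1] independent times three agree modulo [d]. The first one serves as origin, at
    which the point is near [b]; the delays to the other two are multiples of [d], so a point fixed
    by [f^d] is fixed at both. *)
Lemma IN_patterns f a b c ea eb ec d : IN_tuple3 f a b c -> 0 < ea -> 0 < eb -> 0 < ec -> (0 < d)%nat ->
  exists s t, (0 < s < t)%nat /\ Nat.divide d s /\ Nat.divide d t /\
    forall l2 l3 : bool, exists u, inI u /\ ball b eb u /\
      (if l2 then ball c ec (iter s f u) else ball a ea (iter s f u)) /\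
      (if l3 then ball c ec (iter t f u) else ball a ea (iter t f u)).
Proof.
  intros (Ha & Hb & Hc & HIN) Hea Heb Hec Hd.
  destruct (HIN (ball a ea) (ball b eb) (ball c ec) (neigh_ball a ea Hea) (neigh_ball b eb Heb)
    (neigh_ball c ec Hec) (2 * d + 1)%nat) as (J & HJ & Hlen & Hind).
  destruct (pigeonhole3_nat (fun i => (i mod d)%nat) (seq 0 d) J HJ) as (t1 & t2 & t3 & I1 & I2 & I3 & Ht & E1 & E2).
  - intros i _. apply in_seq. pose proof (Nat.mod_upper_bound i d). lia.
  - rewrite length_seq. lia.
  - assert (Hdiv : forall i j, (i < j)%nat -> (i mod d = j mod d)%nat -> Nat.divide d (j - i)).
    { intros i j Hij E. exists (j / d - i / d)%nat.
      pose proof (Nat.div_mod i d ltac:(lia)). pose proof (Nat.div_mod j d ltac:(lia)).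
      rewrite Nat.mul_sub_distr_r. nia. }
    exists (t2 - t1)%nat, (t3 - t1)%nat.
    split; [lia|]. split; [apply Hdiv; [lia|exact E1]|]. split; [apply Hdiv; [lia|exact E2]|].
    intros l2 l3.
    destruct (indep_three _ _ _ t1 t2 t3 1%nat (if l2 then 2 else 0)%nat (if l3 then 2 else 0)%nat Hind I1 I2 I3 Ht)
      as (x & Hx & [X1 Y1] & X2 & X3); [lia|destruct l2; lia|destruct l3; lia|].
    exists (iter t1 f x). split; [exact X1|]. split; [exact Y1|].
    rewrite <- !iter_add.
    replace (t2 - t1 + t1)%nat with t2 by lia. replace (t3 - t1 + t1)%nat with t3 by lia.
    destruct l2, l3; tauto.
Qed.

Lemma no_IN3_sorted f a b c : CII f -> NT f -> IN_tuple3 f a b c -> a < b < c -> False.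
Proof.
  intros Hf HN HIN Habc.
  assert (Hb : inI b) by apply HIN.
  set (e := Rmin (b - a) (c - b) / 3).
  assert (He : 0 < e) by (unfold e; assert (0 < Rmin (b - a) (c - b)) by (apply Rmin_pos; lra); lra).
  assert (Hea : a + e < b - e) by (unfold e in *; pose proof (Rmin_l (b - a) (c - b)); lra).
  assert (Hec : b + e < c - e) by (unfold e in *; pose proof (Rmin_r (b - a) (c - b)); lra).
  (* Of the three points [u1, u2, u3] near [b] two lie on the same weak side of [b], and any two of
     them have opposite targets under one of the delays. The resulting fixed point lies strictly
     between them and so differs from [b]. *)
  assert (Hper : exists z d, (0 < d)%nat /\ inI z /\ z <> b /\ b - e < z < b + e /\ iter d f z = z).
  { destruct (IN_patterns f a b c e e e 1 HIN He He He) as (s & t & Hst & _ & _ & H); [lia|].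
    destruct (H false true) as (u1 & U1 & B1 & P1 & Q1).
    destruct (H true false) as (u2 & U2 & B2 & P2 & Q2).
    destruct (H false false) as (u3 & U3 & B3 & P3 & Q3).
    simpl in *.
    apply ball_bounds in B1, B2, B3, P1, P2, P3, Q1, Q2, Q3.
    assert (Hpair : forall d v w, inI v -> inI w -> b - e < v < b + e -> b - e < w < b + e -> (0 < d)%nat ->
       iter d f v < a + e -> c - e < iter d f w -> (v <= b /\ w <= b) \/ (b <= v /\ b <= w) ->
       exists z d, (0 < d)%nat /\ inI z /\ z <> b /\ b - e < z < b + e /\ iter d f z = z).
    { intros d v w Hv Hw Bv Bw Hd Ev Ew Hside.
      assert (Hc : CII (iter d f)) by (apply CII_iter, Hf).
      destruct (Rtotal_order v w) as [L|[E|G]].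
      - destruct (fixed_between (iter d f) v w Hc Hv Hw L) as [z [Hz Ez]]; [left; lra|].
        exists z, d. unfold inI in *. repeat split; first [lra|lia|exact Ez].
      - subst. lra.
      - destruct (fixed_between (iter d f) w v Hc Hw Hv G) as [z [Hz Ez]]; [right; lra|].
        exists z, d. unfold inI in *. repeat split; first [lra|lia|exact Ez]. }
    destruct (Rle_lt_dec u1 b), (Rle_lt_dec u2 b), (Rle_lt_dec u3 b).
    - apply (Hpair s u1 u2); try assumption; try lia; lra.
    - apply (Hpair s u1 u2); try assumption; try lia; lra.
    - apply (Hpair t u3 u1); try assumption; try lia; lra.
    - apply (Hpair s u3 u2); try assumption; try lia; lra.
    - apply (Hpair s u3 u2); try assumption; try lia; lra.
    - apply (Hpair t u3 u1); try assumption; try lia; lra.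
    - apply (Hpair s u1 u2); try assumption; try lia; lra.
    - apply (Hpair s u1 u2); try assumption; try lia; lra. }
  destruct Hper as (z & d & Hd & Hz & Hzb & Hze & Ez).
  (* Shrinking the middle neighbourhood to radius [|z - b|] puts the new points on one known side of
     [z], while delays divisible by [d] keep [z] fixed. *)
  set (e' := Rabs (z - b)). assert (He' : 0 < e') by (apply Rabs_pos_lt; lra).
  destruct (IN_patterns f a b c e e' e d HIN He He' He Hd) as (s & t & Hst & [ks Hs] & [kt Ht] & H).
  assert (Ezs : iter s f z = z) by (rewrite Hs, <- iter_mul; apply iter_fixed, Ez).
  assert (Ezt : iter t f z = z) by (rewrite Ht, <- iter_mul; apply iter_fixed, Ez).
  destruct (H false true) as (u1 & U1 & B1 & P1 & Q1).
  destruct (H true false) as (u2 & U2 & B2 & P2 & Q2).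
  simpl in *. apply ball_bounds in B1, B2, P1, P2, Q1, Q2.
  assert (e' < e) by (unfold e', Rabs; destruct (Rcase_abs _); lra).
  destruct (Rlt_le_dec b z) as [Hbz|Hbz].
  - assert (Ee : e' = z - b) by (unfold e', Rabs; destruct (Rcase_abs _); lra).
    apply (swap_right_turb f s t z u1 u2); auto; try lra;
      apply Rmin_glb_lt; lra.
  - assert (Ee : e' = b - z) by (unfold e', Rabs; destruct (Rcase_abs _); lra).
    apply (swap_left_turb f s t z u2 u1); auto; try lra; apply Rmax_lub_lt; lra.
Qed.

Lemma IN_swap12 f a b c : IN_tuple3 f a b c -> IN_tuple3 f b a c.
Proof.
  intros (Ha & Hb & Hc & H). split; [exact Hb|]. split; [exact Ha|]. split; [exact Hc|].
  intros U1 U2 U3 H1 H2 H3 m. destruct (H U2 U1 U3 H2 H1 H3 m) as (J & N & L & I).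
  exists J. split; [exact N|]. split; [exact L|].
  intros F s HF HFJ Hs.
  destruct (I F (fun i => match s i with 0 => 1 | 1 => 0 | k => k end)%nat) as [x [Hx E]]; auto.
  - intros i Hi. specialize (Hs i Hi). destruct (s i) as [|[|]]; lia.
  - exists x. split; [exact Hx|]. intros i Hi. specialize (E i Hi). simpl in E.
    destruct (s i) as [|[|k]]; exact E.
Qed.

Lemma IN_swap23 f a b c : IN_tuple3 f a b c -> IN_tuple3 f a c b.
Proof.
  intros (Ha & Hb & Hc & H). split; [exact Ha|]. split; [exact Hc|]. split; [exact Hb|].
  intros U1 U2 U3 H1 H2 H3 m. destruct (H U1 U3 U2 H1 H3 H2 m) as (J & N & L & I).
  exists J. split; [exact N|]. split; [exact L|].
  intros F s HF HFJ Hs.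
  destruct (I F (fun i => match s i with 0 => 0 | 1 => 2 | _ => 1 end)%nat) as [x [Hx E]]; auto.
  - intros i Hi. specialize (Hs i Hi). destruct (s i) as [|[|]]; lia.
  - exists x. split; [exact Hx|]. intros i Hi. specialize (E i Hi). simpl in E. specialize (Hs i Hi).
    destruct (s i) as [|[|[|k]]]; exact E.
Qed.

Lemma NT_no_IN f : CII f -> NT f -> ~ exists x1 x2 x3, essential_IN_tuple3 f x1 x2 x3.
Proof.
  intros Hf HN (a & b & c & H & Hab & Hac & Hbc).
  destruct (Rtotal_order a b) as [?|[?|?]]; [|contradiction|];
  (destruct (Rtotal_order a c) as [?|[?|?]]; [|contradiction|]);
  (destruct (Rtotal_order b c) as [?|[?|?]]; [|contradiction|]); try lra.
  - apply (no_IN3_sorted f a b c); auto.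
  - apply (no_IN3_sorted f a c b); auto. apply IN_swap23, H.
  - apply (no_IN3_sorted f c a b); auto. apply IN_swap12, IN_swap23, H.
  - apply (no_IN3_sorted f b a c); auto. apply IN_swap12, H.
  - apply (no_IN3_sorted f b c a); auto. apply IN_swap23, IN_swap12, H.
  - apply (no_IN3_sorted f c b a); auto. apply IN_swap12, IN_swap23, IN_swap12, H.
Qed.

(** * Entropy and shattering of words *)

Section Words.
Local Open Scope nat_scope.

Definition quad : Type := nat * nat * nat * nat.

Definition in_quad (Q : quad) (h : nat) : Prop :=
  match Q with (a, b, c, d) => h = a \/ h = b \/ h = c \/ h = d end.

Definition incr_quad (Q : quad) : Prop :=
  match Q with (a, b, c, d) => a < b < c /\ c < d end.

Definition quads (r : nat) : list quad :=
  list_prod (list_prod (list_prod (seq 0 r) (seq 0 r)) (seq 0 r)) (seq 0 r).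

Lemma quads_length r : length (quads r) = r ^ 4.
Proof. unfold quads, quad. rewrite !length_prod, !length_seq. simpl. lia. Qed.

Definition shattered (W : list (list nat)) (P : list (nat * quad)) : Prop :=
  forall c : nat -> nat, (forall i Q, In (i, Q) P -> in_quad Q (c i)) ->
    exists w, In w W /\ forall i Q, In (i, Q) P -> nth i w 0 = c i.

(** The recursion copies the induction on word length: at most three first letters per tail are free
    of charge, and the factor [r^5] counts [r^4] quadruples, each paying for up to [r] letters. For
    [D = 0] one word is enough; for length 0 there is only one word. *)
Fixpoint shatter_bound (r n D : nat) : nat :=
  match n, D with
  | _, 0 => 0
  | 0, S _ => 1
  | S n, S D => 3 * shatter_bound r n (S D) + r ^ 5 * shatter_bound r n D
  end.

Lemma list_sum_le {A} (h k : A -> nat) l : (forall x, In x l -> h x <= k x) ->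
  list_sum (map h l) <= list_sum (map k l).
Proof.
  induction l as [|a l IH]; intros H; simpl; [lia|].
  pose proof (H a (or_introl eq_refl)). assert (forall x, In x l -> h x <= k x) by (intros; apply H; right; assumption).
  specialize (IH H1). unfold list_sum in *. lia.
Qed.

Lemma list_sum_const {A} c (l : list A) : list_sum (map (fun _ => c) l) = c * length l.
Proof. induction l as [|a l IH]; simpl; [lia|]. unfold list_sum in *. lia. Qed.

Lemma list_sum_affine {A} a b (h : A -> nat) l :
  list_sum (map (fun x => a + b * h x) l) = a * length l + b * list_sum (map h l).
Proof. induction l as [|x l IH]; simpl; [lia|]. unfold list_sum in *. lia. Qed.

Lemma double_count {A B} (p : A -> B -> bool) (la : list A) (lb : list B) :
  list_sum (map (fun a => length (filter (fun b => p a b) lb)) la) =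
  list_sum (map (fun b => length (filter (fun a => p a b) la)) lb).
Proof.
  induction la as [|a la IH]; simpl.
  - rewrite list_sum_const. lia.
  - assert (E : list_sum (map (fun b => length (if p a b then a :: filter (fun a => p a b) la else filter (fun a => p a b) la)) lb)
       = length (filter (fun b => p a b) lb) + list_sum (map (fun b => length (filter (fun a => p a b) la)) lb)).
    { clear IH. induction lb as [|b lb IH]; simpl; [reflexivity|].
      unfold list_sum in *. destruct (p a b); simpl; lia. }
    rewrite E. unfold list_sum in *. lia.
Qed.

Definition ext_quad (W : list (list nat)) (t : list nat) (Q : quad) : Prop :=
  incr_quad Q /\ forall h, in_quad Q h -> In (h :: t) W.

Definition dec (P : Prop) : bool := if excluded_middle_informative P then true else false.

Lemma dec_true P : dec P = true <-> P.
Proof. unfold dec. destruct (excluded_middle_informative P); split; auto; discriminate. Qed.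

Lemma filter_seq_incr (p : nat -> bool) : forall len s a l, filter p (seq s len) = a :: l ->
  s <= a < s + len /\ p a = true /\ exists s' len', a < s' /\ s' + len' = s + len /\ l = filter p (seq s' len').
Proof.
  induction len as [|len IH]; intros s a l H; simpl in H; [discriminate|].
  destruct (p s) eqn:E.
  - injection H as -> <-. split; [lia|]. split; [exact E|]. exists (S a), len. repeat split; lia.
  - destruct (IH _ _ _ H) as (H1 & H2 & s' & len' & H3 & H4 & H5).
    split; [lia|]. split; [exact H2|]. exists s', len'. repeat split; [lia|lia|exact H5].
Qed.

(** If a tail has more than three extensions, the four smallest letters form an extending quadruple.
    That single quadruple pays for all extensions, of which there are at most [r]. *)
Lemma four_letters r W t :
  let L := filter (fun h => dec (In (h :: t) W)) (seq 0 r) in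
  length L <= 3 + r * length (filter (fun Q => dec (ext_quad W t Q)) (quads r)).
Proof.
  intros L.
  assert (HL : length L <= r).
  { unfold L. eapply Nat.le_trans; [apply filter_length_le|]. rewrite length_seq. lia. }
  destruct (Compare_dec.le_lt_dec (length L) 3); [lia|].
  assert (HQ : exists Q, In Q (filter (fun Q => dec (ext_quad W t Q)) (quads r))).
  { unfold L in *. destruct (filter _ (seq 0 r)) as [|a l1] eqn:E1; simpl in *; [lia|].
    destruct (filter_seq_incr _ _ _ _ _ E1) as (A1 & A2 & s1 & n1 & A3 & A4 & E2).
    destruct l1 as [|b l2]; simpl in *; [lia|]. symmetry in E2.
    destruct (filter_seq_incr _ _ _ _ _ E2) as (B1 & B2 & s2 & n2 & B3 & B4 & E3).
    destruct l2 as [|c l3]; simpl in *; [lia|]. symmetry in E3.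
    destruct (filter_seq_incr _ _ _ _ _ E3) as (C1 & C2 & s3 & n3 & C3 & C4 & E4).
    destruct l3 as [|d l4]; simpl in *; [lia|]. symmetry in E4.
    destruct (filter_seq_incr _ _ _ _ _ E4) as (D1 & D2 & s4 & n4 & D3 & D4 & E5).
    rewrite dec_true in A2, B2, C2, D2.
    exists (a, b, c, d). apply filter_In. split.
    - unfold quads. repeat apply in_prod; apply in_seq; lia.
    - apply dec_true. split; [simpl; lia|]. simpl. intros h [->|[->|[->| ->]]]; assumption. }
  destruct HQ as [Q HQ]. destruct (filter (fun Q => dec (ext_quad W t Q)) (quads r)); [destruct HQ|]. simpl. nia.
Qed.

(* Karpovsky-Milman: more than roughly 3^n words over a finite alphabet realise all patterns on D
   positions, each position using four prescribed letters. Induction on the first letter: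
   a tail extended by at least four letters is counted by one of its quadruples. *)
Lemma many_words_shatter r n : forall W D, NoDup W ->
  (forall w, In w W -> length w = n /\ forall h, In h w -> h < r) ->
  shatter_bound r n D < length W ->
  exists P, length P = D /\ NoDup (map fst P) /\
    (forall i Q, In (i, Q) P -> i < n /\ incr_quad Q /\ In Q (quads r)) /\ shattered W P.
Proof.
  assert (Hnil : forall k (W : list (list nat)) m, m < length W ->
    exists P, length P = 0 /\ NoDup (map fst P) /\
    (forall i Q, In (i, Q) P -> i < k /\ incr_quad Q /\ In Q (quads r)) /\ shattered W P).
  { intros k W m Hm. exists nil. split; [reflexivity|]. split; [constructor|]. split; [intros i Q []|].
    intros c _. destruct W as [|w W]; simpl in Hm; [lia|]. exists w. split; [left; reflexivity|intros i Q []]. }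
  induction n as [|n IH]; intros W D Hnd HW Hlen; (destruct D as [|D]; [eapply Hnil, Hlen|]).
  - exfalso. simpl in Hlen. destruct W as [|w1 [|w2 W]]; simpl in Hlen; try lia.
    destruct (HW w1) as [L1 _]; [simpl; auto|]. destruct (HW w2) as [L2 _]; [simpl; auto|].
    destruct w1; [|discriminate]. destruct w2; [|discriminate].
    inversion Hnd as [|? ? H _]. apply H. left; reflexivity.
  - set (W' := nodup (list_eq_dec Nat.eq_dec) (map (@tl nat) W)).
    set (L := fun t => filter (fun h => dec (In (h :: t) W)) (seq 0 r)).
    assert (HW' : forall t, In t W' -> length t = n /\ forall h, In h t -> h < r).
    { intros t Ht. apply nodup_In, in_map_iff in Ht. destruct Ht as [w [<- Hw]].
      destruct (HW w Hw) as [Hl Hh]. destruct w as [|h t]; [discriminate|]. simpl in *.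
      split; [lia|]. intros k Hk. apply Hh. auto. }
    assert (Hincl : incl W (flat_map (fun t => map (fun h => h :: t) (L t)) W')).
    { intros w Hw. destruct (HW w Hw) as [Hl Hh]. destruct w as [|h t]; [discriminate|].
      apply in_flat_map. exists t. split.
      - apply nodup_In, in_map_iff. exists (h :: t). auto.
      - apply in_map_iff. exists h. split; [reflexivity|]. apply filter_In. split.
        + apply in_seq. specialize (Hh h (or_introl eq_refl)). lia.
        + apply dec_true, Hw. }
    apply NoDup_incl_length in Hincl; [|exact Hnd].
    assert (Hlen2 : length W <= 3 * length W' +
       r * list_sum (map (fun t => length (filter (fun Q => dec (ext_quad W t Q)) (quads r))) W')).
    { eapply Nat.le_trans; [exact Hincl|]. rewrite length_flat_map, <- list_sum_affine.
      apply list_sum_le. intros t _. rewrite length_map. apply four_letters. }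
    rewrite (double_count (fun t Q => dec (ext_quad W t Q))) in Hlen2.
    (* If there are few tails, averaging over quadruples finds one that extends more than
       [shatter_bound r n D] tails, and position 0 joins the [D] positions shattered by these. If
       there are many, the tails alone shatter [D + 1] positions. *)
    destruct (Compare_dec.le_lt_dec (length W') (shatter_bound r n (S D))) as [H1|H1].
    + assert (HQ : exists Q, In Q (quads r) /\
         shatter_bound r n D < length (filter (fun t => dec (ext_quad W t Q)) W')).
      { apply NNPP. intros C.
        assert (Hs : list_sum (map (fun Q => length (filter (fun t => dec (ext_quad W t Q)) W')) (quads r))
           <= list_sum (map (fun _ => shatter_bound r n D) (quads r))).
        { apply list_sum_le. intros Q HQ.
          destruct (Compare_dec.le_lt_dec (length (filter (fun t => dec (ext_quad W t Q)) W')) (shatter_bound r n D));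
            [assumption|]. exfalso. apply C. exists Q. auto. }
        rewrite list_sum_const, quads_length in Hs.
        assert (E5 : r ^ 5 = r * r ^ 4) by reflexivity.
        change (shatter_bound r (S n) (S D)) with
          (3 * shatter_bound r n (S D) + r ^ 5 * shatter_bound r n D) in Hlen.
        rewrite E5 in Hlen.
        set (X := list_sum _) in *. set (r4 := r ^ 4) in *.
        assert (r * X <= r * (shatter_bound r n D * r4)) by (apply Nat.mul_le_mono_l, Hs).
        nia. }
      destruct HQ as [Q [HQ HQl]].
      destruct (IH _ D (NoDup_filter _ (NoDup_nodup _ _))
        (fun t Ht => HW' t (proj1 (proj1 (filter_In _ _ _) Ht))) HQl) as (P & PL & PN & PP & PS).
      exists ((0, Q) :: map (fun iQ => (S (fst iQ), snd iQ)) P).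
      assert (Hin : forall i R, In (i, R) (map (fun iQ => (S (fst iQ), snd iQ)) P) ->
        exists j, i = S j /\ In (j, R) P).
      { intros i R HR. apply in_map_iff in HR. destruct HR as [[j R'] [E HR]].
        simpl in E. injection E as <- <-. exists j. auto. }
      split; [simpl; rewrite length_map; lia|]. split.
      { simpl. constructor.
        - intros H0. apply in_map_iff in H0. destruct H0 as [[i R] [E HR]].
          apply Hin in HR. destruct HR as [j [-> _]]. discriminate.
        - rewrite map_map. simpl. rewrite <- (map_map fst S).
          apply Injective_map_NoDup; [|exact PN]. intros x y E. lia. }
      split.
      { intros i R [E|HR].
        - injection E as <- <-. split; [lia|]. split; [|exact HQ].
          destruct (filter (fun t => dec (ext_quad W t Q)) W') as [|t l] eqn:EF; simpl in HQl; [lia|].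
          assert (Ht : In t (filter (fun t => dec (ext_quad W t Q)) W')) by (rewrite EF; left; reflexivity).
          apply filter_In in Ht. destruct Ht as [_ Ht]. apply (proj1 (dec_true _)) in Ht. apply Ht.
        - apply Hin in HR. destruct HR as [j [-> HR]]. destruct (PP j R HR) as (? & ? & ?).
          repeat split; try assumption; lia. }
      intros c Hc. destruct (PS (fun i => c (S i))) as [t [Ht HtP]].
      { intros i R HR. apply Hc. right. apply in_map_iff. exists (i, R). auto. }
      apply filter_In in Ht. destruct Ht as [_ Ht]. apply (proj1 (dec_true _)) in Ht.
      exists (c 0 :: t). split.
      { apply Ht. apply Hc. left. reflexivity. }
      intros i R [E|HR].
      * injection E as <- <-. reflexivity.
      * apply Hin in HR. destruct HR as [j [-> HR]]. simpl. apply (HtP j R HR).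
    + destruct (IH W' (S D) (NoDup_nodup _ _) HW' H1) as (P & PL & PN & PP & PS).
      exists (map (fun iQ => (S (fst iQ), snd iQ)) P).
      assert (Hin : forall i R, In (i, R) (map (fun iQ => (S (fst iQ), snd iQ)) P) ->
        exists j, i = S j /\ In (j, R) P).
      { intros i R HR. apply in_map_iff in HR. destruct HR as [[j R'] [E HR]].
        simpl in E. injection E as <- <-. exists j. auto. }
      split; [rewrite length_map; exact PL|]. split.
      { rewrite map_map. simpl. rewrite <- (map_map fst S).
        apply Injective_map_NoDup; [|exact PN]. intros x y E. lia. }
      split.
      { intros i R HR. apply Hin in HR. destruct HR as [j [-> HR]]. destruct (PP j R HR) as (? & ? & ?).
        repeat split; try assumption; lia. }
      intros c Hc. destruct (PS (fun i => c (S i))) as [t [Ht HtP]].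
      { intros i R HR. apply Hc. apply in_map_iff. exists (i, R). auto. }
      apply nodup_In, in_map_iff in Ht. destruct Ht as [w [<- Hw]].
      exists w. split; [exact Hw|]. intros i R HR. apply Hin in HR. destruct HR as [j [-> HR]].
      rewrite <- (HtP j R HR). destruct (HW w Hw) as [Hl _]. destruct w; [discriminate|]. reflexivity.
Qed.

Lemma shatter_bound_le r n : forall D, shatter_bound r n D <= 3 ^ n * (1 + r ^ 5 * n) ^ D.
Proof.
  set (q := r ^ 5).
  induction n as [|n IH]; intros [|D]; try (simpl; lia).
  - simpl. rewrite Nat.mul_0_r. simpl. rewrite Nat.pow_1_l. lia.
  - change (3 * shatter_bound r n (S D) + q * shatter_bound r n D <= 3 ^ S n * (1 + q * S n) ^ S D).
    pose proof (IH D) as I1. pose proof (IH (S D)) as I2.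
    rewrite !Nat.pow_succ_r'. rewrite Nat.pow_succ_r' in I2.
    assert (HX : (1 + q * n) ^ D <= (1 + q * S n) ^ D) by (apply Nat.pow_le_mono_l; nia).
    set (X := (1 + q * n) ^ D) in *. set (Y := (1 + q * S n) ^ D) in *. set (T := 3 ^ n) in *.
    assert (3 * shatter_bound r n (S D) + q * shatter_bound r n D <= T * X * (3 * (1 + q * n) + q)) by nia.
    assert (T * X * (3 * (1 + q * n) + q) <= T * Y * (3 * (1 + q * S n))).
    { apply Nat.mul_le_mono; [apply Nat.mul_le_mono_l, HX|lia]. }
    lia.
Qed.
End Words.

(** * Exponential growth and letters of points *)

Lemma exp_mul_nat n x : exp (INR n * x) = exp x ^ n.
Proof.
  induction n as [|n IH]; [simpl; rewrite Rmult_0_l, exp_0; reflexivity|].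
  rewrite S_INR. simpl. rewrite <- IH, <- exp_plus. f_equal. lra.
Qed.

Lemma exp_le x y : x <= y -> exp x <= exp y.
Proof. intros [H|H]; [left; apply exp_increasing, H|right; congruence]. Qed.

(** Here [3 <= exp 2] bounds the power of three by [exp (2n)], and the choice [d = 2(D + 1)] bounds
    the polynomial factor by [C exp (n/2)]. The rate 4 leaves [exp (3n/2 - 4)] to absorb [C]. The
    shift [n - 1] matches the sample count, one more than a quotient. *)
Lemma shatter_bound_exp r D : exists n0, forall n, (n >= n0)%nat ->
  INR (shatter_bound r n D) < exp (4 * (INR n - 1)).
Proof.
  set (q := INR (r ^ 5)). set (d := 2 * (INR D + 1)).
  assert (Hq : 0 <= q) by apply pos_INR. assert (Hd : 2 <= d) by (unfold d; pose proof (pos_INR D); lra).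
  set (C := (1 + d * q) ^ D).
  assert (HC : 1 <= C) by (apply pow_R1_Rle; nra).
  destruct (INR_unbounded (C + 4)) as [n0 Hn0].
  exists n0. intros n Hn.
  assert (Hnn : INR n0 <= INR n) by (apply le_INR; lia).
  assert (Hn0' : 0 <= INR n) by apply pos_INR.
  apply Rle_lt_trans with (exp (2 * INR n) * (C * exp (INR n / 2))).
  - eapply Rle_trans; [apply le_INR, shatter_bound_le|].
    rewrite mult_INR, !pow_INR, plus_INR, mult_INR. fold q.
    apply Rmult_le_compat.
    + apply pow_le. simpl; lra.
    + apply pow_le. simpl (INR 1). nra.
    + replace (2 * INR n) with (INR n * 2) by lra. rewrite exp_mul_nat. apply pow_incr.
      pose proof (exp_ineq1_le 2). simpl. lra.
    + apply Rle_trans with (((1 + d * q) * exp (INR n / d)) ^ D).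
      * apply pow_incr. simpl (INR 1). split; [nra|].
        apply Rle_trans with ((1 + d * q) * (1 + INR n / d)).
        -- assert (E : d * (INR n / d) = INR n) by (field; lra).
           assert (0 <= INR n / d) by (apply Rmult_le_pos; [lra|left; apply Rinv_0_lt_compat; lra]).
           nra.
        -- apply Rmult_le_compat_l; [nra|]. apply exp_ineq1_le.
      * rewrite Rpow_mult_distr. fold C. apply Rmult_le_compat_l; [lra|].
        rewrite <- exp_mul_nat. apply exp_le.
        assert (E : INR n / d * d = INR n) by (field; lra).
        assert (0 <= INR n / d) by (apply Rmult_le_pos; [lra|left; apply Rinv_0_lt_compat; lra]).
        assert (INR D <= d / 2) by (unfold d; lra). nra.
  - replace (4 * (INR n - 1)) with (2 * INR n + (INR n / 2 + (3 / 2 * INR n - 4))) by lra.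
    rewrite !exp_plus. apply Rmult_lt_compat_l; [apply exp_pos|].
    rewrite Rmult_comm. apply Rmult_lt_compat_l; [apply exp_pos|].
    pose proof (exp_ineq1_le (3 / 2 * INR n - 4)). lra.
Qed.

(** One plus the integer part of [r y]: the number of the cell of length [1/r] that contains [y].
    For [y] in I it is positive and at most [r + 1]. *)
Definition letter (r : nat) (y : R) : nat := Z.to_nat (up (INR r * y)).

Lemma letter_spec r y : inI y -> INR r * y < INR (letter r y) <= INR r * y + 1.
Proof.
  intros Hy. unfold letter. destruct (archimed (INR r * y)) as [H1 H2].
  assert (0 <= INR r * y) by (apply Rmult_le_pos; [apply pos_INR|apply Hy]).
  rewrite (INR_IZR_INZ (Z.to_nat _)), Z2Nat.id; [lra|]. apply le_IZR. lra.
Qed.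

Lemma letter_lt r x y : inI x -> inI y -> (letter r x < letter r y)%nat -> x < y.
Proof.
  intros Hx Hy H. pose proof (letter_spec r x Hx). pose proof (letter_spec r y Hy).
  apply le_INR in H. rewrite S_INR in H. pose proof (pos_INR r).
  destruct (Rlt_le_dec x y); [assumption|]. nra.
Qed.

Lemma letter_eq r x y d : inI x -> inI y -> 1 < INR r * d -> letter r x = letter r y -> Rabs (x - y) < d.
Proof.
  intros Hx Hy Hd H. pose proof (letter_spec r x Hx). pose proof (letter_spec r y Hy).
  rewrite H in *. pose proof (pos_INR r).
  unfold Rabs. destruct (Rcase_abs _); nra.
Qed.

Lemma NoDup_fst_inj {A B} (P : list (A * B)) i Q Q' :
  NoDup (map fst P) -> In (i, Q) P -> In (i, Q') P -> Q = Q'.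
Proof.
  induction P as [|[j R] P IH]; simpl; [tauto|]. intros H. inversion H as [|? ? N1 N2]; subst.
  intros [E1|H1] [E2|H2].
  - congruence.
  - injection E1 as -> ->. exfalso. apply N1. apply in_map_iff. exists (i, Q'). auto.
  - injection E2 as -> ->. exfalso. apply N1. apply in_map_iff. exists (i, Q). auto.
  - auto.
Qed.

(** Points are coded by their letters at multiples of [M]. Points with equal words are close at
    these times and, by uniform continuity over [M] steps, at all times before [n]; thus separated
    points have distinct words. Since [c M > 4], their number exceeds the shattering bound. *)
Lemma pos_entropy_patterns f : CII f -> pos_entropy f ->
  exists (M r t1 t2 t3 : nat) (Q : quad), (0 < M)%nat /\ (t1 < t2 < t3)%nat /\ incr_quad Q /\
    forall l1 l2 l3, in_quad Q l1 -> in_quad Q l2 -> in_quad Q l3 ->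
      exists x, inI x /\ letter r (iter (M * t1) f x) = l1 /\ letter r (iter (M * t2) f x) = l2 /\
        letter r (iter (M * t3) f x) = l3.
Proof.
  intros Hf (eps & Heps & c & Hc & Hent).
  destruct (INR_unbounded (4 / c)) as [M HM].
  assert (HM4 : 4 < c * INR M).
  { apply (Rmult_lt_compat_l c) in HM; [|lra]. replace (c * (4 / c)) with 4 in HM by (field; lra). lra. }
  assert (HM0 : (0 < M)%nat) by (destruct M; [simpl in HM4; lra|lia]).
  destruct (unif_cont_iter f M eps Hf Heps) as [d [Hd Hdu]].
  destruct (INR_unbounded (1 / d)) as [r0 Hr0].
  assert (Hr0d : 1 < INR r0 * d).
  { apply (Rmult_lt_compat_r d) in Hr0; [|lra]. replace (1 / d * d) with 1 in Hr0 by (field; lra). lra. }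
  (* Letters for mesh [r0] are at most [r0 + 1], hence below [r]. With [D] shattered positions,
     three of them carry the same quadruple. *)
  set (r := (r0 + 2)%nat). set (D := (2 * length (quads r) + 1)%nat).
  destruct (shatter_bound_exp r D) as [n0 Hn0].
  destruct (Hent (M * n0)%nat) as (n & Hn & E & (HEnd & HEI & HEsep) & HEc).
  (* The extra sample makes every time [k < n] follow one of the sampled times within fewer than [M]
     steps. *)
  set (m := S (n / M)).
  assert (Hm : (m >= n0)%nat).
  { unfold m. assert (n0 <= n / M)%nat; [|lia]. apply Nat.div_le_lower_bound; lia. }
  set (word := fun x => map (fun i => letter r0 (iter (M * i) f x)) (seq 0 m)).
  assert (Hnth : forall x i, (i < m)%nat -> nth i (word x) 0%nat = letter r0 (iter (M * i) f x)).
  { intros x i Hi. unfold word. 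
    rewrite nth_indep with (d' := (fun i => letter r0 (iter (M * i) f x)) 0%nat)
      by (rewrite length_map, length_seq; exact Hi).
    rewrite (map_nth (fun i => letter r0 (iter (M * i) f x))), seq_nth by exact Hi. reflexivity. }
  assert (Hinj : forall x y, In x E -> In y E -> word x = word y -> x = y).
  { intros x y Hx Hy Hw. destruct (Req_dec x y) as [|Hxy]; [assumption|]. exfalso.
    destruct (HEsep x y Hx Hy Hxy) as [k [Hk Hke]].
    assert (Hkm : (k / M < m)%nat) by (unfold m; apply Nat.lt_succ_r, Nat.Div0.div_le_mono; lia).
    assert (El : letter r0 (iter (M * (k / M)) f x) = letter r0 (iter (M * (k / M)) f y)).
    { rewrite <- !Hnth by exact Hkm. rewrite Hw. reflexivity. }
    apply (letter_eq r0 _ _ d) in El; try (apply iter_inI; auto); [|exact Hr0d].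
    pose proof (Nat.mod_upper_bound k M ltac:(lia)).
    specialize (Hdu _ _ (iter_inI f (M * (k / M)) x Hf (HEI x Hx)) (iter_inI f (M * (k / M)) y Hf (HEI y Hy)) El
       (k mod M)%nat ltac:(lia)).
    rewrite <- !iter_add in Hdu.
    replace (k mod M + M * (k / M))%nat with k in Hdu by (pose proof (Nat.div_mod k M ltac:(lia)); lia).
    unfold dist_n in Hke. lra. }
  destruct (many_words_shatter r m (map word E) D) as (P & PL & PN & PP & PS).
  - apply Injective_map_NoDup_in; assumption.
  - intros w Hw. apply in_map_iff in Hw. destruct Hw as [x [<- Hx]].
    split; [unfold word; rewrite length_map, length_seq; reflexivity|].
    intros h Hh. apply in_map_iff in Hh. destruct Hh as [i [<- _]].
    pose proof (letter_spec r0 _ (iter_inI f (M * i) x Hf (HEI x Hx))) as [_ Hl].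
    assert (HI := iter_inI f (M * i) x Hf (HEI x Hx)).
    assert (INR (letter r0 (iter (M * i) f x)) <= INR (r0 + 1)).
    { rewrite plus_INR. simpl. pose proof (pos_INR r0). unfold inI in HI. nra. }
    apply INR_le in H. unfold r. lia.
  - apply INR_lt. eapply Rlt_le_trans; [apply (Hn0 m Hm)|]. rewrite length_map.
    eapply Rle_trans; [|exact HEc]. apply exp_le.
    unfold m. rewrite S_INR. replace (INR (n / M) + 1 - 1) with (INR (n / M)) by lra.
    assert (INR (n / M) * INR M <= INR n).
    { rewrite <- mult_INR. apply le_INR. rewrite Nat.mul_comm. apply Nat.Div0.mul_div_le. }
    pose proof (pos_INR (n / M)). nra.
  - set (h := fun i => epsilon (inhabits (0, 0, 0, 0)%nat) (fun Q => In (i, Q) P)).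
    assert (Hh : forall i, In i (map fst P) -> In (i, h i) P).
    { intros i Hi. unfold h. apply epsilon_spec. apply in_map_iff in Hi.
      destruct Hi as [[j Q] [E1 HQ]]. simpl in E1. subst j. exists Q. exact HQ. }
    assert (Hh' : forall i Q, In (i, Q) P -> Q = h i).
    { intros i Q HQ. apply (NoDup_fst_inj P i); auto. apply Hh. apply in_map_iff. exists (i, Q). auto. }
    destruct (pigeonhole3_nat h (quads r) (map fst P) PN) as (t1 & t2 & t3 & I1 & I2 & I3 & Ht & E1 & E2).
    + intros i Hi. apply (PP i (h i)). apply Hh, Hi.
    + rewrite length_map, PL. unfold D, quad. lia.
    + exists M, r0, t1, t2, t3, (h t1).
      split; [exact HM0|]. split; [exact Ht|]. split; [apply (PP t1 (h t1)), Hh, I1|].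
      intros l1 l2 l3 L1 L2 L3.
      set (c' := fun i => if Nat.eqb i t1 then l1 else if Nat.eqb i t2 then l2 else
         if Nat.eqb i t3 then l3 else fst (fst (fst (h i)))).
      destruct (PS c') as [w [Hw HwP]].
      { intros i Q HQ. apply Hh' in HQ. subst Q. unfold c'.
        destruct (Nat.eqb_spec i t1); [subst; assumption|].
        destruct (Nat.eqb_spec i t2); [subst; rewrite <- E1; assumption|].
        destruct (Nat.eqb_spec i t3); [subst; rewrite <- E2; assumption|].
        destruct (h i) as [[[a b] c0] d0]. simpl. auto. }
      apply in_map_iff in Hw. destruct Hw as [x [<- Hx]].
      exists x. split; [apply HEI, Hx|].
      pose proof (HwP t1 _ (Hh t1 I1)) as W1. pose proof (HwP t2 _ (Hh t2 I2)) as W2.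
      pose proof (HwP t3 _ (Hh t3 I3)) as W3.
      rewrite Hnth in W1 by (apply (PP t1 _ (Hh t1 I1))).
      rewrite Hnth in W2 by (apply (PP t2 _ (Hh t2 I2))).
      rewrite Hnth in W3 by (apply (PP t3 _ (Hh t3 I3))).
      rewrite W1, W2, W3. unfold c'.
      destruct (Nat.eqb_spec t1 t1); [|lia]. destruct (Nat.eqb_spec t2 t1); [lia|].
      destruct (Nat.eqb_spec t2 t2); [|lia]. destruct (Nat.eqb_spec t3 t1); [lia|].
      destruct (Nat.eqb_spec t3 t2); [lia|]. destruct (Nat.eqb_spec t3 t3); [|lia]. auto.
Qed.

(** Roles of the four letters [a < b < c < d]: [v] and [v'] start in cell [c] and go to [a] twice,
    respectively to [d] twice, which traps a common fixed point [z] between them; [u] and [u'] start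
    in cell [b], left of [z], and visit [a] and [d] in opposite orders. This is the configuration of
    [swap_right_turb]. *)
Lemma NT_no_entropy f : CII f -> NT f -> ~ pos_entropy f.
Proof.
  intros Hf HN Hent.
  destruct (pos_entropy_patterns f Hf Hent) as (M & r & t1 & t2 & t3 & [[[a b] c] d] & HM & Ht & HQ & H).
  simpl in HQ.
  set (s := (M * (t2 - t1))%nat). set (t := (M * (t3 - t1))%nat).
  assert (Hst : (0 < s < t)%nat) by (unfold s, t; nia).
  assert (H' : forall l1 l2 l3, in_quad (a, b, c, d) l1 -> in_quad (a, b, c, d) l2 -> in_quad (a, b, c, d) l3 ->
    exists u, inI u /\ letter r u = l1 /\ letter r (iter s f u) = l2 /\ letter r (iter t f u) = l3).
  { intros l1 l2 l3 L1 L2 L3. destruct (H l1 l2 l3 L1 L2 L3) as (x & Hx & X1 & X2 & X3).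
    exists (iter (M * t1) f x). split; [apply iter_inI; assumption|]. split; [exact X1|].
    rewrite <- !iter_add.
    replace (s + M * t1)%nat with (M * t2)%nat by (unfold s; nia).
    replace (t + M * t1)%nat with (M * t3)%nat by (unfold t; nia). auto. }
  assert (HL : forall x y, inI x -> inI y -> (letter r x < letter r y)%nat -> x < y)
    by (intros; eapply letter_lt; eassumption).
  destruct (H' c a a) as (v & V1 & V2 & V3 & V4); simpl; auto.
  destruct (H' c d d) as (v' & V1' & V2' & V3' & V4'); simpl; auto.
  destruct (H' b a d) as (u & U1 & U2 & U3 & U4); simpl; auto.
  destruct (H' b d a) as (u' & U1' & U2' & U3' & U4'); simpl; auto.
  destruct (common_fixed f s t Hf HN) as [e [He Hfix]]; try lia.
  assert (Iv : forall n, inI (iter n f v)) by (intros; apply iter_inI; assumption).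
  assert (Iv' : forall n, inI (iter n f v')) by (intros; apply iter_inI; assumption).
  assert (Iu : forall n, inI (iter n f u)) by (intros; apply iter_inI; assumption).
  assert (Iu' : forall n, inI (iter n f u')) by (intros; apply iter_inI; assumption).
  assert (Hz : exists z, inI z /\ iter e f z = z /\ u < z /\ u' < z /\ (forall y, inI y -> letter r y = d -> z <= y)).
  { assert (Hc : CII (iter e f)) by (apply CII_iter, Hf).
    assert (H1 : iter e f v < v) by (destruct He as [-> | ->]; apply HL; auto; lia).
    assert (H2 : v' < iter e f v') by (destruct He as [-> | ->]; apply HL; auto; lia).
    assert (u < v /\ u < v' /\ u' < v /\ u' < v') by (repeat split; apply HL; auto; lia).
    assert (Hdv : forall y, inI y -> letter r y = d -> v < y /\ v' < y) by (intros; split; apply HL; auto; lia).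
    destruct (Rtotal_order v v') as [L|[E|G]].
    - destruct (fixed_between (iter e f) v v' Hc V1 V1' L) as [z [Hz Ez]]; [left; auto|].
      exists z. unfold inI in V1, V1'. repeat split; try lra; try assumption. intros y Hy El. destruct (Hdv y Hy El). lra.
    - subst. lra.
    - destruct (fixed_between (iter e f) v' v Hc V1' V1 G) as [z [Hz Ez]]; [right; auto|].
      exists z. unfold inI in V1, V1'. repeat split; try lra; try assumption. intros y Hy El. destruct (Hdv y Hy El). lra. }
  destruct Hz as (z & Iz & Ez & Huz & Huz' & Hzd). destruct (Hfix z Iz Ez) as [Ezs Ezt].
  apply (swap_right_turb f s t z u u'); auto.
  - apply Rmin_glb_lt; apply HL; auto; lia.
  - apply Rmin_glb_lt; apply HL; auto; lia.
Qed.

(** * Proximality and maximal scrambled sets *)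

Lemma Rabs_lt_iff x e : Rabs x < e <-> - e < x < e.
Proof. split; intros H; [apply Rabs_def2 in H; lra|apply Rabs_def1; lra]. Qed.

Lemma cv_inI u q : (forall n, inI (u n)) -> Un_cv u q -> inI q.
Proof.
  intros Hu Hq. unfold inI. split.
  - destruct (Rle_lt_dec 0 q); [assumption|]. destruct (Hq (- q)) as [N HN]; [lra|].
    specialize (HN N (Nat.le_refl _)). specialize (Hu N). unfold Rdist in HN. apply Rabs_lt_iff in HN.
    unfold inI in Hu. lra.
  - destruct (Rle_lt_dec q 1); [assumption|]. destruct (Hq (q - 1)) as [N HN]; [lra|].
    specialize (HN N (Nat.le_refl _)). specialize (Hu N). unfold Rdist in HN. apply Rabs_lt_iff in HN.
    unfold inI in Hu. lra.
Qed.

Lemma cv_map g u q : CII g -> (forall n, inI (u n)) -> Un_cv u q -> Un_cv (fun n => g (u n)) (g q).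
Proof.
  intros Hg Hu Hq eps He.
  destruct (proj2 Hg q (cv_inI u q Hu Hq) eps He) as [d [Hd H]].
  destruct (Hq d Hd) as [N HN]. exists N. intros n Hn. apply H; [apply Hu|]. apply (HN n Hn).
Qed.

(** Asymptotic periodicity: the limit is a point of period dividing [2^k], and the orbit is
    attracted to its cycle. *)
Definition AP (f : R -> R) (x : R) : Prop := exists k, conv (iter (2 ^ k) f) x.

Lemma pow2_pos k : (1 <= 2 ^ k)%nat.
Proof. assert (2 ^ k <> 0)%nat by (apply Nat.pow_nonzero; lia). lia. Qed.

(** Another [(2^k - 1) i] steps complete the shift by [i] to [i] full steps of [f^(2^k)]. *)
Lemma conv_shift f k i x : CII f -> inI x ->
  conv (iter (2 ^ k) f) (iter i f x) -> conv (iter (2 ^ k) f) x.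
Proof.
  intros Hf Hx [q Hq]. pose proof (pow2_pos k) as Hp.
  exists (iter ((2 ^ k - 1) * i) f q).
  apply (Un_cv_shift _ i).
  assert (H := cv_map (iter ((2 ^ k - 1) * i) f) _ q (CII_iter f _ Hf)
    (fun n => iter_inI (iter (2 ^ k) f) n (iter i f x) (CII_iter f _ Hf) (iter_inI f i x Hf Hx)) Hq).
  intros eps He. destruct (H eps He) as [N HN]. exists N. intros n Hn. specialize (HN n Hn).
  simpl in HN. rewrite iter_mul, <- !iter_add in HN. rewrite iter_mul.
  replace ((n + i) * 2 ^ k)%nat with ((2 ^ k - 1) * i + n * 2 ^ k + i)%nat by nia. exact HN.
Qed.

Lemma NP_alt f x : CII f -> NT f -> inI x -> ~ AP f x -> forall k i, exists z b,
  inI z /\ iter (2 ^ k) f z = z /\ alt (iter (2 ^ k) f) z b (iter i f x).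
Proof.
  intros Hf HN Hx HA k i.
  destruct (conv_or_alt (iter (2 ^ k) f) (iter i f x)) as [C|H].
  - apply CII_iter, Hf.
  - apply NT_iter; [apply pow2_pos|exact HN].
  - apply iter_inI; assumption.
  - exfalso. apply HA. exists k. apply (conv_shift f k i); assumption.
  - exact H.
Qed.

Lemma odd_double n : Nat.odd (n * 2) = false.
Proof. rewrite Nat.odd_mul. simpl. apply Bool.andb_false_r. Qed.

(* Every other even iterate lies beyond [z1] as seen from [z], and uniform continuity propagates
   this distance to the neighbouring iterates. *)
Lemma alt_far g z z1 b b1 : CII g -> inI z -> g z = z ->
  exists d, 0 < d /\ forall x, inI x -> alt g z b x -> alt (iter 2 g) z1 b1 x ->
    exists N, forall n, (n >= N)%nat -> d <= Rabs (iter n g x - z).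
Proof.
  intros Hg Hz Ez.
  assert (Hbey : forall x, alt g z b x -> alt (iter 2 g) z1 b1 x -> z1 <> z /\
    exists N, forall n, (n >= N)%nat -> Nat.even n = true ->
      Rabs (z1 - z) < Rabs (iter n g x - z) \/ Rabs (z1 - z) < Rabs (iter (2 + n) g x - z)).
  { intros x [N1 H1] [N2 H2].
    assert (Hm : forall m, (m >= N1 + N2)%nat -> z1 <> z /\ 
      (Rabs (z1 - z) < Rabs (iter (m * 2) g x - z) \/ Rabs (z1 - z) < Rabs (iter (S m * 2) g x - z))).
    { intros m Hm.
      pose proof (H1 (m * 2)%nat ltac:(lia)) as A1. pose proof (H1 (S m * 2)%nat ltac:(lia)) as A2.
      rewrite odd_double, Bool.xorb_false_r in A1, A2.
      pose proof (H2 m ltac:(lia)) as B1. pose proof (H2 (S m) ltac:(lia)) as B2.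
      rewrite iter_mul in B1, B2. rewrite Nat.odd_succ, <- Nat.negb_odd in B2.
      unfold Rabs. destruct b, b1, (Nat.odd m); simpl xorb in *; cbv iota in *;
      (split; [lra|]); repeat destruct (Rcase_abs _); lra. }
    split; [apply (Hm (N1 + N2)%nat); lia|].
    exists (2 * (N1 + N2))%nat. intros n Hn En. apply Nat.even_spec in En. destruct En as [m ->].
    destruct (Hm m ltac:(lia)) as [_ H]. replace (2 + 2 * m)%nat with (S m * 2)%nat by lia.
    replace (2 * m)%nat with (m * 2)%nat by lia. exact H. }
  destruct (Req_dec z1 z) as [E|Hne].
  { exists 1. split; [lra|]. intros x Hx HA1 HA2. destruct (Hbey x HA1 HA2). contradiction. }
  set (e := Rabs (z1 - z)) in *. assert (He : 0 < e) by (apply Rabs_pos_lt; lra).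
  destruct (unif_cont_iter g 2 e Hg He) as [d1 [Hd1 U1]].
  set (d1' := Rmin d1 e). assert (Hd1' : 0 < d1') by (apply Rmin_pos; assumption).
  destruct (unif_cont g d1' Hg Hd1') as [d2 [Hd2 U2]].
  exists (Rmin d2 d1'). split; [apply Rmin_pos; assumption|].
  intros x Hx HA1 HA2. destruct (Hbey x HA1 HA2) as [_ [N HN]].
  assert (Hev : forall n, (n >= N)%nat -> Nat.even n = true -> d1' <= Rabs (iter n g x - z)).
  { intros n Hn En. destruct (Rle_lt_dec d1' (Rabs (iter n g x - z))) as [|Hlt]; [assumption|].
    pose proof (Rmin_l d1 e). pose proof (Rmin_r d1 e). fold d1' in H, H0.
    destruct (HN n Hn En) as [H3|H3]; [lra|].
    specialize (U1 (iter n g x) z (iter_inI g n x Hg Hx) Hz ltac:(lra) 2%nat (Nat.le_refl _)).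
    rewrite <- iter_add, (iter_fixed g 2 z Ez) in U1. lra. }
  exists N. intros n Hn. pose proof (Rmin_l d2 d1'). pose proof (Rmin_r d2 d1').
  destruct (Nat.even n) eqn:En; [specialize (Hev n Hn En); lra|].
  destruct (Rle_lt_dec (Rmin d2 d1') (Rabs (iter n g x - z))) as [|Hlt]; [assumption|].
  specialize (Hev (S n) ltac:(lia)). rewrite Nat.even_succ, <- Nat.negb_even, En in Hev.
  specialize (Hev eq_refl).
  specialize (U2 (iter n g x) z (iter_inI g n x Hg Hx) Hz ltac:(lra)). rewrite Ez in U2.
  simpl in Hev. lra.
Qed.

Lemma not_ev_ge (u : nat -> R) d : ~ (exists N, forall n, (n >= N)%nat -> d <= u n) ->
  forall N, exists n, (n >= N)%nat /\ u n < d.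
Proof.
  intros H N. apply NNPP. intros C. apply H. exists N. intros n Hn.
  destruct (Rle_lt_dec d (u n)); [assumption|]. exfalso. apply C. exists n. auto.
Qed.

(** At each late step [x] crosses [z] with margin [d0] on both sides. If [y] is [d]-close to it
    infinitely often, [y] makes such crossings too, so it does not converge and alternates around
    some fixed point, which is then shown to be interchangeable with [z]. A simultaneous position
    fixes the phase. *)
Lemma far_or_alt g z b d0 : CII g -> NT g -> inI z -> g z = z -> 0 < d0 ->
  exists d, 0 < d /\ forall x y, inI x -> inI y -> alt g z b x ->
    (exists N, forall n, (n >= N)%nat -> d0 <= Rabs (iter n g x - z)) ->
    (exists N, forall n, (n >= N)%nat -> d <= Rabs (iter n g x - iter n g y)) \/
    (alt g z b y /\ ~ conv g y).
Proof.
  intros Hg HN Hz Ez Hd0.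
  destruct (unif_cont g d0 Hg Hd0) as [d1 [Hd1 U1]].
  set (d := Rmin d1 (d0 / 2)). assert (Hd : 0 < d) by (apply Rmin_pos; lra).
  assert (Hdl : d <= d1) by apply Rmin_l. assert (Hdr : d <= d0 / 2) by apply Rmin_r.
  exists d. split; [exact Hd|]. intros x y Hx Hy [Nx HAx] [Nf Hfar].
  destruct (classic (exists N, forall n, (n >= N)%nat -> d <= Rabs (iter n g x - iter n g y))) as [|HC];
    [left; assumption|right].
  assert (Hio := not_ev_ge _ _ HC). clear HC.
  set (X := fun n => iter n g x) in *. set (Y := fun n => iter n g y) in *.
  assert (HX : forall n, inI (X n)) by (intros; apply iter_inI; assumption).
  assert (HY : forall n, inI (Y n)) by (intros; apply iter_inI; assumption).
  assert (Hnext : forall n, Rabs (X n - Y n) < d -> Rabs (X (S n) - Y (S n)) < d0)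
    by (intros n Hn; apply (U1 (X n) (Y n) (HX n) (HY n)); lra).
  assert (Hcross : forall n, (n >= Nx + Nf)%nat ->
     (X n <= z - d0 /\ z + d0 <= X (S n)) \/ (z + d0 <= X n /\ X (S n) <= z - d0)).
  { intros n Hn. pose proof (HAx n ltac:(lia)) as A1. pose proof (HAx (S n) ltac:(lia)) as A2.
    pose proof (Hfar n ltac:(lia)) as B1. pose proof (Hfar (S n) ltac:(lia)) as B2.
    change (iter n g x) with (X n) in *. change (iter (S n) g x) with (X (S n)) in *.
    rewrite Nat.odd_succ, <- Nat.negb_odd in A2.
    unfold Rabs in B1, B2. repeat destruct (Rcase_abs _); destruct b, (Nat.odd n); simpl xorb in *; cbv iota in *; lra. }
  assert (Hnc : ~ conv g y).
  { intros [q Hq]. destruct (Hq (d0 / 8)) as [Nq HNq]; [lra|].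
    destruct (Hio (Nx + Nf + Nq)%nat) as [n [Hn Hclose]].
    pose proof (Hnext n Hclose) as Hc2.
    pose proof (HNq n ltac:(lia)) as Q1. pose proof (HNq (S n) ltac:(lia)) as Q2. unfold Rdist in Q1, Q2.
    change (iter n g y) with (Y n) in *. change (iter (S n) g y) with (Y (S n)) in *.
    apply Rabs_lt_iff in Hclose, Hc2, Q1, Q2.
    destruct (Hcross n ltac:(lia)) as [H|H]; unfold X in *; lra. }
  split; [|exact Hnc].
  destruct (conv_or_alt g y Hg HN Hy) as [C|(z' & b' & Hz' & Ez' & Ny & HAy)]; [contradiction|].
  assert (HYz : forall n, Y n <> z).
  { intros n E. apply Hnc. exists z. intros eps He. exists n. intros m Hm.
    replace m with ((m - n) + n)%nat by lia. rewrite iter_add. change (iter n g y) with (Y n).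
    rewrite E, iter_fixed by assumption. unfold Rdist. rewrite Rminus_diag, Rabs_R0. exact He. }
  assert (Hside : exists N, (N >= Ny)%nat /\ forall n, (n >= N)%nat ->
      if xorb b' (Nat.odd n) then Y n < z else z < Y n).
  { assert (HA' : forall n, (n >= Ny)%nat -> (Y n < z' /\ z' < Y (S n)) \/ (z' < Y n /\ Y (S n) < z')).
    { intros n Hn. pose proof (HAy n ltac:(lia)) as A1. pose proof (HAy (S n) ltac:(lia)) as A2.
      rewrite Nat.odd_succ, <- Nat.negb_odd in A2.
      change (iter n g y) with (Y n) in *. change (iter (S n) g y) with (Y (S n)) in *.
      destruct b', (Nat.odd n); simpl xorb in *; cbv iota in *; lra. }
    (* If [Y n] lay strictly between the fixed points, a later crossing of both would be turbulent
       by [two_fixed_turb]. The orbit would thus remain on one side of [z], against its crossings in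
       the company of [x]. *)
    assert (Hno : forall n, (n >= Ny)%nat -> z < Y n < z' \/ z' < Y n < z -> False).
    { intros n Hn Hb.
      assert (Hlater : forall c, (c >= n)%nat -> (z < z' /\ z < Y c) \/ (z' < z /\ Y c < z)).
      { intros c Hc. destruct Hb as [Hb|Hb].
        - left. split; [lra|]. destruct (Rlt_le_dec z (Y c)) as [|Hle]; [assumption|]. exfalso.
          assert (c <> n) by (intros ->; lra).
          destruct (HA' c ltac:(lia)) as [[H1 H2]|[H1 H2]]; [|lra].
          apply (two_fixed_turb g (c - n) (S c - n) z (Y n) z'); auto; try lia; try (apply iter_fixed; assumption).
          left. unfold Y. rewrite <- !iter_add.
          replace (c - n + n)%nat with c by lia. replace (S c - n + n)%nat with (S c) by lia.
          fold (Y c). fold (Y (S c)). lra.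
        - right. split; [lra|]. destruct (Rlt_le_dec (Y c) z) as [|Hle]; [assumption|]. exfalso.
          assert (c <> n) by (intros ->; lra).
          destruct (HA' c ltac:(lia)) as [[H1 H2]|[H1 H2]]; [lra|].
          apply (two_fixed_turb g (c - n) (S c - n) z' (Y n) z); auto; try lia; try (apply iter_fixed; assumption).
          right. unfold Y. rewrite <- !iter_add.
          replace (c - n + n)%nat with c by lia. replace (S c - n + n)%nat with (S c) by lia.
          fold (Y c). fold (Y (S c)). lra. }
      destruct (Hio (Nx + Nf + n)%nat) as [m [Hm Hclose]]. pose proof (Hnext m Hclose) as Hc2.
      change (iter m g x) with (X m) in Hclose. change (iter m g y) with (Y m) in Hclose.
      apply Rabs_lt_iff in Hclose, Hc2.
      pose proof (Hlater m ltac:(lia)). pose proof (Hlater (S m) ltac:(lia)).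
      destruct (Hcross m ltac:(lia)); lra. }
    exists Ny. split; [lia|]. intros n Hn. specialize (HAy n Hn). change (iter n g y) with (Y n) in HAy.
    pose proof (HYz n). specialize (Hno n Hn).
    destruct (xorb b' (Nat.odd n)); destruct (Rtotal_order (Y n) z) as [?|[?|?]]; try assumption; try contradiction;
      exfalso; apply Hno; lra. }
  destruct Hside as [N [_ Hside]].
  assert (b' = b); [|subst b'; exists N; exact Hside].
  destruct (Bool.bool_dec b' b) as [|Hbb]; [assumption|]. exfalso.
  destruct (Hio (Nx + Nf + N)%nat) as [n [Hn Hclose]].
  change (iter n g x) with (X n) in Hclose. change (iter n g y) with (Y n) in Hclose.
  apply Rabs_lt_iff in Hclose. specialize (Hside n ltac:(lia)). specialize (HAx n ltac:(lia)).
  change (iter n g x) with (X n) in HAx.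
  destruct (Hcross n ltac:(lia)); destruct b, b', (Nat.odd n); try congruence; simpl xorb in *; cbv iota in *; lra.
Qed.

(** Every late time is followed within [m] steps by a sampled time [i + q m], and closeness at the
    former would propagate to the latter. *)
Lemma far_all_times f m i d : CII f -> (1 <= m)%nat -> 0 < d ->
  exists d', 0 < d' /\ forall x y, inI x -> inI y ->
    (exists N, forall n, (n >= N)%nat -> d <= Rabs (iter n (iter m f) (iter i f x) - iter n (iter m f) (iter i f y))) ->
    exists N, forall n, (n >= N)%nat -> d' <= dist_n f x y n.
Proof.
  intros Hf Hm Hd. destruct (unif_cont_iter f m d Hf Hd) as [d' [Hd' U]].
  exists d'. split; [exact Hd'|]. intros x y Hx Hy [N HN].
  exists (i + N * m)%nat. intros n Hn. unfold dist_n.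
  destruct (Rle_lt_dec d' (Rabs (iter n f x - iter n f y))) as [|Hlt]; [assumption|]. exfalso.
  set (q := ((n - i) / m + 1)%nat).
  assert (Hq : (q * m + i = (m - (n - i) mod m) + n)%nat).
  { unfold q. pose proof (Nat.div_mod (n - i) m ltac:(lia)). pose proof (Nat.mod_upper_bound (n - i) m ltac:(lia)). nia. }
  specialize (U _ _ (iter_inI f n x Hf Hx) (iter_inI f n y Hf Hy) Hlt (m - (n - i) mod m)%nat ltac:(lia)).
  rewrite <- !iter_add, <- Hq in U.
  specialize (HN q). rewrite !iter_mul, <- !iter_add in HN.
  assert (q >= N)%nat; [|specialize (HN H); lra].
  unfold q. assert (N <= (n - i) / m)%nat; [|lia]. apply Nat.div_le_lower_bound; [lia|]. lia.
Qed.

Lemma proximal_not_far f x y d : proximal f x y -> 0 < d ->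
  (exists N, forall n, (n >= N)%nat -> d <= dist_n f x y n) -> False.
Proof.
  intros (_ & _ & Hp) Hd [N HN]. destruct (Hp d Hd N) as [n [Hn H]]. specialize (HN n Hn). lra.
Qed.

Lemma proximal_sym f x y : proximal f x y -> proximal f y x.
Proof.
  intros (Hx & Hy & H). split; [exact Hy|]. split; [exact Hx|].
  intros e He N. destruct (H e He N) as [n [Hn Hd]]. exists n. split; [exact Hn|].
  unfold dist_n in *. rewrite Rabs_minus_sym. exact Hd.
Qed.

Lemma iter2_pow f k : forall n x, iter n (iter 2 (iter (2 ^ k) f)) x = iter n (iter (2 ^ S k) f) x.
Proof.
  intros n x. rewrite !iter_mul. rewrite Nat.pow_succ_r'. f_equal. lia.
Qed.

Lemma alt_ext g h z b x : (forall n, iter n g x = iter n h x) -> alt g z b x -> alt h z b x.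
Proof. intros E [N H]. exists N. intros n Hn. rewrite <- E. apply H, Hn. Qed.

(** The separator of level [k + 1] keeps the orbit of [y] away from [z], so [far_or_alt] applies
    with [y] as the reference orbit. Proximality rules out its first alternative. *)
Lemma proximal_alt f x y : CII f -> NT f -> ~ AP f y -> proximal f x y -> forall k i z b,
  inI z -> iter (2 ^ k) f z = z -> alt (iter (2 ^ k) f) z b (iter i f y) ->
  alt (iter (2 ^ k) f) z b (iter i f x) /\ ~ conv (iter (2 ^ k) f) (iter i f x).
Proof.
  intros Hf HN HA Hp k i z b Hz Ez Halt.
  assert (Hx : inI x) by apply Hp. assert (Hy : inI y) by apply Hp.
  set (g := iter (2 ^ k) f) in *.
  assert (Hg : CII g) by (apply CII_iter, Hf).
  assert (HNg : NT g) by (apply NT_iter; [apply pow2_pos|exact HN]).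
  destruct (NP_alt f y Hf HN Hy HA (S k) i) as (z1 & b1 & _ & _ & Halt1).
  destruct (alt_far g z z1 b b1 Hg Hz Ez) as [d0 [Hd0 Hfar]].
  specialize (Hfar (iter i f y) (iter_inI f i y Hf Hy) Halt
    (alt_ext _ _ _ _ _ (fun n => eq_sym (iter2_pow f k n _)) Halt1)).
  destruct (far_or_alt g z b d0 Hg HNg Hz Ez Hd0) as [d [Hd H]].
  destruct (H (iter i f y) (iter i f x) (iter_inI f i y Hf Hy) (iter_inI f i x Hf Hx) Halt Hfar) as [C|C]; [|exact C].
  exfalso. destruct (far_all_times f (2 ^ k) i d Hf (pow2_pos k) Hd) as [d' [Hd' H']].
  apply (proximal_not_far f y x d'); auto. apply proximal_sym, Hp.
Qed.

Lemma proximal_AP f x y : CII f -> NT f -> proximal f x y -> AP f x -> AP f y.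
Proof.
  intros Hf HN Hp [k Hk]. apply NNPP. intros HA.
  assert (Hy : inI y) by apply Hp.
  destruct (NP_alt f y Hf HN Hy HA k 0) as (z & b & Hz & Ez & Halt).
  destruct (proximal_alt f x y Hf HN HA Hp k 0 z b Hz Ez Halt) as [_ Hn]. apply Hn, Hk.
Qed.

Definition asym (f : R -> R) (x y : R) : Prop :=
  forall e, 0 < e -> exists N, forall n, (n >= N)%nat -> dist_n f x y n < e.

Lemma asym_sym f x y : asym f x y -> asym f y x.
Proof.
  intros H e He. destruct (H e He) as [N HN]. exists N. intros n Hn. unfold dist_n in *.
  rewrite Rabs_minus_sym. auto.
Qed.

Lemma dist_triangle f x y z n : dist_n f x z n <= dist_n f x y n + dist_n f y z n.
Proof.
  unfold dist_n. replace (iter n f x - iter n f z) with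
    ((iter n f x - iter n f y) + (iter n f y - iter n f z)) by lra. apply Rabs_triang.
Qed.

Lemma asym_trans f x y z : asym f x y -> asym f y z -> asym f x z.
Proof.
  intros H1 H2 e He. destruct (H1 (e / 2)) as [N1 A1]; [lra|]. destruct (H2 (e / 2)) as [N2 A2]; [lra|].
  exists (N1 + N2)%nat. intros n Hn. pose proof (dist_triangle f x y z n).
  specialize (A1 n ltac:(lia)). specialize (A2 n ltac:(lia)). lra.
Qed.

Lemma asym_refl f x : asym f x x.
Proof. intros e He. exists 0%nat. intros n _. unfold dist_n. rewrite Rminus_diag, Rabs_R0. exact He. Qed.

Lemma asym_proximal f x y z : inI x -> asym f x y -> proximal f y z -> proximal f x z.
Proof.
  intros Hx Ha (Hy & Hz & Hp). split; [exact Hx|]. split; [exact Hz|]. intros e He N.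
  destruct (Ha (e / 2)) as [N1 A1]; [lra|]. destruct (Hp (e / 2) ltac:(lra) (N + N1)%nat) as [n [Hn H]].
  exists n. split; [lia|]. specialize (A1 n ltac:(lia)). pose proof (dist_triangle f x y z n). lra.
Qed.

Lemma proximal_refl f x : inI x -> proximal f x x.
Proof.
  intros Hx. split; [exact Hx|]. split; [exact Hx|]. intros e He N. exists N. split; [lia|].
  unfold dist_n. rewrite Rminus_diag, Rabs_R0. exact He.
Qed.

Lemma not_asym_limsup f x y : ~ asym f x y -> limsup_pos (dist_n f x y).
Proof.
  intros H. apply not_all_ex_not in H. destruct H as [e H].
  apply imply_to_and in H. destruct H as [He H]. exists e. split; [exact He|].
  intros N. apply NNPP. intros C. apply H. exists N. intros n Hn.
  destruct (Rlt_le_dec (dist_n f x y n) e); [assumption|]. exfalso. apply C. exists n. auto.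
Qed.

Lemma asym_not_limsup f x y : asym f x y -> ~ limsup_pos (dist_n f x y).
Proof.
  intros H [d [Hd HN]]. destruct (H d Hd) as [N HN']. destruct (HN N) as [n [Hn Hdn]].
  specialize (HN' n Hn). lra.
Qed.

Lemma conv_higher f k l x : (k <= l)%nat -> conv (iter (2 ^ k) f) x -> conv (iter (2 ^ l) f) x.
Proof.
  intros Hkl [q Hq]. exists q. intros e He. destruct (Hq e He) as [N HN]. exists N. intros n Hn.
  specialize (HN (n * 2 ^ (l - k))%nat). rewrite !iter_mul in *.
  replace (n * 2 ^ (l - k) * 2 ^ k)%nat with (n * 2 ^ l)%nat in HN.
  - apply HN. pose proof (pow2_pos (l - k)). nia.
  - rewrite <- Nat.mul_assoc, <- Nat.pow_add_r. do 2 f_equal. lia.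
Qed.

(** Both orbits converge under a common power. Distinct limits would keep them apart at all late
    times; equal limits make them asymptotic by uniform continuity. *)
Lemma AP_proximal_asym f x y : CII f -> AP f x -> AP f y -> proximal f x y -> asym f x y.
Proof.
  intros Hf [k Hk] [l Hl] Hp.
  assert (Hx : inI x) by apply Hp. assert (Hy : inI y) by apply Hp.
  apply (conv_higher f k (k + l)) in Hk; [|lia]. apply (conv_higher f l (k + l)) in Hl; [|lia].
  set (m := (2 ^ (k + l))%nat) in *. assert (Hm : (1 <= m)%nat) by apply pow2_pos.
  destruct Hk as [p Hpc], Hl as [q Hqc].
  assert (E : p = q).
  { apply NNPP. intros Hpq. set (e := Rabs (p - q) / 3).
    assert (He : 0 < e) by (unfold e; assert (0 < Rabs (p - q)) by (apply Rabs_pos_lt; lra); lra).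
    destruct (far_all_times f m 0 e Hf Hm He) as [d' [Hd' H']].
    apply (proximal_not_far f x y d' Hp Hd'). apply H'; auto.
    destruct (Hpc e He) as [N1 A1]. destruct (Hqc e He) as [N2 A2].
    exists (N1 + N2)%nat. intros n Hn. specialize (A1 n ltac:(lia)). specialize (A2 n ltac:(lia)).
    unfold Rdist in *. simpl (iter 0 _ _). unfold e in *.
    unfold Rabs in *. repeat destruct (Rcase_abs _); lra. }
  subst q. intros e He. destruct (unif_cont_iter f m e Hf He) as [d [Hd U]].
  destruct (Hpc (d / 2)) as [N1 A1]; [lra|]. destruct (Hqc (d / 2)) as [N2 A2]; [lra|].
  exists ((N1 + N2) * m)%nat. intros n Hn.
  assert (Hq : (n / m >= N1 + N2)%nat) by (apply Nat.div_le_lower_bound; lia).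
  specialize (A1 (n / m)%nat ltac:(lia)). specialize (A2 (n / m)%nat ltac:(lia)). unfold Rdist in *.
  rewrite iter_mul in A1, A2.
  assert (Hc : Rabs (iter (n / m * m) f x - iter (n / m * m) f y) < d).
  { apply Rabs_lt_iff in A1, A2. apply Rabs_lt_iff. lra. }
  pose proof (Nat.mod_upper_bound n m ltac:(lia)).
  specialize (U _ _ (iter_inI f _ x Hf Hx) (iter_inI f _ y Hf Hy) Hc (n mod m)%nat ltac:(lia)).
  rewrite <- !iter_add in U.
  replace (n mod m + n / m * m)%nat with n in U by (pose proof (Nat.div_mod n m ltac:(lia)); lia).
  exact U.
Qed.

(* Bisection: among the two halves cut by the separator, follow the shorter one. *)
Lemma cosplit_proximal f x y : CII f -> inI x -> inI y ->
  (forall k i, exists z b, alt (iter (2 ^ k) f) z b (iter i f x) /\ alt (iter (2 ^ k) f) z b (iter i f y)) ->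
  proximal f x y.
Proof.
  intros Hf Hx Hy H.
  assert (HK : forall k, exists i l u N, u - l <= / 2 ^ k /\ forall n, (n >= N)%nat ->
     l <= iter (n * 2 ^ k + i) f x <= u /\ l <= iter (n * 2 ^ k + i) f y <= u).
  { induction k as [|k (i & l & u & N & Hlu & IH)].
    - exists 0%nat, 0, 1, 0%nat. split; [simpl; lra|]. intros n _.
      split; apply (iter_inI f); assumption.
    - destruct (H k i) as (z & b & [N1 H1] & [N2 H2]).
      (* [e] is the parity of the times at which both orbits lie in the shorter half *)
      assert (Hgo : forall (e : bool) l' u', u' - l' <= / 2 ^ S k ->
        (if xorb b e then l' = l /\ u' = z else l' = z /\ u' = u) ->
        exists i l u N, u - l <= / 2 ^ S k /\ forall n, (n >= N)%nat ->
          l <= iter (n * 2 ^ S k + i) f x <= u /\ l <= iter (n * 2 ^ S k + i) f y <= u).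
      { intros e l' u' Hl' He.
        exists (i + (if e then 2 ^ k else 0))%nat, l', u', (N + N1 + N2)%nat. split; [exact Hl'|].
        intros n Hn. set (m := (n * 2 + (if e then 1 else 0))%nat).
        assert (Em : (n * 2 ^ S k + (i + (if e then 2 ^ k else 0)) = m * 2 ^ k + i)%nat).
        { unfold m. rewrite Nat.pow_succ_r'. destruct e; nia. }
        rewrite Em. assert (Hm : (m >= n)%nat) by (unfold m; lia).
        assert (Om : Nat.odd m = e).
        { unfold m. rewrite Nat.odd_add, odd_double. destruct e; reflexivity. }
        specialize (IH m ltac:(lia)). specialize (H1 m ltac:(lia)). specialize (H2 m ltac:(lia)).
        rewrite Om in H1, H2. rewrite iter_mul, <- iter_add in H1, H2.
        destruct (xorb b e); destruct He as [-> ->]; lra. }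
      assert (E2 : / 2 ^ S k = / 2 ^ k / 2).
      { simpl. rewrite Rinv_mult. lra. }
      destruct (Rle_lt_dec (z - l) ((u - l) / 2)) as [Hz|Hz].
      + apply (Hgo (negb b) l z); [rewrite E2; lra|]. destruct b; simpl; auto.
      + apply (Hgo b z u); [rewrite E2; lra|]. destruct b; simpl; auto. }
  split; [exact Hx|]. split; [exact Hy|]. intros e He N.
  destruct (pow_lt_1_zero (/ 2) ltac:(rewrite Rabs_right; lra) e He) as [k Hk].
  specialize (Hk k (Nat.le_refl _)).
  destruct (HK k) as (i & l & u & N0 & Hlu & HN0).
  exists ((N + N0) * 2 ^ k + i)%nat. pose proof (pow2_pos k).
  split; [nia|]. specialize (HN0 (N + N0)%nat ltac:(lia)). unfold dist_n.
  rewrite pow_inv in Hk. rewrite Rabs_right in Hk.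
  - apply Rabs_lt_iff. lra.
  - left. apply Rinv_0_lt_compat, pow_lt. lra.
Qed.

(** An asymptotically periodic middle point makes [x] asymptotic to it, and asymptotic points can be
    exchanged. Otherwise each separator of [y] cuts both [x] and [w] in the same phase. *)
Theorem NT_prox_equiv f : CII f -> NT f -> is_equivalence_on_I (proximal f).
Proof.
  intros Hf HN. split; [intros; apply proximal_refl; assumption|].
  split; [intros x y _ _; apply proximal_sym|].
  intros x y w Hx Hy Hw Hxy Hyw.
  destruct (classic (AP f y)) as [HA|HA].
  - assert (AP f x) by (apply (proximal_AP f y x); auto; apply proximal_sym, Hxy).
    apply (asym_proximal f x y w); auto. apply AP_proximal_asym; auto.
  - apply cosplit_proximal; auto. intros k i.
    destruct (NP_alt f y Hf HN Hy HA k i) as (z & b & Hz & Ez & Halt). exists z, b. split.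
    + apply (proximal_alt f x y Hf HN HA Hxy k i z b Hz Ez Halt).
    + apply (proximal_alt f w y Hf HN HA (proximal_sym _ _ _ Hyw) k i z b Hz Ez Halt).
Qed.

Lemma scrambled_proximal f S x y : scrambled_set f S -> S x -> S y -> proximal f x y.
Proof.
  intros [HS H] Hx Hy. destruct (Req_dec x y) as [->|Hn]; [apply proximal_refl, HS, Hy|].
  apply (H x y Hx Hy Hn).
Qed.

Lemma scrambled_asym_eq f S x y : scrambled_set f S -> S x -> S y -> asym f x y -> x = y.
Proof.
  intros [HS H] Hx Hy Ha. destruct (Req_dec x y) as [|Hn]; [assumption|].
  exfalso. apply (asym_not_limsup f x y Ha). apply (H x y Hx Hy Hn).
Qed.

Lemma scrambled_AP_eq f S x y : CII f -> NT f -> scrambled_set f S -> S x -> S y -> AP f x -> x = y.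
Proof.
  intros Hf HN HS Hx Hy HA. assert (Hp := scrambled_proximal f S x y HS Hx Hy).
  apply (scrambled_asym_eq f S x y HS Hx Hy). apply AP_proximal_asym; auto.
  apply (proximal_AP f x y); auto.
Qed.

Lemma ev_ge_liminf_ge u d : (exists N, forall n, (n >= N)%nat -> d <= u n) -> liminf_ge u d.
Proof. intros [N H] e He. exists N. intros n Hn. specialize (H n Hn). lra. Qed.

(** Non-proximality singles out a separator of [x] that does not cut [y] in the same phase.
    Proximality within [S] gives its phase to all of [S], and proximality within [T] denies it to
    all of [T]. All distances are chosen before the points, so one bound serves every pair. *)
Lemma separable_of_NP f S T x y : CII f -> NT f -> scrambled_set f S -> scrambled_set f T ->
  S x -> T y -> ~ AP f x -> ~ proximal f x y -> separable_sets f S T.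
Proof.
  intros Hf HN HS HT Hx Hy HA Hp.
  assert (Ix : inI x) by (apply HS, Hx). assert (Iy : inI y) by (apply HT, Hy).
  assert (Hex : exists k i z b, inI z /\ iter (2 ^ k) f z = z /\ alt (iter (2 ^ k) f) z b (iter i f x) /\
     ~ alt (iter (2 ^ k) f) z b (iter i f y)).
  { apply NNPP. intros C. apply Hp. apply cosplit_proximal; auto. intros k i.
    destruct (NP_alt f x Hf HN Ix HA k i) as (z & b & Hz & Ez & Halt). exists z, b. split; [exact Halt|].
    apply NNPP. intros C'. apply C. exists k, i, z, b. auto. }
  destruct Hex as (k & i & z & b & Hz & Ez & Hax & Hay).
  set (g := iter (2 ^ k) f) in *.
  assert (Hg : CII g) by (apply CII_iter, Hf).
  assert (HNg : NT g) by (apply NT_iter; [apply pow2_pos|exact HN]).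
  destruct (NP_alt f x Hf HN Ix HA (Datatypes.S k) i) as (z1 & b1 & Hz1 & Ez1 & Halt1).
  destruct (alt_far g z z1 b b1 Hg Hz Ez) as [d0 [Hd0 Hfar]].
  destruct (far_or_alt g z b d0 Hg HNg Hz Ez Hd0) as [d [Hd H]].
  destruct (far_all_times f (2 ^ k) i d Hf (pow2_pos k) Hd) as [d' [Hd' H']].
  exists d'. split; [exact Hd'|]. intros x' y' Hx' Hy'. apply ev_ge_liminf_ge.
  assert (Ix' : inI x') by (apply HS, Hx'). assert (Iy' : inI y') by (apply HT, Hy').
  assert (Hpx := scrambled_proximal f S x' x HS Hx' Hx).
  assert (Hpy := scrambled_proximal f T y y' HT Hy Hy').
  apply H'; auto.
  destruct (proximal_alt f x' x Hf HN HA Hpx k i z b Hz Ez Hax) as [Hax' _].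
  destruct (proximal_alt f x' x Hf HN HA Hpx (Datatypes.S k) i z1 b1 Hz1 Ez1 Halt1) as [Hax1' _].
  destruct (H (iter i f x') (iter i f y')) as [C|[C _]]; auto.
  - apply iter_inI; auto.
  - apply iter_inI; auto.
  - apply Hfar; [apply iter_inI; auto|exact Hax'|].
    apply (alt_ext _ _ _ _ _ (fun n => eq_sym (iter2_pow f k n _)) Hax1').
  - exfalso. apply Hay. destruct (classic (AP f y')) as [HA'|HA'].
    + rewrite <- (scrambled_AP_eq f T y' y Hf HN HT Hy' Hy HA'). exact C.
    + apply (proximal_alt f y y' Hf HN HA' Hpy k i z b Hz Ez C).
Qed.

Lemma separable_sym f S T : separable_sets f S T -> separable_sets f T S.
Proof.
  intros (d & Hd & H). exists d. split; [exact Hd|]. intros x y Hx Hy e He.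
  destruct (H y x Hy Hx e He) as [N HN]. exists N. intros n Hn. specialize (HN n Hn).
  unfold dist_n in *. rewrite Rabs_minus_sym. exact HN.
Qed.

Lemma maximal_nonempty f S : maximal_scrambled f S -> exists x, S x.
Proof.
  intros [_ H]. apply NNPP. intros C. apply C. exists 0.
  apply (H (fun y => y = 0)); [|intros x Hx; exfalso; apply C; exists x; exact Hx|reflexivity].
  split; [intros x ->; unfold inI; lra|]. intros x y -> -> Hn. contradiction.
Qed.

(** A point [s] with no asymptotic partner in [T] is scrambled with every point of [T]. Maximality
    then puts it into [T], where it is its own partner. *)
Lemma maximal_asym_partner f S T : maximal_scrambled f T -> scrambled_set f S ->
  (forall s t, S s -> T t -> proximal f s t) ->
  forall s, S s -> exists t, T t /\ asym f t s.
Proof.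
  intros [HT Hmax] HS Hp s Hs. apply NNPP. intros C.
  assert (Hts : T s).
  { apply (Hmax (fun y => T y \/ y = s)); [|auto|auto].
    assert (Hn : forall t, T t -> ~ asym f t s) by (intros t Ht Ha; apply C; exists t; auto).
    split.
    - intros y [Hy| ->]; [apply HT, Hy|apply HS, Hs].
    - intros x y [Hx| ->] [Hy| ->] Hxy.
      + apply HT; assumption.
      + split; [apply proximal_sym, Hp; assumption|]. apply not_asym_limsup, Hn, Hx.
      + split; [apply Hp; assumption|]. apply not_asym_limsup. intros Ha. apply (Hn y Hy), asym_sym, Ha.
      + contradiction. }
  apply C. exists s. split; [exact Hts|apply asym_refl].
Qed.

(** One proximal cross pair would, by transitivity, make all cross pairs proximal, and sending each
    point to its asymptotic partner would be an equivalence. Without such pairs, either one of the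
    sets contains a point that is not asymptotically periodic, or both sets are singletons. *)
Theorem NT_maximal_sets f S T : CII f -> NT f -> maximal_scrambled f S -> maximal_scrambled f T ->
  ~ equivalent_sets f S T -> separable_sets f S T.
Proof.
  intros Hf HN HS HT Hne.
  destruct (NT_prox_equiv f Hf HN) as [_ [_ Htr]].
  assert (HnP : forall x y, S x -> T y -> ~ proximal f x y).
  { intros x0 y0 Hx0 Hy0 Hp0. apply Hne.
    assert (Hall : forall s t, S s -> T t -> proximal f s t).
    { intros s t Hs Ht.
      assert (Is : inI s) by (apply HS, Hs). assert (It : inI t) by (apply HT, Ht).
      assert (Ix0 : inI x0) by (apply HS, Hx0). assert (Iy0 : inI y0) by (apply HT, Hy0).
      apply (Htr s x0 t); auto; [apply (scrambled_proximal f S); auto; apply HS|].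
      apply (Htr x0 y0 t); auto. apply (scrambled_proximal f T); auto; apply HT. }
    assert (Hpart := maximal_asym_partner f S T HT (proj1 HS) Hall).
    assert (Hpart' := maximal_asym_partner f T S HS (proj1 HT)
      (fun t s Ht Hs => proximal_sym f s t (Hall s t Hs Ht))).
    set (phi := fun s => epsilon (inhabits 0) (fun t => T t /\ asym f t s)).
    assert (Hphi : forall s, S s -> T (phi s) /\ asym f (phi s) s)
      by (intros s Hs; unfold phi; apply epsilon_spec, Hpart, Hs).
    exists phi. split; [intros; apply Hphi; assumption|]. split; [|split].
    - intros x y Hx Hy E. apply (scrambled_asym_eq f S x y (proj1 HS) Hx Hy).
      destruct (Hphi x Hx) as [_ A]. destruct (Hphi y Hy) as [_ B]. rewrite E in A.
      apply (asym_trans f x (phi y) y); [apply asym_sym, A|exact B].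
    - intros z Hz. destruct (Hpart' z Hz) as [s [Hs Ha]]. exists s. split; [exact Hs|].
      destruct (Hphi s Hs) as [A B]. apply (scrambled_asym_eq f T _ _ (proj1 HT) A Hz).
      apply (asym_trans f _ s _); assumption.
    - intros x Hx e He. destruct (proj2 (Hphi x Hx) e He) as [N HN']. exists N. intros n Hn.
      specialize (HN' n Hn). unfold dist_n in HN'. rewrite Rabs_Rabsolu. exact HN'. }
  destruct (maximal_nonempty f S HS) as [x Hx]. destruct (maximal_nonempty f T HT) as [y Hy].
  assert (Hxy := HnP x y Hx Hy).
  destruct (classic (AP f x)) as [HA|HA].
  - destruct (classic (AP f y)) as [HB|HB].
    + assert (Hd : exists d, 0 < d /\ exists N, forall n, (n >= N)%nat -> d <= dist_n f x y n).
      { apply NNPP. intros C. apply Hxy. split; [apply HS, Hx|]. split; [apply HT, Hy|].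
        intros e He. apply not_ev_ge. intros C'. apply C. exists e. auto. }
      destruct Hd as (d & Hd & HN').
      exists d. split; [exact Hd|]. intros x' y' Hx' Hy'.
      rewrite <- (scrambled_AP_eq f S x x' Hf HN (proj1 HS) Hx Hx' HA).
      rewrite <- (scrambled_AP_eq f T y y' Hf HN (proj1 HT) Hy Hy' HB).
      apply ev_ge_liminf_ge, HN'.
    + apply separable_sym. apply (separable_of_NP f T S y x); auto; try apply HS; try apply HT.
      intros C. apply Hxy, proximal_sym, C.
  - apply (separable_of_NP f S T x y); auto; try apply HS; try apply HT.
Qed.

(** * Limit points with the same dyadic itinerary *)

Lemma dep_choice {A : Type} (P : nat -> A -> Prop) (Rl : nat -> A -> A -> Prop) (a0 : A) :
  P 0%nat a0 -> (forall n a, P n a -> exists a', P (S n) a' /\ Rl n a a') ->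
  exists u : nat -> A, u 0%nat = a0 /\ forall n, P n (u n) /\ Rl n (u n) (u (S n)).
Proof.
  intros H0 HS.
  set (nxt := fun n a => epsilon (inhabits a0) (fun a' => P (S n) a' /\ Rl n a a')).
  set (u := fix u n := match n with O => a0 | S m => nxt m (u m) end).
  assert (HP : forall n, P n (u n)).
  { induction n as [|n IH]; [exact H0|]. simpl. unfold nxt.
    apply (epsilon_spec (inhabits a0) (fun a' => P (S n) a' /\ Rl n (u n) a')). apply HS, IH. }
  exists u. split; [reflexivity|]. intros n. split; [apply HP|]. simpl. unfold nxt.
  apply (epsilon_spec (inhabits a0) (fun a' => P (S n) a' /\ Rl n (u n) a')). apply HS, HP.
Qed.

Lemma fun_choice {A B : Type} (P : A -> B -> Prop) : (forall a, exists b, P a b) ->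
  exists h : A -> B, forall a, P a (h a).
Proof.
  intros H. exists (fun a => proj1_sig (constructive_indefinite_description _ (H a))).
  intros a. apply proj2_sig.
Qed.

Lemma inf_pigeonhole {B : Type} (P : nat -> B -> Prop) (l : list B) :
  (forall N, exists n b, (n >= N)%nat /\ In b l /\ P n b) ->
  exists b, In b l /\ forall N, exists n, (n >= N)%nat /\ P n b.
Proof.
  induction l as [|b l IH]; intros H.
  - destruct (H 0%nat) as (n & b & _ & [] & _).
  - destruct (classic (forall N, exists n, (n >= N)%nat /\ P n b)) as [Hb|Hb].
    + exists b. split; [left; reflexivity|exact Hb].
    + apply not_all_ex_not in Hb. destruct Hb as [N0 Hb].
      destruct IH as (c & Hc & HP).
      { intros N. destruct (H (N + N0)%nat) as (n & c & Hn & [<-|Hc] & Hp).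
        - exfalso. apply Hb. exists n. split; [lia|exact Hp].
        - exists n, c. split; [lia|]. auto. }
      exists c. split; [right; exact Hc|exact HP].
Qed.

Lemma mod_pow_mono k l n : (k <= l)%nat -> ((n mod 2 ^ l) mod 2 ^ k = n mod 2 ^ k)%nat.
Proof.
  intros H. replace l with (k + (l - k))%nat by lia. rewrite Nat.pow_add_r.
  rewrite Nat.Div0.mod_mul_r, (Nat.mul_comm (2 ^ k)), Nat.Div0.mod_add.
  apply Nat.Div0.mod_mod.
Qed.

Lemma mod_pow_S k n : (n mod 2 ^ S k = n mod 2 ^ k + 2 ^ k * (if Nat.odd (n / 2 ^ k) then 1 else 0))%nat.
Proof.
  rewrite Nat.pow_succ_r', Nat.mul_comm, Nat.Div0.mod_mul_r. do 2 f_equal.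
  rewrite <- Nat.bit0_mod, Nat.bit0_odd. destruct (Nat.odd _); reflexivity.
Qed.

Lemma mod_cancel M a m : (0 < M)%nat -> ((a + m) mod M = a mod M -> m mod M = 0)%nat.
Proof.
  intros HM H. pose proof (Nat.div_mod (a + m) M ltac:(lia)) as E1. pose proof (Nat.div_mod a M ltac:(lia)) as E2.
  assert (m = (((a + m) / M) - (a / M)) * M)%nat as ->; [|apply Nat.Div0.mod_mul].
  rewrite Nat.mul_sub_distr_r. rewrite H in E1. nia.
Qed.

Lemma mod0_iter f k m z : iter (2 ^ k) f z = z -> (m mod 2 ^ k = 0)%nat -> iter m f z = z.
Proof.
  intros Ez Hm. apply Nat.Div0.div_exact in Hm. rewrite Hm, Nat.mul_comm, <- iter_mul. apply iter_fixed, Ez.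
Qed.

(* Koenig's lemma on the binary tree of residues modulo powers of two. *)
Lemma residue_branch (Q : nat -> nat -> Prop) :
  (forall k i, Q k i -> (i < 2 ^ k)%nat) ->
  (forall k i, Q (S k) i -> Q k (i mod 2 ^ k)%nat) ->
  (forall k, exists i, Q k i) ->
  exists r : nat -> nat, forall k, Q k (r k) /\ (r (S k) mod 2 ^ k = r k)%nat.
Proof.
  intros Hlt Hmono Hex.
  assert (Hmono' : forall d k i, Q (d + k)%nat i -> Q k (i mod 2 ^ k)%nat).
  { induction d as [|d IH]; intros k i H.
    - rewrite Nat.mod_small; [exact H|]. apply (Hlt k i H).
    - simpl in H. apply Hmono in H. apply IH in H. rewrite mod_pow_mono in H by lia. exact H. }
  (* [Ext k i] says that the node has descendants at every deeper level. If neither child had this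
     property, failing at [K1] and [K2], a descendant at level [K1 + K2] would contradict one of the
     failures. *)
  set (Ext := fun k i => forall K, (k <= K)%nat -> exists i', Q K i' /\ (i' mod 2 ^ k = i)%nat).
  destruct (dep_choice Ext (fun k i i' => (i' mod 2 ^ k = i)%nat) 0%nat) as (r & _ & Hr).
  - intros K _. destruct (Hex K) as [i Hi]. exists i. split; [exact Hi|]. apply Nat.mod_1_r.
  - intros k i Hi. apply NNPP. intros C.
    assert (Hi2 : (i < 2 ^ k)%nat).
    { destruct (Hi k (Nat.le_refl _)) as [i' [_ <-]]. apply Nat.mod_upper_bound. pose proof (pow2_pos k). lia. }
    assert (Hno : forall c, (c = 0 \/ c = 1)%nat -> exists K, (S k <= K)%nat /\ forall i', Q K i' -> (i' mod 2 ^ S k <> i + 2 ^ k * c)%nat).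
    { intros c Hc. apply NNPP. intros C'. apply C. exists (i + 2 ^ k * c)%nat. split.
      - intros K HK. apply NNPP. intros C''. apply C'. exists K. split; [exact HK|].
        intros i' HQ E. apply C''. exists i'. auto.
      - rewrite Nat.mul_comm, Nat.Div0.mod_add. apply Nat.mod_small, Hi2. }
    destruct (Hno 0%nat (or_introl eq_refl)) as (K1 & HK1 & N1).
    destruct (Hno 1%nat (or_intror eq_refl)) as (K2 & HK2 & N2).
    destruct (Hi (K1 + K2)%nat ltac:(lia)) as (i' & HQ & E).
    assert (HQ1 := Hmono' K2 K1 i'). rewrite Nat.add_comm in HQ1. specialize (HQ1 HQ).
    assert (HQ2 := Hmono' K1 K2 i' HQ).
    apply N1 in HQ1. apply N2 in HQ2.
    rewrite mod_pow_mono, mod_pow_S, E in HQ1 by lia. rewrite mod_pow_mono, mod_pow_S, E in HQ2 by lia.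
    destruct (Nat.odd (i' / 2 ^ k)); lia.
  - exists r. intros k. destruct (Hr k) as [HE Hk]. split; [|exact Hk].
    destruct (HE k (Nat.le_refl _)) as (i' & HQ & E).
    rewrite Nat.mod_small in E by (apply (Hlt k i' HQ)). subst. exact HQ.
Qed.

Definition side (b : bool) (x z : R) : Prop := if b then x < z else z < x.

Lemma alt_side f k z b i x : alt (iter (2 ^ k) f) z b (iter i f x) -> (i < 2 ^ k)%nat ->
  exists N, forall m, (m >= N)%nat -> (m mod 2 ^ k = i)%nat ->
    side (xorb b (Nat.odd (m / 2 ^ k))) (iter m f x) z.
Proof.
  intros [N H] Hi. exists (N * 2 ^ k + i)%nat. intros m Hm E.
  pose proof (Nat.div_mod m (2 ^ k) ltac:(pose proof (pow2_pos k); lia)) as D. rewrite E in D.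
  specialize (H (m / 2 ^ k)%nat). rewrite iter_mul, <- iter_add in H.
  replace (m / 2 ^ k * 2 ^ k + i)%nat with m in H by lia. apply H. nia.
Qed.

Definition cosplit3 (f : R -> R) (x1 x2 x3 : R) : Prop :=
  forall k i, exists z b, inI z /\ iter (2 ^ k) f z = z /\ alt (iter (2 ^ k) f) z b (iter i f x1) /\
    alt (iter (2 ^ k) f) z b (iter i f x2) /\ alt (iter (2 ^ k) f) z b (iter i f x3).

Definition recurs (S : nat -> Prop) (k i : nat) : Prop :=
  forall N, exists n, (n >= N)%nat /\ (n mod 2 ^ k = i)%nat /\ S n.

(* In a map without turbulent iterates a component of a solenoid contains at most two limit points:
   a middle visit returning to [p, p'] at a time of dyadic valuation [j] forces the image of [p, p']
   over the separator [z j]; a further separator on the same side provides an orbit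
   of [x1] (or [x3]) beyond [p'] (or [p]) which returns before [p] (or after [p']). *)
Lemma no_middle_visits f x1 x2 x3 p p' r : CII f -> NT f -> inI x1 -> inI x2 -> inI x3 ->
  cosplit3 f x1 x2 x3 -> p <= p' ->
  (forall k, (r (S k) mod 2 ^ k = r k)%nat) ->
  (forall k, (r k < 2 ^ k)%nat) ->
  (forall k, recurs (fun n => iter n f x1 <= p) k (r k)) ->
  (forall k, recurs (fun n => p <= iter n f x2 <= p') k (r k)) ->
  (forall k, recurs (fun n => p' <= iter n f x3) k (r k)) -> False.
Proof.
  intros Hf HN I1 I2 I3 Hco Hpp Hr Hrlt R1 R2 R3.
  destruct (fun_choice (fun k (zb : R * bool) => inI (fst zb) /\ iter (2 ^ k) f (fst zb) = fst zb /\
     alt (iter (2 ^ k) f) (fst zb) (snd zb) (iter (r k) f x1) /\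
     alt (iter (2 ^ k) f) (fst zb) (snd zb) (iter (r k) f x2) /\
     alt (iter (2 ^ k) f) (fst zb) (snd zb) (iter (r k) f x3))) as [zb Hzb].
  { intros k. destruct (Hco k (r k)) as (z & b & H). exists (z, b). exact H. }
  set (z := fun k => fst (zb k)) in *.
  set (cg := fun k m => (m mod 2 ^ k = r k)%nat).
  assert (Hp2 : forall k, (1 <= 2 ^ k)%nat) by apply pow2_pos.
  assert (Hcg : forall k m, cg (S k) m -> cg k m).
  { unfold cg. intros k m E. rewrite <- (mod_pow_mono k (S k)), E by lia. apply Hr. }
  assert (Hcgm : forall d k m, cg (d + k)%nat m -> cg k m).
  { induction d as [|d IH]; intros k m H; [exact H|]. apply IH, Hcg, H. }
  assert (Hcgm' : forall k l m, (k <= l)%nat -> cg l m -> cg k m).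
  { intros k l m Hkl H. apply (Hcgm (l - k)%nat). replace (l - k + k)%nat with l by lia. exact H. }
  (* the side of the separator [z k] on which the orbits lie at the times congruent to [r (S k)] *)
  set (s := fun k => xorb (snd (zb k)) (Nat.odd (r (S k) / 2 ^ k))).
  assert (Hodd : forall k m, cg (S k) m -> Nat.odd (m / 2 ^ k) = Nat.odd (r (S k) / 2 ^ k)).
  { intros k m E. unfold cg in E. pose proof (Hcg k m E) as E'. unfold cg in E'.
    rewrite mod_pow_S, E' in E. pose proof (mod_pow_S k (r (S k))) as F.
    rewrite Nat.mod_small, Hr in F by apply Hrlt. specialize (Hp2 k).
    destruct (Nat.odd (m / 2 ^ k)), (Nat.odd (r (S k) / 2 ^ k)); try reflexivity; lia. }
  assert (Hodd' : forall k m, cg k m -> ~ cg (S k) m -> Nat.odd (m / 2 ^ k) = negb (Nat.odd (r (S k) / 2 ^ k))).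
  { intros k m E E'. unfold cg in E, E'. rewrite mod_pow_S, E in E'.
    pose proof (mod_pow_S k (r (S k))) as F. rewrite Nat.mod_small, Hr in F by apply Hrlt.
    destruct (Nat.odd (m / 2 ^ k)), (Nat.odd (r (S k) / 2 ^ k)); try reflexivity; exfalso; lia. }
  assert (HS : forall k, exists N, forall m, (m >= N)%nat ->
     (cg (S k) m -> side (s k) (iter m f x1) (z k) /\ side (s k) (iter m f x2) (z k) /\ side (s k) (iter m f x3) (z k)) /\
     (cg k m -> ~ cg (S k) m -> side (negb (s k)) (iter m f x1) (z k) /\ side (negb (s k)) (iter m f x2) (z k) /\
        side (negb (s k)) (iter m f x3) (z k))).
  { intros k. destruct (Hzb k) as (_ & _ & A1 & A2 & A3).
    apply alt_side in A1; [|apply Hrlt]. apply alt_side in A2; [|apply Hrlt]. apply alt_side in A3; [|apply Hrlt].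
    destruct A1 as [N1 A1], A2 as [N2 A2], A3 as [N3 A3].
    exists (N1 + N2 + N3)%nat. intros m Hm. split.
    - intros E. pose proof (Hcg k m E) as E'. unfold s. rewrite <- (Hodd k m E).
      split; [|split]; [apply A1|apply A2|apply A3]; try exact E'; lia.
    - intros E E'. unfold s. rewrite <- Bool.xorb_true_r, Bool.xorb_assoc, Bool.xorb_true_r, <- (Hodd' k m E E').
      split; [|split]; [apply A1|apply A2|apply A3]; try exact E; lia. }
  assert (Hother : forall k N, exists m, (m >= N)%nat /\ cg k m /\ ~ cg (S k) m).
  { intros k N. destruct (R1 (S k) N) as (n & Hn & E & _). exists (n + 2 ^ k)%nat. split; [lia|].
    pose proof (Hcg k n E) as E'. unfold cg in *.
    assert (E1 : ((n + 2 ^ k) mod 2 ^ k = r k)%nat).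
    { replace (n + 2 ^ k)%nat with (n + 1 * 2 ^ k)%nat by lia. rewrite Nat.Div0.mod_add. exact E'. }
    split; [exact E1|]. intros E2. rewrite <- E in E2. apply mod_cancel in E2; [|pose proof (Hp2 (S k)); lia].
    rewrite Nat.mod_small in E2; [specialize (Hp2 k); lia|]. rewrite Nat.pow_succ_r'. specialize (Hp2 k). lia. }
  (* A sequence of sides repeats each of its late values, so every late separator has a deeper one
     on the same side. *)
  assert (Hj0 : exists j0, forall j, (j >= j0)%nat -> exists k, (k > j)%nat /\ s k = s j).
  { destruct (classic (forall N, exists n, (n >= N)%nat /\ s n = true)) as [A|A].
    - destruct (classic (forall N, exists n, (n >= N)%nat /\ s n = false)) as [B|B].
      + exists 0%nat. intros j _. destruct (s j) eqn:E.
        * destruct (A (S j)) as [k [Hk E']]. exists k. split; [lia|exact E'].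
        * destruct (B (S j)) as [k [Hk E']]. exists k. split; [lia|exact E'].
      + apply not_all_ex_not in B. destruct B as [N B]. exists N. intros j Hj. exists (S j). split; [lia|].
        assert (Ht : forall i, (i >= N)%nat -> s i = true)
          by (intros i Hi; destruct (s i) eqn:E; [reflexivity|exfalso; apply B; exists i; auto]).
        rewrite !Ht by lia. reflexivity.
    - apply not_all_ex_not in A. destruct A as [N A]. exists N. intros j Hj. exists (S j). split; [lia|].
      assert (Ht : forall i, (i >= N)%nat -> s i = false)
        by (intros i Hi; destruct (s i) eqn:E; [exfalso; apply A; exists i; auto|reflexivity]).
      rewrite !Ht by lia. reflexivity. }
  destruct Hj0 as [j0 Hj0].
  (* Two distinct times cannot both follow the branch at all levels, since at level [b] both would
     equal [r b]. One of two middle visits therefore leaves the branch; below, [j] is the level at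
     which it does so. *)
  assert (Hn0 : exists n0 K, cg j0 n0 /\ p <= iter n0 f x2 <= p' /\ ~ cg K n0).
  { destruct (R2 j0 0%nat) as (a & _ & Ea & Va). destruct (R2 j0 (S a)) as (b & Hb & Eb & Vb).
    destruct (classic (exists K, ~ cg K a)) as [[K HK]|HK]; [exists a, K; auto|].
    exists b, b. split; [exact Eb|]. split; [exact Vb|]. intros C.
    assert (Ca : cg b a) by (apply NNPP; intros C'; apply HK; exists b; exact C').
    unfold cg in C, Ca. assert (b < 2 ^ b)%nat by (apply Nat.pow_gt_lin_r; lia).
    rewrite Nat.mod_small in C, Ca by lia. lia. }
  destruct Hn0 as (n0 & K & En0 & Vn0 & HK).
  assert (Hj : exists j, (j >= j0)%nat /\ cg j n0 /\ ~ cg (S j) n0).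
  { apply NNPP. intros C.
    assert (Hall : forall d, cg (d + j0)%nat n0).
    { induction d as [|d IH]; [exact En0|]. apply NNPP. intros C'. apply C. exists (d + j0)%nat.
      split; [lia|]. split; [exact IH|exact C']. }
    apply HK. apply (Hcgm' K (K + j0)%nat); [lia|apply Hall]. }
  destruct Hj as (j & Hjj & Ej & ESj).
  destruct (Hj0 j Hjj) as (k & Hkj & Esk).
  destruct (R2 (S j) (S n0)) as (n1 & Hn1 & En1 & Vn1).
  (* [n0] leaves the branch exactly at level [j] whereas [n1] is still on it at level [j + 1]. So
     [m] is divisible by [2^j] but not by [2^(j+1)], and adding it moves times of the branch into
     the sibling class. *)
  set (m := (n1 - n0)%nat).
  destruct (HS j) as [Nj HSj]. destruct (HS k) as [Nk HSk].
  destruct (R2 (S j) Nj) as (n2 & Hn2 & En2 & Vn2).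
  assert (Em : (m mod 2 ^ j = 0)%nat).
  { apply (mod_cancel _ n0); [specialize (Hp2 j); lia|]. replace (n0 + m)%nat with n1 by (unfold m; lia).
    pose proof (Hcg j n1 En1) as E. unfold cg in *. congruence. }
  assert (E2m : cg j (n2 + m)%nat).
  { unfold cg. rewrite Nat.Div0.add_mod, Em, Nat.add_0_r, Nat.Div0.mod_mod. apply Hcg, En2. }
  assert (E2m' : ~ cg (S j) (n2 + m)%nat).
  { intros E. unfold cg in E, En2. rewrite <- En2 in E. apply mod_cancel in E; [|specialize (Hp2 (S j)); lia].
    apply ESj. unfold cg in *. rewrite <- En1. replace n1 with (n0 + m)%nat by (unfold m; lia).
    rewrite Nat.Div0.add_mod, E, Nat.add_0_r, Nat.Div0.mod_mod. reflexivity. }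
  destruct (Hzb j) as (Izj & Ezj & _).
  fold (z j) in Izj, Ezj.
  assert (Hit : forall a b x, iter a f (iter b f x) = iter (a + b) f x) by (intros; symmetry; apply iter_add).
  assert (Hi2 : forall n, inI (iter n f x2)) by (intros; apply iter_inI; assumption).
  assert (Hs2 : side (negb (s j)) (iter (n2 + m) f x2) (z j)) by (apply (HSj (n2 + m)%nat); [lia|exact E2m|exact E2m']).
  (* The middle visits at [n0] and [n2] are sent by [f^m] to opposite sides of [z j], so some point
     of [[p, p']] is sent onto [z j]. *)
  assert (Ht : side (s j) (iter n1 f x2) (z j) -> exists t, p <= t <= p' /\ iter m f t = z j).
  { intros Hs1.
    assert (Hu : iter m f (iter n0 f x2) = iter n1 f x2) by (rewrite Hit; f_equal; unfold m; lia).
    assert (Hw : iter m f (iter n2 f x2) = iter (n2 + m) f x2) by (rewrite Hit; f_equal; lia).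
    destruct (Rle_lt_dec (iter n0 f x2) (iter n2 f x2)) as [L|L].
    - destruct (ivt (iter m f) (iter n0 f x2) (iter n2 f x2) (z j)) as [t [Ht Et]]; auto; [apply CII_iter, Hf| |].
      + rewrite Hu, Hw. unfold side in *. destruct (s j); simpl in *; lra.
      + exists t. split; [lra|exact Et].
    - destruct (ivt (iter m f) (iter n2 f x2) (iter n0 f x2) (z j)) as [t [Ht Et]]; auto; [apply CII_iter, Hf|lra| |].
      + rewrite Hu, Hw. unfold side in *. destruct (s j); simpl in *; lra.
      + exists t. split; [lra|exact Et]. }
  (* At time [b], on the branch at level [k] but not at level [k + 1], the orbits are on the usual
     side of [z j] and on the unusual side of [z k]. They thus lie between these two separators,
     outside [[p, p']]. *)
  destruct (Hother k (Nj + Nk)%nat) as (b & Hb & Eb & Eb').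
  assert (EbS : cg (S j) b) by (apply (Hcgm' (S j) k); [lia|exact Eb]).
  destruct (HSj b ltac:(lia)) as [Hbj _]. specialize (Hbj EbS).
  destruct (HSk b ltac:(lia)) as [_ Hbk]. specialize (Hbk Eb Eb').
  assert (Hret : forall c, cg (S j) c -> (c >= b + m + 1)%nat ->
     (1 <= c - b)%nat /\ iter (c - b) f (z j) = z j /\ iter (c - b - m) f (z j) = z j).
  { intros c Ec Hc. pose proof (Hcg j c Ec) as Ec'. pose proof (Hcg j b EbS) as Ebj.
    assert (M1 : ((c - b) mod 2 ^ j = 0)%nat).
    { apply (mod_cancel _ b); [specialize (Hp2 j); lia|]. replace (b + (c - b))%nat with c by lia.
      unfold cg in *. congruence. }
    split; [lia|]. split; [apply (mod0_iter f j); assumption|].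
    apply (mod0_iter f j); [assumption|].
    apply (mod_cancel _ m); [specialize (Hp2 j); lia|]. replace (m + (c - b - m))%nat with (c - b)%nat by lia.
    congruence. }
  assert (Hpull : forall N t, (N >= m)%nat -> iter m f t = z j -> iter (N - m) f (z j) = z j -> iter N f t = z j).
  { intros N t HNm Et E. replace N with ((N - m) + m)%nat by lia. rewrite iter_add, Et. exact E. }
  destruct (s j) eqn:Esj.
  - (* both separators lie to the right of [p'] *)
    destruct (R3 (S k) Nk) as (n3 & Hn3 & En3 & V3).
    destruct (HSk n3 ltac:(lia)) as [Hs3 _]. specialize (Hs3 En3). rewrite Esk in Hs3, Hbk. simpl in *.
    assert (p' < iter b f x1) by lra.
    destruct (R1 (S j) (b + m + 1)%nat) as (c & Hc & Ec & Vc).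
    destruct (Hret c Ec Hc) as (Hcb & Ez1 & Ez2).
    destruct Ht as (t & Ht & Et); [lra|].
    apply (Hpull (c - b)%nat t ltac:(lia)) in Et; [|exact Ez2].
    assert (Eq : iter (c - b) f (iter b f x1) <= p).
    { rewrite Hit. replace (c - b + b)%nat with c by lia. exact Vc. }
    apply (HN (c - b)%nat Hcb).
    assert (Ip : inI p).
    { pose proof (iter_inI f c x1 Hf I1). pose proof (Hi2 n1). unfold inI in *. lra. }
    exists p, (iter b f x1), (z j). split; [exact Ip|]. split; [exact Izj|]. split; [lra|].
    split; [exists (iter b f x1); lra|]. split; [exists t; lra|]. split; [exists (iter b f x1); lra|].
    exists (z j). rewrite Ez1. lra.
  - (* both separators lie to the left of [p] *)
    destruct (R1 (S k) Nk) as (n3 & Hn3 & En3 & V3).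
    destruct (HSk n3 ltac:(lia)) as [Hs3 _]. specialize (Hs3 En3). rewrite Esk in Hs3, Hbk. simpl in *.
    assert (iter b f x3 < p) by lra.
    destruct (R3 (S j) (b + m + 1)%nat) as (c & Hc & Ec & Vc).
    destruct (Hret c Ec Hc) as (Hcb & Ez1 & Ez2).
    destruct Ht as (t & Ht & Et); [lra|].
    apply (Hpull (c - b)%nat t ltac:(lia)) in Et; [|exact Ez2].
    assert (Eq : p' <= iter (c - b) f (iter b f x3)).
    { rewrite Hit. replace (c - b + b)%nat with c by lia. exact Vc. }
    apply (HN (c - b)%nat Hcb).
    assert (Ip : inI p').
    { pose proof (iter_inI f c x3 Hf I3). pose proof (Hi2 n1). unfold inI in *. lra. }
    exists (z j), (iter b f x3), p'. split; [exact Izj|]. split; [exact Ip|]. split; [lra|].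
    split; [exists (z j); rewrite Ez1; lra|]. split; [exists (iter b f x3); lra|]. split; [exists t; lra|].
    exists (iter b f x3); lra.
Qed.

Lemma recurs_mono S k i : recurs S (Datatypes.S k) i -> recurs S k (i mod 2 ^ k)%nat.
Proof.
  intros H N. destruct (H N) as (n & Hn & E & HS). exists n. split; [exact Hn|]. split; [|exact HS].
  rewrite <- E, mod_pow_mono by lia. reflexivity.
Qed.

(** Levelwise residues need not be compatible with each other; the branch of the residue tree makes
    them so. *)
Lemma no_middle_visits_tree f x1 x2 x3 p p' : CII f -> NT f -> inI x1 -> inI x2 -> inI x3 ->
  cosplit3 f x1 x2 x3 -> p <= p' ->
  (forall k, exists i, (i < 2 ^ k)%nat /\ recurs (fun n => iter n f x1 <= p) k i /\
     recurs (fun n => p <= iter n f x2 <= p') k i /\ recurs (fun n => p' <= iter n f x3) k i) -> False.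
Proof.
  intros Hf HN I1 I2 I3 Hco Hpp Hk.
  destruct (residue_branch (fun k i => (i < 2 ^ k)%nat /\ recurs (fun n => iter n f x1 <= p) k i /\
     recurs (fun n => p <= iter n f x2 <= p') k i /\ recurs (fun n => p' <= iter n f x3) k i)) as [r Hr].
  - intros k i H. apply H.
  - intros k i (H0 & H1 & H2 & H3). split; [apply Nat.mod_upper_bound; pose proof (pow2_pos k); lia|].
    split; [|split]; apply recurs_mono; assumption.
  - exact Hk.
  - apply (no_middle_visits f x1 x2 x3 p p' r); auto; intros k; destruct (Hr k) as ((? & ? & ? & ?) & ?); assumption.
Qed.

(** A finite stock of thresholds, fine enough to separate points at the given distance. Finiteness
    lets a pigeonhole fix the same thresholds for infinitely many times or levels. *)
Definition grid (M : nat) : list R := map (fun i => INR i / INR M) (seq 0 (S M)).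

Lemma grid_between M u v : (0 < M)%nat -> inI u -> inI v -> 2 / INR M < v - u ->
  exists p, In p (grid M) /\ u < p < v.
Proof.
  intros HM Hu Hv Huv.
  assert (HM' : 0 < INR M) by (apply lt_0_INR; exact HM).
  destruct (letter_spec M u Hu) as [A1 A2]. set (i := letter M u) in *.
  assert (Hvm : (u + 2 / INR M) * INR M < v * INR M) by (apply Rmult_lt_compat_r; lra).
  replace ((u + 2 / INR M) * INR M) with (u * INR M + 2) in Hvm by (field; lra).
  assert (E : INR i / INR M * INR M = INR i) by (field; lra).
  exists (INR i / INR M). split.
  - apply in_map_iff. exists i. split; [reflexivity|]. apply in_seq. split; [lia|].
    simpl. apply Nat.lt_succ_r, INR_le.
    assert (v * INR M <= 1 * INR M) by (apply Rmult_le_compat_r; [lra|apply Hv]). lra.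
  - split; apply (Rmult_lt_reg_r (INR M)); try exact HM'; rewrite E; lra.
Qed.

Lemma grid_exists d : 0 < d -> exists M, (0 < M)%nat /\ 2 / INR M < d.
Proof.
  intros Hd. destruct (INR_unbounded (2 / d)) as [M HM].
  assert (0 < 2 / d) by (apply Rdiv_lt_0_compat; lra).
  assert (HM0 : 0 < INR M) by lra.
  exists M. split; [apply INR_lt; simpl; exact HM0|].
  apply (Rmult_lt_reg_r (INR M)); [exact HM0|]. replace (2 / INR M * INR M) with 2 by (field; lra).
  apply (Rmult_lt_compat_l d) in HM; [|exact Hd]. replace (d * (2 / d)) with 2 in HM by (field; lra). lra.
Qed.

Lemma separate3 M a b c : (0 < M)%nat -> inI a -> inI b -> inI c ->
  2 / INR M < b - a -> 2 / INR M < c - b ->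
  exists p p', In p (grid M) /\ In p' (grid M) /\ a < p < b /\ b < p' < c.
Proof.
  intros HM Ha Hb Hc H1 H2.
  destruct (grid_between M a b HM Ha Hb H1) as (p & Hp & Hp').
  destruct (grid_between M b c HM Hb Hc H2) as (q & Hq & Hq').
  exists p, q. auto.
Qed.

Lemma min3_ge d a b c : d <= min3 a b c -> d <= a /\ d <= b /\ d <= c.
Proof.
  unfold min3. intros H. pose proof (Rmin_l a (Rmin b c)). pose proof (Rmin_r a (Rmin b c)).
  pose proof (Rmin_l b c). pose proof (Rmin_r b c). lra.
Qed.

Lemma max3_lt e a b c : max3 a b c < e -> a < e /\ b < e /\ c < e.
Proof.
  unfold max3. intros H. pose proof (Rmax_l a (Rmax b c)). pose proof (Rmax_r a (Rmax b c)).
  pose proof (Rmax_l b c). pose proof (Rmax_r b c). lra.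
Qed.

Lemma sort3 d (a b c : R) : 0 < d -> d <= Rabs (a - b) -> d <= Rabs (a - c) -> d <= Rabs (b - c) ->
  (d <= b - a /\ d <= c - b) \/ (d <= c - a /\ d <= b - c) \/ (d <= a - b /\ d <= c - a) \/
  (d <= c - b /\ d <= a - c) \/ (d <= a - c /\ d <= b - a) \/ (d <= b - c /\ d <= a - b).
Proof.
  intros Hd. unfold Rabs. repeat destruct (Rcase_abs _); intros; try lra;
  repeat (try (left; lra); right); lra.
Qed.

Lemma cosplit3_perm f x1 x2 x3 a b c : cosplit3 f x1 x2 x3 ->
  In a (x1 :: x2 :: x3 :: nil) -> In b (x1 :: x2 :: x3 :: nil) -> In c (x1 :: x2 :: x3 :: nil) ->
  cosplit3 f a b c.
Proof.
  intros H Ha Hb Hc k i. destruct (H k i) as (z & s & Hz & Ez & A1 & A2 & A3).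
  exists z, s. split; [exact Hz|]. split; [exact Ez|].
  assert (Hall : forall y, In y (x1 :: x2 :: x3 :: nil) -> alt (iter (2 ^ k) f) z s (iter i f y)).
  { intros y [<-|[<-|[<-|[]]]]; assumption. }
  auto.
Qed.

(** An asymptotically periodic point would be asymptotic to the others. Otherwise the three orbits
    share all separators, and a pigeonhole keeps one ordering of the three and one pair of grid
    thresholds for infinitely many times. A second pigeonhole, at each level, selects the
    residue. *)
Theorem NT_no_scrambled3 f : CII f -> NT f -> ~ exists x1 x2 x3, scrambled3 f x1 x2 x3.
Proof.
  intros Hf HN (x1 & x2 & x3 & I1 & I2 & I3 & Hinf & d & Hd & Hsup).
  assert (P12 : proximal f x1 x2).
  { split; [exact I1|]. split; [exact I2|]. intros e He N. destruct (Hinf e He N) as [n [Hn H]].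
    apply max3_lt in H. exists n. tauto. }
  assert (P13 : proximal f x1 x3).
  { split; [exact I1|]. split; [exact I3|]. intros e He N. destruct (Hinf e He N) as [n [Hn H]].
    apply max3_lt in H. exists n. tauto. }
  destruct (classic (AP f x1)) as [HA|HA].
  { apply (asym_not_limsup f x1 x2).
    - apply AP_proximal_asym; auto. apply (proximal_AP f x1 x2); auto.
    - exists d. split; [exact Hd|]. intros N. destruct (Hsup N) as [n [Hn H]]. apply min3_ge in H.
      exists n. tauto. }
  assert (Hco : cosplit3 f x1 x2 x3).
  { intros k i. destruct (NP_alt f x1 Hf HN I1 HA k i) as (z & b & Hz & Ez & A).
    exists z, b. split; [exact Hz|]. split; [exact Ez|]. split; [exact A|]. split.
    - apply (proximal_alt f x2 x1 Hf HN HA (proximal_sym _ _ _ P12) k i z b Hz Ez A).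
    - apply (proximal_alt f x3 x1 Hf HN HA (proximal_sym _ _ _ P13) k i z b Hz Ez A). }
  destruct (grid_exists d Hd) as (M & HM & HMd).
  set (L := x1 :: x2 :: x3 :: nil).
  destruct (inf_pigeonhole (fun n (w : (R * R * R) * (R * R)) =>
     match w with (a, b, c, (p, p')) => p < p' /\ iter n f a <= p /\ p <= iter n f b <= p' /\ p' <= iter n f c end)
     (list_prod (list_prod (list_prod L L) L) (list_prod (grid M) (grid M)))) as ((((a, b), c), (p, p')) & Hin & Hrec).
  { intros N. destruct (Hsup N) as [n [Hn H]]. apply min3_ge in H. destruct H as (H1 & H2 & H3).
    assert (Hall : forall a b c, In a L -> In b L -> In c L -> d <= iter n f b - iter n f a -> d <= iter n f c - iter n f b ->
       exists n w, (n >= N)%nat /\ In w (list_prod (list_prod (list_prod L L) L) (list_prod (grid M) (grid M))) /\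
       match w with (a, b, c, (p, p')) => p < p' /\ iter n f a <= p /\ p <= iter n f b <= p' /\ p' <= iter n f c end).
    { intros a b c La Lb Lc D1 D2.
      assert (HI : forall y, In y L -> inI (iter n f y))
        by (intros y [<-|[<-|[<-|[]]]]; apply iter_inI; assumption).
      destruct (separate3 M (iter n f a) (iter n f b) (iter n f c)) as (p & p' & Gp & Gp' & S1 & S2); auto; try lra.
      exists n, (a, b, c, (p, p')). split; [exact Hn|]. split; [repeat apply in_prod; assumption|]. lra. }
    unfold dist_n in *.
    destruct (sort3 d _ _ _ Hd H1 H2 H3) as [[D1 D2]|[[D1 D2]|[[D1 D2]|[[D1 D2]|[[D1 D2]|[D1 D2]]]]]].
    - apply (Hall x1 x2 x3); simpl; auto.
    - apply (Hall x1 x3 x2); simpl; auto.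
    - apply (Hall x2 x1 x3); simpl; auto.
    - apply (Hall x2 x3 x1); simpl; auto.
    - apply (Hall x3 x1 x2); simpl; auto.
    - apply (Hall x3 x2 x1); simpl; auto. }
  apply in_prod_iff in Hin. destruct Hin as [Hin _]. apply in_prod_iff in Hin. destruct Hin as [Hin Lc].
  apply in_prod_iff in Hin. destruct Hin as [La Lb].
  assert (HI : forall y, In y L -> inI y) by (intros y [<-|[<-|[<-|[]]]]; assumption).
  apply (no_middle_visits_tree f a b c p p'); auto.
  - apply (cosplit3_perm f x1 x2 x3); auto.
  - destruct (Hrec 0%nat) as (n & _ & H & _). lra.
  - intros k. destruct (inf_pigeonhole (fun n i => (n mod 2 ^ k = i)%nat /\ p < p' /\ iter n f a <= p /\
      p <= iter n f b <= p' /\ p' <= iter n f c) (seq 0 (2 ^ k))) as (i & Hi & Hrec').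
    { intros N. destruct (Hrec N) as (n & Hn & H). exists n, (n mod 2 ^ k)%nat. split; [exact Hn|].
      split; [|split; [reflexivity|exact H]]. apply in_seq. split; [lia|].
      apply Nat.mod_upper_bound. pose proof (pow2_pos k). lia. }
    apply in_seq in Hi. exists i. split; [lia|].
    split; [|split]; intros N; destruct (Hrec' N) as (n & Hn & E & H); exists n; tauto.
Qed.

(** * Transitive subsystems *)

Lemma ball_open c e : open_set (ball c e).
Proof.
  intros y Hy. unfold ball in *.
  assert (H : 0 < e - Rabs (y - c)) by lra.
  exists (mkposreal _ H). intros t Ht. unfold disc, ball in *. simpl in Ht.
  replace (t - c) with ((t - y) + (y - c)) by lra. pose proof (Rabs_triang (t - y) (y - c)). lra.
Qed.

Lemma ball_center c e : 0 < e -> ball c e c.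
Proof. intros He. unfold ball. rewrite Rminus_diag, Rabs_R0. exact He. Qed.

Lemma open_ball_inside O x : open_set O -> O x -> exists e, 0 < e /\ forall t, Rabs (t - x) < e -> O t.
Proof. intros HO Hx. destruct (HO x Hx) as [d Hd]. exists d. split; [apply cond_pos|]. intros t Ht. apply Hd, Ht. Qed.

Lemma closed_limit Y y : closed_set Y -> (forall e, 0 < e -> exists t, Y t /\ Rabs (t - y) < e) -> Y y.
Proof.
  intros HY H. apply NNPP. intros C. destruct (open_ball_inside _ y HY C) as (e & He & Hb).
  destruct (H e He) as (t & Ht & Htb). apply (Hb t Htb Ht).
Qed.

Lemma nested_point (l u : nat -> R) :
  (forall n, l n <= l (S n) /\ u (S n) <= u n /\ l n <= u n) -> exists y, forall n, l n <= y <= u n.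
Proof.
  intros H.
  assert (Hl : forall d n, l n <= l (d + n)%nat) by (induction d; intros n; simpl; [lra|specialize (IHd n); pose proof (H (d + n)%nat); lra]).
  assert (Hu : forall d n, u (d + n)%nat <= u n) by (induction d; intros n; simpl; [lra|specialize (IHd n); pose proof (H (d + n)%nat); lra]).
  assert (Hlu : forall n m, l n <= u m).
  { intros n m. pose proof (Hl m n). pose proof (Hu n m). pose proof (H (m + n)%nat).
    replace (n + m)%nat with (m + n)%nat in * by lia. lra. }
  destruct (completeness (fun t => exists n, t = l n)) as [y [Hub Hlb]].
  - exists (u 0%nat). intros t [n ->]. apply Hlu.
  - exists (l 0%nat), 0%nat. reflexivity.
  - exists y. intros n. split.
    + apply Hub. exists n. reflexivity.
    + apply Hlb. intros t [m ->]. apply Hlu.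
Qed.

Lemma list_dist_pos (l : list R) a : ~ In a l -> exists d, 0 < d /\ forall b, In b l -> d <= Rabs (b - a).
Proof.
  induction l as [|b l IH]; intros H.
  - exists 1. split; [lra|]. intros b [].
  - destruct IH as (d & Hd & Hl); [intros C; apply H; right; exact C|].
    assert (Hb : 0 < Rabs (b - a)) by (apply Rabs_pos_lt; intros C; apply H; left; lra).
    exists (Rmin d (Rabs (b - a))). split; [apply Rmin_pos; assumption|].
    intros c [<-|Hc]; [apply Rmin_r|]. eapply Rle_trans; [apply Rmin_l|]. apply Hl, Hc.
Qed.

(** Sensitivity leaves no isolated points: every open set meeting [Y] does so in more than one
    point, hence still meets it after one point is removed. *)
Lemma sensitive_infinite f Y : sensitive3_sub f Y -> forall (l : list R) O, open_set O ->
  (exists y, Y y /\ O y) -> exists y, Y y /\ O y /\ ~ In y l.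
Proof.
  intros (d & Hd & HS). induction l as [|a l IH]; intros O HO Hex.
  - destruct Hex as (y & H1 & H2). exists y. simpl. tauto.
  - set (O' := fun t => O t /\ t <> a).
    assert (HO' : open_set O').
    { intros t [Ht Hta]. destruct (open_ball_inside O t HO Ht) as (e & He & Hb).
      assert (H : 0 < Rmin e (Rabs (a - t))) by (apply Rmin_pos; [assumption|apply Rabs_pos_lt; lra]).
      exists (mkposreal _ H). intros s Hs. unfold disc in Hs. simpl in Hs.
      pose proof (Rmin_l e (Rabs (a - t))). pose proof (Rmin_r e (Rabs (a - t))).
      split; [apply Hb; lra|]. intros ->. lra. }
    destruct (HS O HO Hex) as (x1 & x2 & x3 & k & Y1 & O1 & Y2 & O2 & _ & _ & H12 & _).
    assert (Hex' : exists y, Y y /\ O' y).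
    { destruct (Req_dec x1 a) as [E|E].
      - exists x2. split; [exact Y2|]. split; [exact O2|]. congruence.
      - exists x1. split; [exact Y1|]. split; [exact O1|exact E]. }
    destruct (IH O' HO' Hex') as (y & Hy & [Oy Hya] & Hyl). exists y. split; [exact Hy|]. split; [exact Oy|].
    intros [C|C]; [congruence|contradiction].
Qed.

(** Countably many balls of radius [2/M] around [i/M], with [(i, M - 1)] coded by the Cantor
    pairing. The successor keeps the denominator positive. *)
Definition basic_open (n : nat) : R -> Prop :=
  ball (INR (fst (Cantor.of_nat n)) / INR (S (snd (Cantor.of_nat n)))) (2 / INR (S (snd (Cantor.of_nat n)))).

Lemma basic_open_small z e : inI z -> 0 < e -> exists n, basic_open n z /\ forall t, basic_open n t -> Rabs (t - z) < e.
Proof.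
  intros Hz He. destruct (grid_exists (e / 2)) as (M & HM & HMe); [lra|].
  assert (HM' : 0 < INR M) by (apply lt_0_INR; exact HM).
  destruct (letter_spec M z Hz) as [A1 A2]. set (i := letter M z) in *.
  exists (Cantor.to_nat (i, M - 1)%nat).
  unfold basic_open. rewrite Cantor.cancel_of_to. simpl fst. simpl snd.
  replace (S (M - 1)) with M by lia.
  assert (E : INR i / INR M * INR M = INR i) by (field; lra).
  assert (B : z < INR i / INR M <= z + 1 / INR M).
  { split.
    - apply (Rmult_lt_reg_r (INR M)); [lra|]. rewrite E. lra.
    - apply (Rmult_le_reg_r (INR M)); [lra|]. rewrite E.
      replace ((z + 1 / INR M) * INR M) with (z * INR M + 1) by (field; lra). lra. }
  assert (0 < 1 / INR M) by (apply Rdiv_lt_0_compat; lra).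
  replace (2 / INR M) with (1 / INR M + 1 / INR M) in * by lra.
  split.
  - unfold ball. apply Rabs_lt_iff. lra.
  - intros t Ht. apply ball_bounds in Ht. apply Rabs_lt_iff. lra.
Qed.

(** A Baire argument with balls centred in [Y]: stage [n] uses transitivity to shrink the ball until
    all its points in [Y] visit the [n]-th basic set, provided this set meets [Y]. The common point
    is in [Y] because [Y] is closed. *)
Lemma dense_orbit f Y : CII f -> subsystem f Y -> transitive_sub f Y -> sensitive3_sub f Y ->
  exists y, Y y /\ forall z e N, Y z -> 0 < e -> exists n, (n >= N)%nat /\ Rabs (iter n f y - z) < e.
Proof.
  intros Hf (HYI & [y0 Hy0] & HYc & HYf) HT HS.
  assert (Hstep : forall n (cr : R * R), (Y (fst cr) /\ 0 < snd cr) ->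
    exists cr' : R * R, (Y (fst cr') /\ 0 < snd cr') /\
      (snd cr' <= snd cr / 2 /\ Rabs (fst cr' - fst cr) + snd cr' < snd cr /\
       ((exists z, Y z /\ basic_open n z) -> exists k, forall t, Y t -> Rabs (t - fst cr') <= snd cr' ->
          basic_open n (iter k f t)))).
  { intros n [c r] [Hc Hr]. simpl in *.
    destruct (classic (exists z, Y z /\ basic_open n z)) as [Hm|Hm].
    - destruct (HT (ball c r) (basic_open n) (ball_open _ _) (ball_open _ _)) as (k & x & Hx & Bx & _ & Vx); auto.
      { exists c. split; [exact Hc|apply ball_center, Hr]. }
      destruct (open_ball_inside _ _ (ball_open _ _ : open_set (basic_open n)) Vx) as (e & He & Hb).
      destruct (unif_cont_iter f k e Hf He) as (d & Hd & U).
      unfold ball in Bx.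
      set (r' := Rmin (Rmin (d / 2) (r / 2)) ((r - Rabs (x - c)) / 2)).
      assert (Hr' : 0 < r') by (unfold r'; repeat apply Rmin_pos; lra).
      assert (r' <= d / 2 /\ r' <= r / 2 /\ r' <= (r - Rabs (x - c)) / 2).
      { unfold r'. pose proof (Rmin_l (Rmin (d / 2) (r / 2)) ((r - Rabs (x - c)) / 2)).
        pose proof (Rmin_r (Rmin (d / 2) (r / 2)) ((r - Rabs (x - c)) / 2)).
        pose proof (Rmin_l (d / 2) (r / 2)). pose proof (Rmin_r (d / 2) (r / 2)). lra. }
      exists (x, r'). simpl. split; [split; assumption|]. split; [lra|]. split; [lra|].
      intros _. exists k. intros t Ht Htx. apply Hb. apply (U t x (HYI t Ht) (HYI x Hx)); [lra|lia].
    - exists (c, r / 2). simpl. split; [split; [assumption|lra]|]. split; [lra|].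
      rewrite Rminus_diag, Rabs_R0. split; [lra|]. intros C. contradiction. }
  destruct (dep_choice (fun n (cr : R * R) => Y (fst cr) /\ 0 < snd cr) _ (y0, 1)
     (conj Hy0 Rlt_0_1) Hstep) as (u & Hu0 & Hu).
  destruct (nested_point (fun n => fst (u n) - snd (u n)) (fun n => fst (u n) + snd (u n))) as [y Hy].
  { intros n. destruct (Hu n) as ((_ & Hr) & _ & Hb & _).
    unfold Rabs in Hb. destruct (Rcase_abs _); lra. }
  assert (Hrad : forall n, snd (u n) <= (/ 2) ^ n).
  { induction n as [|n IH]; [rewrite Hu0; simpl; lra|]. destruct (Hu n) as (_ & Hb & _). simpl. lra. }
  assert (HYy : Y y).
  { apply closed_limit; [exact HYc|]. intros e He.
    destruct (pow_lt_1_zero (/ 2) ltac:(rewrite Rabs_right; lra) e He) as [k Hk].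
    specialize (Hk k (Nat.le_refl _)). apply Rabs_lt_iff in Hk.
    exists (fst (u k)). split; [apply Hu|]. specialize (Hy k). specialize (Hrad k). apply Rabs_lt_iff. lra. }
  assert (Hvis : forall z e, Y z -> 0 < e -> exists n, Rabs (iter n f y - z) < e).
  { intros z e Hz He. destruct (basic_open_small z e (HYI z Hz) He) as (n & Hn & Hb).
    destruct (Hu n) as (_ & _ & _ & Hk). destruct Hk as [k Hk]; [exists z; auto|].
    exists k. apply Hb. apply Hk; [exact HYy|]. specialize (Hy (S n)). simpl in Hy.
    apply Rabs_le. lra. }
  exists y. split; [exact HYy|]. intros z e N Hz He.
  (* To force a visit at time at least [N], the target is moved slightly, off the first [N] points
     of the orbit, and then approached more closely than any of them. *)
  destruct (sensitive_infinite f Y HS (map (fun n => iter n f y) (seq 0 N)) (ball z e) (ball_open _ _)) as (z' & Hz' & Bz' & Hl).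
  { exists z. split; [exact Hz|apply ball_center, He]. }
  destruct (list_dist_pos _ _ Hl) as (d & Hd & Hdl). unfold ball in Bz'.
  destruct (Hvis z' (Rmin d (e - Rabs (z' - z))) Hz') as [n Hn]; [apply Rmin_pos; lra|].
  pose proof (Rmin_l d (e - Rabs (z' - z))). pose proof (Rmin_r d (e - Rabs (z' - z))).
  exists n. split.
  - destruct (Compare_dec.le_lt_dec N n); [assumption|]. exfalso.
    specialize (Hdl (iter n f y)). assert (d <= Rabs (iter n f y - z')); [|lra].
    apply Hdl. apply in_map_iff. exists n. split; [reflexivity|]. apply in_seq. lia.
  - replace (iter n f y - z) with ((iter n f y - z') + (z' - z)) by lra.
    pose proof (Rabs_triang (iter n f y - z') (z' - z)). lra.
Qed.

Definition cell (f : R -> R) (y : R) (K i : nat) (u : R) : Prop :=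
  forall e, 0 < e -> forall N, exists n, (n >= N)%nat /\ (n mod 2 ^ K = i)%nat /\ Rabs (iter n f y - u) < e.

Lemma cell_exists f y K u : (forall e N, 0 < e -> exists n, (n >= N)%nat /\ Rabs (iter n f y - u) < e) ->
  exists i, (i < 2 ^ K)%nat /\ cell f y K i u.
Proof.
  intros H. pose proof (pow2_pos K) as Hp.
  destruct (inf_pigeonhole (fun N i => exists n, (n >= N)%nat /\ (n mod 2 ^ K = i)%nat /\
     Rabs (iter n f y - u) < / INR (S N)) (seq 0 (2 ^ K))) as (i & Hi & Hrec).
  { intros N. destruct (H (/ INR (S N)) N) as (n & Hn & Hd).
    - apply Rinv_0_lt_compat. apply lt_0_INR. lia.
    - exists N, (n mod 2 ^ K)%nat. split; [lia|]. split.
      + apply in_seq. split; [lia|]. apply Nat.mod_upper_bound. lia.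
      + exists n. auto. }
  apply in_seq in Hi. exists i. split; [lia|]. intros e He N.
  destruct (INR_unbounded (/ e)) as [N0 HN0].
  destruct (Hrec (N + N0)%nat) as (N1 & HN1 & n & Hn & E & Hd).
  exists n. split; [lia|]. split; [exact E|]. eapply Rlt_trans; [exact Hd|].
  rewrite <- (Rinv_inv e). apply Rinv_lt_contravar.
  - apply Rmult_lt_0_compat; [apply Rinv_0_lt_compat, He|apply lt_0_INR; lia].
  - eapply Rlt_le_trans; [exact HN0|]. apply le_INR. lia.
Qed.

Lemma cell_map f y K i u t : CII f -> inI y -> inI u -> cell f y K i u ->
  cell f y K ((i + t) mod 2 ^ K) (iter t f u).
Proof.
  intros Hf Hy Hu H e He N. destruct (unif_cont_iter f t e Hf He) as (d & Hd & U).
  destruct (H d Hd N) as (n & Hn & E & Hdn). exists (t + n)%nat. split; [lia|]. split.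
  - rewrite <- E, Nat.Div0.add_mod_idemp_l. f_equal. lia.
  - rewrite iter_add. apply (U (iter n f y) u (iter_inI f n y Hf Hy) Hu Hdn t (Nat.le_refl _)).
Qed.

Lemma cell_mono f y k l i u : (k <= l)%nat -> cell f y l i u -> cell f y k (i mod 2 ^ k) u.
Proof.
  intros Hkl H e He N. destruct (H e He N) as (n & Hn & E & Hd). exists n. split; [exact Hn|].
  split; [|exact Hd]. rewrite <- E. symmetry. apply mod_pow_mono, Hkl.
Qed.

Lemma finite_min (P : nat -> R -> Prop) n : (forall i d d', P i d -> 0 < d' <= d -> P i d') ->
  (forall i, (i < n)%nat -> exists d, 0 < d /\ P i d) -> exists d, 0 < d /\ forall i, (i < n)%nat -> P i d.
Proof.
  intros Hm. induction n as [|n IH]; intros H.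
  - exists 1. split; [lra|]. intros i Hi. lia.
  - destruct IH as (d & Hd & Hall); [intros i Hi; apply H; lia|].
    destruct (H n (Nat.lt_succ_diag_r n)) as (d' & Hd' & Hn).
    assert (0 < Rmin d d') by (apply Rmin_pos; assumption).
    exists (Rmin d d'). split; [assumption|]. intros i Hi.
    destruct (Nat.eq_dec i n) as [->|Hne].
    + apply (Hm n d'); [exact Hn|]. split; [assumption|apply Rmin_r].
    + apply (Hm i d); [apply Hall; lia|]. split; [assumption|apply Rmin_l].
Qed.

(** Times in the two sibling classes eventually lie on opposite sides of the separator of level [K],
    at distance at least [d] from it. *)
Lemma sibling_cells_far f y K i : CII f -> NT f -> inI y -> ~ AP f y -> (i < 2 ^ K)%nat ->
  exists d, 0 < d /\ forall u u', cell f y (S K) i u -> cell f y (S K) (i + 2 ^ K) u' -> d <= Rabs (u - u').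
Proof.
  intros Hf HN Hy HA Hi.
  destruct (NP_alt f y Hf HN Hy HA K i) as (z & b & Hz & Ez & Halt).
  destruct (NP_alt f y Hf HN Hy HA (S K) i) as (z1 & b1 & _ & _ & Halt1).
  destruct (alt_far (iter (2 ^ K) f) z z1 b b1 (CII_iter f _ Hf) Hz Ez) as [d [Hd Hfar]].
  specialize (Hfar (iter i f y) (iter_inI f i y Hf Hy) Halt
    (alt_ext _ _ _ _ _ (fun n => eq_sym (iter2_pow f K n _)) Halt1)).
  destruct Hfar as [N1 Hfar]. apply alt_side in Halt; [|exact Hi]. destruct Halt as [N2 Halt].
  pose proof (pow2_pos K) as Hp.
  assert (Hgen : forall m, (m >= N1 * 2 ^ K + i + N2)%nat -> (m mod 2 ^ K = i)%nat ->
     if xorb b (Nat.odd (m / 2 ^ K)) then iter m f y <= z - d else z + d <= iter m f y).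
  { intros m Hm E. specialize (Halt m ltac:(lia) E). 
    pose proof (Nat.div_mod m (2 ^ K) ltac:(lia)) as D. rewrite E in D.
    specialize (Hfar (m / 2 ^ K)%nat ltac:(nia)). rewrite iter_mul, <- iter_add in Hfar.
    replace (m / 2 ^ K * 2 ^ K + i)%nat with m in Hfar by lia.
    unfold side in Halt. unfold Rabs in Hfar. destruct (xorb b _); destruct (Rcase_abs _); lra. }
  exists d. split; [exact Hd|]. intros u u' Hu Hu'.
  destruct (Hu (d / 2) ltac:(lra) (N1 * 2 ^ K + i + N2)%nat) as (m & Hm & E & Hdm).
  destruct (Hu' (d / 2) ltac:(lra) (N1 * 2 ^ K + i + N2)%nat) as (m' & Hm' & E' & Hdm').
  assert (F : (m mod 2 ^ K = i)%nat).
  { rewrite <- (mod_pow_mono K (S K)), E by lia. apply Nat.mod_small, Hi. }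
  assert (F' : (m' mod 2 ^ K = i)%nat).
  { rewrite <- (mod_pow_mono K (S K)), E' by lia. replace (i + 2 ^ K)%nat with (i + 1 * 2 ^ K)%nat by lia.
    rewrite Nat.Div0.mod_add. apply Nat.mod_small, Hi. }
  specialize (Hgen m Hm F) as G. specialize (Hgen m' Hm' F') as G'.
  rewrite mod_pow_S, F in E. rewrite mod_pow_S, F' in E'.
  apply Rabs_lt_iff in Hdm, Hdm'.
  destruct (Nat.odd (m / 2 ^ K)); [lia|]. destruct (Nat.odd (m' / 2 ^ K)); [|lia].
  unfold Rabs. destruct b; simpl in *; destruct (Rcase_abs _); lra.
Qed.

(** Two different residues part at some level, where they are siblings; the bound is the least of
    the finitely many sibling distances. *)
Lemma cells_far f y K : CII f -> NT f -> inI y -> ~ AP f y ->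
  exists d, 0 < d /\ forall i i' u u', (i < 2 ^ K)%nat -> (i' < 2 ^ K)%nat ->
    cell f y K i u -> cell f y K i' u' -> Rabs (u - u') < d -> i = i'.
Proof.
  intros Hf HN Hy HA. induction K as [|K (d & Hd & IH)].
  - exists 1. split; [lra|]. intros i i' u u' Hi Hi' _ _ _. simpl in *. lia.
  - destruct (finite_min (fun i d => forall u u', cell f y (S K) i u -> cell f y (S K) (i + 2 ^ K) u' ->
       d <= Rabs (u - u')) (2 ^ K)) as (d' & Hd' & Hsib).
    + intros i e e' H He u u' Hu Hu'. specialize (H u u' Hu Hu'). lra.
    + intros i Hi. apply sibling_cells_far; auto.
    + exists (Rmin d d'). split; [apply Rmin_pos; assumption|].
      intros i i' u u' Hi Hi' Hu Hu' Huu. pose proof (Rmin_l d d'). pose proof (Rmin_r d d').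
      pose proof (pow2_pos K) as Hp.
      assert (Em : (i mod 2 ^ K = i' mod 2 ^ K)%nat).
      { apply (IH _ _ u u'); try (apply Nat.mod_upper_bound; lia); [| |lra].
        - apply (cell_mono f y K (S K)); [lia|exact Hu].
        - apply (cell_mono f y K (S K)); [lia|exact Hu']. }
      set (j := (i mod 2 ^ K)%nat) in *.
      assert (Hj : (j < 2 ^ K)%nat) by (apply Nat.mod_upper_bound; lia).
      assert (Hc : forall k, (k < 2 ^ S K)%nat -> (k mod 2 ^ K = j)%nat -> k = j \/ k = (j + 2 ^ K)%nat).
      { intros k Hk E. pose proof (mod_pow_S K k) as F. rewrite Nat.mod_small, E in F by exact Hk.
        destruct (Nat.odd (k / 2 ^ K)); lia. }
      destruct (Hc i Hi eq_refl) as [Ei|Ei]; destruct (Hc i' Hi' (eq_sym Em)) as [Ei'|Ei']; try congruence; exfalso.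
      * rewrite Ei in Hu. rewrite Ei' in Hu'. specialize (Hsib j Hj u u' Hu Hu'). lra.
      * rewrite Ei in Hu. rewrite Ei' in Hu'. specialize (Hsib j Hj u' u Hu' Hu).
        rewrite Rabs_minus_sym in Hsib. lra.
Qed.

(** An asymptotically periodic orbit accumulates only on a finite cycle, too little for a dense
    orbit in a set without isolated points. *)
Lemma AP_limit_points f y k q u i : CII f -> inI y -> Un_cv (fun n => iter n (iter (2 ^ k) f) y) q ->
  cell f y k i u -> u = iter i f q.
Proof.
  intros Hf Hy Hq Hu. apply cond_eq. intros e He.
  assert (Hqi : inI q).
  { apply (cv_inI _ q (fun n => iter_inI (iter (2 ^ k) f) n y (CII_iter f _ Hf) Hy) Hq). }
  destruct (unif_cont_iter f i (e / 2) Hf) as (d & Hd & U); [lra|].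
  destruct (Hq d Hd) as [N HN']. pose proof (pow2_pos k) as Hp.
  destruct (Hu (e / 2) ltac:(lra) (N * 2 ^ k + i)%nat) as (n & Hn & E & Hdn).
  pose proof (Nat.div_mod n (2 ^ k) ltac:(lia)) as D. rewrite E in D.
  specialize (HN' (n / 2 ^ k)%nat ltac:(nia)). unfold Rdist in HN'. rewrite iter_mul in HN'.
  specialize (U _ q (iter_inI f _ y Hf Hy) Hqi HN' i (Nat.le_refl _)). rewrite <- iter_add in U.
  replace (i + n / 2 ^ k * 2 ^ k)%nat with n in U by lia.
  apply Rabs_lt_iff in Hdn, U. apply Rabs_lt_iff. lra.
Qed.

(** Points of [Y] near the transitive point [y] belong to the same cell, and [f] maps cells to
    cells. Sensitivity therefore finds, at each level, three separated limit points of [y] along one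
    residue class. All three orbits in [no_middle_visits_tree] are then the orbit of [y]. *)
Theorem NT_no_sensitive3 f : CII f -> NT f ->
  ~ exists Y, subsystem f Y /\ transitive_sub f Y /\ sensitive3_sub f Y.
Proof.
  intros Hf HN (Y & HY & HT & HS).
  destruct (dense_orbit f Y Hf HY HT HS) as (y & Hy & Hdense).
  destruct HY as (HYI & [y0 Hy0] & HYc & HYf).
  assert (Iy : inI y) by (apply HYI, Hy).
  assert (HYit : forall n t, Y t -> Y (iter n f t)) by (induction n; simpl; auto).
  assert (Hcell : forall K u, Y u -> exists i, (i < 2 ^ K)%nat /\ cell f y K i u)
    by (intros K u Hu; apply cell_exists; intros e N He; apply Hdense; assumption).
  assert (HA : ~ AP f y).
  { intros [k [q Hq]].
    destruct (sensitive_infinite f Y HS (map (fun i => iter i f q) (seq 0 (2 ^ k))) (ball y0 1) (ball_open _ _))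
      as (u & Hu & _ & Hl).
    - exists y0. split; [exact Hy0|apply ball_center; lra].
    - destruct (Hcell k u Hu) as (i & Hi & Hci). apply Hl. apply in_map_iff. exists i. split.
      + symmetry. apply (AP_limit_points f y k q u i); assumption.
      + apply in_seq. lia. }
  assert (Hco : cosplit3 f y y y).
  { intros k i. destruct (NP_alt f y Hf HN Iy HA k i) as (z & b & Hz & Ez & A). exists z, b. auto. }
  destruct HS as (d & Hd & HS).
  destruct (grid_exists d Hd) as (M & HM & HMd).
  set (G := fun K i (pp : R * R) => recurs (fun n => iter n f y <= fst pp) K i /\
     recurs (fun n => fst pp <= iter n f y <= snd pp) K i /\ recurs (fun n => snd pp <= iter n f y) K i).
  assert (HK : forall K, exists i pp, (i < 2 ^ K)%nat /\ In pp (list_prod (grid M) (grid M)) /\ fst pp <= snd pp /\ G K i pp).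
  { intros K. destruct (cells_far f y K Hf HN Iy HA) as (e & He & Hfar).
    destruct (Hcell K y Hy) as (i0 & Hi0 & Hc0).
    destruct (HS (ball y e) (ball_open _ _)) as (x1 & x2 & x3 & t & Y1 & O1 & Y2 & O2 & Y3 & O3 & _ & _ & _ & _ & Hmin).
    { exists y. split; [exact Hy|apply ball_center, He]. }
    set (i := ((i0 + t) mod 2 ^ K)%nat).
    assert (Hin : forall x, Y x -> ball y e x -> cell f y K i (iter t f x)).
    { intros x Hx Bx. destruct (Hcell K x Hx) as (ix & Hix & Hcx). unfold ball in Bx.
      assert (ix = i0) by (apply (Hfar ix i0 x y); auto). subst ix.
      apply cell_map; auto. }
    apply min3_ge in Hmin. destruct Hmin as (D1 & D2 & D3). unfold dist_n in *.
    assert (Hi : (i < 2 ^ K)%nat) by (apply Nat.mod_upper_bound; pose proof (pow2_pos K); lia).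
    assert (Hall : forall a b c, Y a -> Y b -> Y c -> cell f y K i a -> cell f y K i b -> cell f y K i c ->
       d <= b - a -> d <= c - b ->
       exists i pp, (i < 2 ^ K)%nat /\ In pp (list_prod (grid M) (grid M)) /\ fst pp <= snd pp /\ G K i pp).
    { intros a b c Ya Yb Yc Ca Cb Cc E1 E2.
      destruct (separate3 M a b c) as (p & p' & Gp & Gp' & S1 & S2); auto; try lra.
      exists i, (p, p'). split; [exact Hi|]. split; [apply in_prod; assumption|]. split; [simpl; lra|].
      unfold G, recurs. simpl. split; [|split]; intros N.
      - destruct (Ca (p - a) ltac:(lra) N) as (n & Hn & E & Hdn). exists n. apply Rabs_lt_iff in Hdn.
        split; [exact Hn|]. split; [exact E|lra].
      - destruct (Cb (Rmin (b - p) (p' - b))) with (N := N) as (n & Hn & E & Hdn); [apply Rmin_pos; lra|].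
        exists n. apply Rabs_lt_iff in Hdn.
        pose proof (Rmin_l (b - p) (p' - b)). pose proof (Rmin_r (b - p) (p' - b)).
        split; [exact Hn|]. split; [exact E|lra].
      - destruct (Cc (c - p') ltac:(lra) N) as (n & Hn & E & Hdn). exists n. apply Rabs_lt_iff in Hdn.
        split; [exact Hn|]. split; [exact E|lra]. }
    pose proof (HYit t x1 Y1). pose proof (HYit t x2 Y2). pose proof (HYit t x3 Y3).
    pose proof (Hin x1 Y1 O1). pose proof (Hin x2 Y2 O2). pose proof (Hin x3 Y3 O3).
    destruct (sort3 d _ _ _ Hd D1 D2 D3) as [[E1 E2]|[[E1 E2]|[[E1 E2]|[[E1 E2]|[[E1 E2]|[E1 E2]]]]]].
    - apply (Hall (iter t f x1) (iter t f x2) (iter t f x3)); assumption.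
    - apply (Hall (iter t f x1) (iter t f x3) (iter t f x2)); assumption.
    - apply (Hall (iter t f x2) (iter t f x1) (iter t f x3)); assumption.
    - apply (Hall (iter t f x2) (iter t f x3) (iter t f x1)); assumption.
    - apply (Hall (iter t f x3) (iter t f x1) (iter t f x2)); assumption.
    - apply (Hall (iter t f x3) (iter t f x2) (iter t f x1)); assumption. }
  destruct (inf_pigeonhole (fun K pp => exists i, (i < 2 ^ K)%nat /\ fst pp <= snd pp /\ G K i pp)
     (list_prod (grid M) (grid M))) as (pp & _ & Hrec).
  { intros N. destruct (HK N) as (i & pp & Hi & Hpp & Hle & HG). exists N, pp. split; [lia|]. split; [exact Hpp|].
    exists i. auto. }
  apply (no_middle_visits_tree f y y y (fst pp) (snd pp)); auto.
  - destruct (Hrec 0%nat) as (_ & _ & _ & _ & H & _). exact H.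
  - intros k. destruct (Hrec k) as (K & HKk & i & Hi & _ & G1 & G2 & G3).
    exists (i mod 2 ^ k)%nat. split; [apply Nat.mod_upper_bound; pose proof (pow2_pos k); lia|].
    assert (Hm : forall Sx, recurs Sx K i -> recurs Sx k (i mod 2 ^ k)%nat).
    { intros Sx H N. destruct (H N) as (n & Hn & E & Hs). exists n. split; [exact Hn|]. split; [|exact Hs].
      rewrite <- E. symmetry. apply mod_pow_mono, HKk. }
    auto.
Qed.

(** * Horseshoes *)

Definition covers (g : R -> R) (u v p q : R) : Prop :=
  forall t, p <= t <= q -> exists s, u <= s <= v /\ g s = t.

Definition maps_onto (g : R -> R) (u v p q : R) : Prop :=
  (forall s, u <= s <= v -> p <= g s <= q) /\ covers g u v p q.

Lemma covers_sub g u v u' v' p q p' q' : covers g u v p q -> u' <= u -> v <= v' -> p <= p' -> q' <= q ->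
  covers g u' v' p' q'.
Proof.
  intros H H1 H2 H3 H4 t Ht. destruct (H t) as [s [Hs E]]; [lra|]. exists s. split; [lra|exact E].
Qed.

Lemma covers_of_points g u v p q s t : CII g -> inI u -> inI v -> u <= s <= v -> u <= t <= v ->
  g s <= p -> q <= g t -> covers g u v p q.
Proof.
  intros Hg Hu Hv Hs Ht Hsp Htq w Hw.
  destruct (Rle_lt_dec s t).
  - destruct (ivt g s t w) as [x [Hx E]]; auto; try (unfold inI in *; lra). exists x. split; [lra|exact E].
  - destruct (ivt g t s w) as [x [Hx E]]; auto; try (unfold inI in *; lra). exists x. split; [lra|exact E].
Qed.

Lemma covers_comp f m n u v p q w z : covers (iter m f) u v p q -> covers (iter n f) p q w z ->
  covers (iter (n + m) f) u v w z.
Proof.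
  intros H1 H2 t Ht. destruct (H2 t Ht) as [s [Hs E]]. destruct (H1 s Hs) as [r [Hr E']].
  exists r. split; [exact Hr|]. rewrite iter_add, E', E. reflexivity.
Qed.

Lemma last_hit g s t p : CII g -> inI s -> inI t -> s <= t -> g s = p ->
  exists x, s <= x <= t /\ g x = p /\ forall y, x < y <= t -> g y <> p.
Proof.
  intros Hg Hs Ht Hst Hp.
  destruct (lub_pt (fun x => s <= x <= t /\ g x = p)) as [x [Hx [Hub Happ]]].
  - exists s. lra.
  - intros y [Hy _]. unfold inI in *; lra.
  - assert (H1 : s <= x) by (apply Hub; lra).
    assert (H2 : x <= t).
    { destruct (Rle_lt_dec x t); [assumption|]. destruct (Happ (x - t)) as [y [[Hy _] Hy']]; lra. }
    exists x. split; [lra|]. split.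
    + apply cond_eq. intros e He. destruct (proj2 Hg x Hx e He) as [d [Hd H]].
      destruct (Happ d Hd) as [y [[Hy Ey] Hy']].
      assert (y <= x) by (apply Hub; auto).
      rewrite Rabs_minus_sym, <- Ey. apply H; [unfold inI in *; lra|]. apply Rabs_lt_iff. lra.
    + intros y Hy E. assert (y <= x) by (apply Hub; split; [lra|exact E]). lra.
Qed.

Lemma CII_flip g : CII g -> CII (fun x => g (1 - x)).
Proof.
  intros [H1 H2]. split.
  - intros x Hx. apply H1. unfold inI in *; lra.
  - intros x Hx e He. destruct (H2 (1 - x) ltac:(unfold inI in *; lra) e He) as [d [Hd H]].
    exists d. split; [exact Hd|]. intros y Hy Hyx. apply H; [unfold inI in *; lra|].
    replace (1 - y - (1 - x)) with (- (y - x)) by lra. rewrite Rabs_Ropp. exact Hyx.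
Qed.

Lemma first_hit g s t p : CII g -> inI s -> inI t -> s <= t -> g t = p ->
  exists x, s <= x <= t /\ g x = p /\ forall y, s <= y < x -> g y <> p.
Proof.
  intros Hg Hs Ht Hst Hp.
  destruct (last_hit (fun x => g (1 - x)) (1 - t) (1 - s) p) as (x & Hx & E & H).
  - apply CII_flip, Hg.
  - unfold inI in *; lra.
  - unfold inI in *; lra.
  - lra.
  - replace (1 - (1 - t)) with t by lra. exact Hp.
  - exists (1 - x). split; [lra|]. split; [exact E|]. intros y Hy.
    specialize (H (1 - y)). replace (1 - (1 - y)) with y in H by lra. apply H. lra.
Qed.

(** Between the last point with value [p] and the first later point with value [q], the map cannot
    leave [[p, q]] without taking one of these values again. *)
Lemma onto_sub_up g s t p q : CII g -> inI s -> inI t -> s <= t -> p <= q -> g s = p -> g t = q ->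
  exists u v, s <= u /\ u <= v /\ v <= t /\ maps_onto g u v p q.
Proof.
  intros Hg Hs Ht Hst Hpq Ep Eq.
  destruct (Req_dec p q) as [<-|Hne].
  { exists s, s. repeat split; try lra.
    - assert (s0 = s) as -> by lra. lra.
    - assert (s0 = s) as -> by lra. lra.
    - intros w Hw. exists s. lra. }
  destruct (last_hit g s t p) as (u & Hu & Eu & Lu); auto.
  destruct (first_hit g u t q) as (v & Hv & Ev & Lv); auto; try (unfold inI in *; lra).
  exists u, v. split; [lra|]. split; [lra|]. split; [lra|].
  assert (Iu : inI u) by (unfold inI in *; lra). assert (Iv : inI v) by (unfold inI in *; lra).
  split.
  - intros x Hx. split.
    + destruct (Rle_lt_dec p (g x)) as [|Hlt]; [assumption|]. exfalso.
      destruct (ivt g x v p) as [y [Hy Ey]]; auto; try (unfold inI in *; lra).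
      assert (x <> u) by (intros ->; lra). apply (Lu y); [lra|exact Ey].
    + destruct (Rle_lt_dec (g x) q) as [|Hlt]; [assumption|]. exfalso.
      destruct (ivt g u x q) as [y [Hy Ey]]; auto; try (unfold inI in *; lra).
      assert (x <> v) by (intros ->; lra). apply (Lv y); [lra|exact Ey].
  - intros w Hw. destruct (ivt g u v w) as [y [Hy Ey]]; auto; try lra. exists y. auto.
Qed.

Lemma onto_sub g u v p q : CII g -> inI u -> inI v -> p <= q -> covers g u v p q ->
  exists u' v', u <= u' /\ u' <= v' /\ v' <= v /\ maps_onto g u' v' p q.
Proof.
  intros Hg Hu Hv Hpq H.
  destruct (H p) as [s [Hs Es]]; [lra|]. destruct (H q) as [t [Ht Et]]; [lra|].
  destruct (Rle_lt_dec s t).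
  - destruct (onto_sub_up g s t p q) as (u' & v' & H1 & H2 & H3 & H4); auto; try (unfold inI in *; lra).
    exists u', v'. split; [lra|]. split; [lra|]. split; [lra|exact H4].
  - assert (HC : CII (fun x => 1 - g x)).
    { split; [intros x Hx; apply (proj1 Hg) in Hx; unfold inI in *; lra|].
      intros x Hx e He. destruct (proj2 Hg x Hx e He) as [d [Hd HH]]. exists d. split; [exact Hd|].
      intros y Hy Hyx. replace (1 - g y - (1 - g x)) with (- (g y - g x)) by lra. rewrite Rabs_Ropp. auto. }
    destruct (onto_sub_up (fun x => 1 - g x) t s (1 - q) (1 - p)) as (u' & v' & H1 & H2 & H3 & H4 & H5); auto; cbv beta; try (unfold inI in *; lra).
    exists u', v'. split; [lra|]. split; [lra|]. split; [lra|]. split.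
    + intros x Hx. specialize (H4 x Hx). lra.
    + intros w Hw. destruct (H5 (1 - w)) as [y [Hy Ey]]; [lra|]. exists y. split; [exact Hy|]. lra.
Qed.

Lemma image_interval g u v : CII g -> inI u -> inI v -> u <= v ->
  exists p q, p <= q /\ inI p /\ inI q /\ maps_onto g u v p q.
Proof.
  intros Hg Hu Hv Huv.
  assert (Hc : forall c, u <= c <= v -> continuity_pt (fun t => g (clamp t)) c)
    by (intros c _; apply clamp_cont, Hg).
  destruct (continuity_ab_maj _ u v Huv Hc) as [M [HM IM]].
  destruct (continuity_ab_min _ u v Huv Hc) as [m [Hm Im]].
  assert (Hcl : forall c, u <= c <= v -> clamp c = c) by (intros c Hc'; apply clamp_id; unfold inI in *; lra).
  assert (Hb : forall c, u <= c <= v -> g m <= g c <= g M).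
  { intros c Hc'. specialize (HM c Hc'). specialize (Hm c Hc'). simpl in *. rewrite !Hcl in * by assumption. lra. }
  exists (g m), (g M). split; [apply (Hb m Im)|].
  split; [apply Hg; unfold inI in *; lra|]. split; [apply Hg; unfold inI in *; lra|].
  split; [exact Hb|]. apply (covers_of_points g u v _ _ m M); auto; lra.
Qed.

(* Of two disjoint subintervals one has at most half of the length. *)
Lemma half_sub g l r p0 q0 p1 q1 : CII g -> inI l -> inI r -> p0 <= q0 -> q0 < p1 -> p1 <= q1 ->
  covers g l r p0 q0 -> covers g l r p1 q1 ->
  exists l' r', l <= l' /\ l' <= r' /\ r' <= r /\ r' - l' <= (r - l) / 2 /\
    (maps_onto g l' r' p0 q0 \/ maps_onto g l' r' p1 q1).
Proof.
  intros Hg Hl Hr H0 H01 H1 C0 C1.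
  destruct (onto_sub g l r p0 q0) as (l0 & r0 & A1 & A2 & A3 & A4); auto.
  destruct (onto_sub g l r p1 q1) as (l1 & r1 & B1 & B2 & B3 & B4); auto.
  assert (Hdis : r0 < l1 \/ r1 < l0).
  { destruct (Rlt_le_dec r0 l1); [auto|]. destruct (Rlt_le_dec r1 l0); [auto|]. exfalso.
    pose proof (proj1 A4 (Rmax l0 l1)) as X. pose proof (proj1 B4 (Rmax l0 l1)) as Y.
    assert (Z : l0 <= Rmax l0 l1 <= r0 /\ l1 <= Rmax l0 l1 <= r1)
      by (unfold Rmax; destruct (Rle_dec l0 l1); lra).
    destruct Z as [Z1 Z2]. specialize (X Z1). specialize (Y Z2). lra. }
  destruct (Rle_lt_dec (r0 - l0) ((r - l) / 2)).
  - exists l0, r0. repeat split; try lra. left. exact A4.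
  - exists l1, r1. repeat split; try lra. right. exact B4.
Qed.

(** Common scheme of repeated halving for different notions of a good interval. The strict growth of
    the times lets them exceed any [N], and halving makes the intervals shrink to the point. *)
Lemma shrinking_point (Good : nat -> R -> R -> Prop) t0 l0 r0 :
  Good t0 l0 r0 -> l0 <= r0 -> r0 - l0 <= 1 ->
  (forall t l r, Good t l r -> l <= r -> exists t' l' r', (t < t')%nat /\ l <= l' /\ l' <= r' /\ r' <= r /\
     r' - l' <= (r - l) / 2 /\ Good t' l' r') ->
  exists e, l0 <= e <= r0 /\ forall N eps, 0 < eps -> exists t l r, (t >= N)%nat /\ Good t l r /\ l0 <= l /\ r <= r0 /\
     l <= e <= r /\ e - eps < l /\ r < e + eps.
Proof.
  intros H0 Hlr Hlen Hstep.
  destruct (dep_choice (fun k (w : nat * (R * R)) => Good (fst w) (fst (snd w)) (snd (snd w)) /\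
      fst (snd w) <= snd (snd w) /\ (k <= fst w)%nat /\ snd (snd w) - fst (snd w) <= (/ 2) ^ k)
    (fun k w w' => fst (snd w) <= fst (snd w') /\ snd (snd w') <= snd (snd w)) (t0, (l0, r0))) as (u & Hu0 & Hu).
  - simpl. repeat split; auto; lia.
  - intros k [t [l r]] (G & Hl & Hk & Hb). simpl in *.
    destruct (Hstep t l r G Hl) as (t' & l' & r' & Ht & H1 & H2 & H3 & H4 & G').
    exists (t', (l', r')). simpl. split; [|split; lra].
    split; [exact G'|]. split; [exact H2|]. split; [lia|]. lra.
  - destruct (nested_point (fun k => fst (snd (u k))) (fun k => snd (snd (u k)))) as [e He].
    { intros k. destruct (Hu k) as ((_ & A & _) & B). lra. }
    assert (Hin : forall k, l0 <= fst (snd (u k)) /\ snd (snd (u k)) <= r0).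
    { induction k as [|k IH]; [rewrite Hu0; simpl; lra|]. destruct (Hu k) as (_ & B). lra. }
    exists e. split; [pose proof (He 0%nat) as X; rewrite Hu0 in X; exact X|].
    intros N eps Heps.
    destruct (pow_lt_1_zero (/ 2) ltac:(rewrite Rabs_right; lra) eps Heps) as [k Hk].
    specialize (Hk (k + N)%nat ltac:(lia)). apply Rabs_lt_iff in Hk.
    destruct (Hu (k + N)%nat) as ((G & A & B & C) & _). specialize (He (k + N)%nat). simpl in He.
    destruct (Hin (k + N)%nat).
    exists (fst (u (k + N)%nat)), (fst (snd (u (k + N)%nat))), (snd (snd (u (k + N)%nat))).
    repeat split; auto; try lra. lia.
Qed.

Fixpoint cumul (m : nat -> nat) (i : nat) : nat :=
  match i with O => O | S j => (m j + cumul m j)%nat end.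

(** Nested pull-backs: stage [i] keeps an interval that is mapped onto [B i] at the arrival time
    [cumul m i]. Only positions at arrival times are prescribed. *)
Lemma itinerary_point f (B : nat -> R * R) (m : nat -> nat) : CII f ->
  (forall i, inI (fst (B i)) /\ inI (snd (B i)) /\ fst (B i) <= snd (B i)) ->
  (forall i, covers (iter (m i) f) (fst (B i)) (snd (B i)) (fst (B (S i))) (snd (B (S i)))) ->
  exists x, inI x /\ forall i, fst (B i) <= iter (cumul m i) f x <= snd (B i).
Proof.
  intros Hf HB HC.
  destruct (dep_choice (fun i (w : R * R) => inI (fst w) /\ inI (snd w) /\ fst w <= snd w /\
      maps_onto (iter (cumul m i) f) (fst w) (snd w) (fst (B i)) (snd (B i)))
    (fun i w w' => fst w <= fst w' /\ snd w' <= snd w) (B 0%nat)) as (u & Hu0 & Hu).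
  - destruct (HB 0%nat) as (H1 & H2 & H3). split; [exact H1|]. split; [exact H2|]. split; [exact H3|].
    split; [intros s Hs; exact Hs|]. intros t Ht. exists t. split; [exact Ht|reflexivity].
  - intros i [l r] (Hl & Hr & Hlr & Hon). simpl in *.
    destruct (HB i) as (B1 & B2 & B3). destruct (HB (S i)) as (B1' & B2' & B3').
    destruct (onto_sub (iter (m i) f) _ _ _ _ (CII_iter f _ Hf) B1 B2 B3' (HC i)) as (p & q & P1 & P2 & P3 & P4).
    destruct (onto_sub (iter (cumul m i) f) l r p q (CII_iter f _ Hf) Hl Hr P2) as (l' & r' & L1 & L2 & L3 & L4).
    { eapply covers_sub; [apply Hon| | | |]; lra. }
    exists (l', r'). simpl. split; [|lra].
    split; [unfold inI in *; lra|]. split; [unfold inI in *; lra|]. split; [exact L2|].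
    destruct L4 as [L4 L5]. destruct P4 as [P4 P5]. split.
    + intros s Hs. rewrite iter_add. apply P4, L4, Hs.
    + apply (covers_comp f _ _ _ _ _ _ _ _ L5 P5).
  - destruct (nested_point (fun i => fst (u i)) (fun i => snd (u i))) as [x Hx].
    { intros i. destruct (Hu i) as ((_ & _ & A & _) & Hb). lra. }
    exists x. split.
    + destruct (Hu 0%nat) as ((A1 & A2 & _) & _). specialize (Hx 0%nat). simpl in Hx. unfold inI in *. lra.
    + intros i. destruct (Hu i) as ((_ & _ & _ & A) & _). apply A, Hx.
Qed.

(** The two halves may share [b]. Passing to [g^2] gives two candidates for each required point of
    the left half, and they cannot both be forced to be [b]; so the left interval can end before
    [b]. *)
Lemma turb_strict g : CII g -> turb g -> exists a c u0 v0 u1 v1, inI a /\ inI c /\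
  a <= u0 /\ u0 <= v0 /\ v0 < u1 /\ u1 <= v1 /\ v1 <= c /\
  covers (iter 2 g) u0 v0 a c /\ covers (iter 2 g) u1 v1 a c.
Proof.
  intros Hg (a & b & c & Ha & Hc & Hab & (s1 & H1 & E1) & (s2 & H2 & E2) & (s3 & H3 & E3) & (s4 & H4 & E4)).
  assert (Hb : inI b) by (unfold inI in *; lra).
  assert (C1 : covers g a b a c) by (apply (covers_of_points g a b a c s1 s2); auto).
  assert (C2 : covers g b c a c) by (apply (covers_of_points g b c a c s3 s4); auto).
  (* Points other than [b] are used so that the two final intervals are disjoint. *)
  assert (Hx : exists x, a <= x <= b /\ x <> b /\ g (g x) <= a).
  { destruct (Req_dec s1 (g b)) as [E|E].
    - destruct (C1 s3) as [x [Hx Ex]]; [lra|]. exists x. split; [exact Hx|]. split; [|rewrite Ex; exact E3].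
      intros ->. assert (E' : s1 = b) by lra. rewrite E' in *. lra.
    - destruct (C1 s1) as [x [Hx Ex]]; [lra|]. exists x. split; [exact Hx|]. split; [|rewrite Ex; exact E1].
      intros ->. lra. }
  assert (Hy : exists y, a <= y <= b /\ y <> b /\ c <= g (g y)).
  { destruct (Req_dec s2 (g b)) as [E|E].
    - destruct (C1 s4) as [x [Hx' Ex]]; [lra|]. exists x. split; [exact Hx'|]. split; [|rewrite Ex; exact E4].
      intros ->. assert (E' : s2 = b) by lra. rewrite E' in *. lra.
    - destruct (C1 s2) as [x [Hx' Ex]]; [lra|]. exists x. split; [exact Hx'|]. split; [|rewrite Ex; exact E2].
      intros ->. lra. }
  destruct Hx as (x & Hx & Hxb & Gx). destruct Hy as (y & Hy & Hyb & Gy).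
  destruct (C2 s1) as [w1 [W1 F1]]; [lra|]. destruct (C2 s2) as [w2 [W2 F2]]; [lra|].
  assert (Hg2 : CII (iter 2 g)) by (apply CII_iter, Hg).
  exists a, c, (Rmin x y), (Rmax x y), b, c.
  assert (Hmm : a <= Rmin x y /\ Rmin x y <= Rmax x y /\ Rmax x y < b /\ Rmin x y <= x <= Rmax x y /\ Rmin x y <= y <= Rmax x y)
    by (unfold Rmin, Rmax; destruct (Rle_dec x y); lra).
  split; [exact Ha|]. split; [exact Hc|]. split; [lra|]. split; [lra|]. split; [lra|]. split; [lra|]. split; [lra|].
  split.
  - apply (covers_of_points (iter 2 g) _ _ a c x y); auto; try (unfold inI in *; lra); simpl; lra.
  - apply (covers_of_points (iter 2 g) _ _ a c w1 w2); auto; simpl; try rewrite F1; try rewrite F2; lra.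
Qed.

(** With four pieces, two disjoint pairs can carry two orbits that never approach each other, or
    three pieces can hold a triple apart while the fourth hosts its meetings. *)
Definition horseshoe4 (f : R -> R) (n : nat) (a c : R) (u v : nat -> R) : Prop :=
  (1 <= n)%nat /\ inI a /\ inI c /\
  (forall i, (i < 4)%nat -> a <= u i /\ u i <= v i /\ v i <= c /\ covers (iter n f) (u i) (v i) a c) /\
  v 0%nat < u 1%nat /\ v 1%nat < u 2%nat /\ v 2%nat < u 3%nat.

Lemma two_disjoint_sub g a c l r u0 v0 u1 v1 : CII g -> inI l -> inI r ->
  a <= u0 -> u0 <= v0 -> v0 < u1 -> u1 <= v1 -> v1 <= c ->
  covers g l r a c -> covers g u0 v0 a c -> covers g u1 v1 a c ->
  exists p0 q0 p1 q1, l <= p0 /\ p0 <= q0 /\ q0 < p1 /\ p1 <= q1 /\ q1 <= r /\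
    covers (iter 2 g) p0 q0 a c /\ covers (iter 2 g) p1 q1 a c.
Proof.
  intros Hg Hl Hr H1 H2 H3 H4 H5 C C0 C1.
  destruct (onto_sub g l r u0 v0) as (l0 & r0 & A1 & A2 & A3 & A4 & A5); auto; [eapply covers_sub; [exact C| | | |]; lra|].
  destruct (onto_sub g l r u1 v1) as (l1 & r1 & B1 & B2 & B3 & B4 & B5); auto; [eapply covers_sub; [exact C| | | |]; lra|].
  pose proof (covers_comp g 1 1 _ _ _ _ _ _ A5 C0) as D0.
  pose proof (covers_comp g 1 1 _ _ _ _ _ _ B5 C1) as D1.
  assert (Hdis : r0 < l1 \/ r1 < l0).
  { destruct (Rlt_le_dec r0 l1); [auto|]. destruct (Rlt_le_dec r1 l0); [auto|]. exfalso.
    assert (Z : l0 <= Rmax l0 l1 <= r0 /\ l1 <= Rmax l0 l1 <= r1)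
      by (unfold Rmax; destruct (Rle_dec l0 l1); lra).
    destruct Z as [Z1 Z2]. specialize (A4 _ Z1). specialize (B4 _ Z2). lra. }
  destruct Hdis.
  - exists l0, r0, l1, r1. repeat split; auto; lra.
  - exists l1, r1, l0, r0. repeat split; auto; lra.
Qed.

(** The exponent doubles twice: once to make two pieces disjoint, once to place two disjoint pieces
    inside each of them. *)
Lemma turb_horseshoe4 f : CII f -> ~ NT f -> exists n a c u v, horseshoe4 f n a c u v.
Proof.
  intros Hf HN. apply not_all_ex_not in HN. destruct HN as [n HN].
  apply imply_to_and in HN. destruct HN as [Hn HN]. apply NNPP in HN.
  destruct (turb_strict (iter n f) (CII_iter f n Hf) HN) as (a & c & u0 & v0 & u1 & v1 & Ha & Hc & H1 & H2 & H3 & H4 & H5 & C0 & C1).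
  set (g := iter 2 (iter n f)) in *. assert (Hg : CII g) by (apply CII_iter, CII_iter, Hf).
  assert (I0 : inI u0 /\ inI v0 /\ inI u1 /\ inI v1) by (unfold inI in *; lra).
  destruct I0 as (I1 & I2 & I3 & I4).
  destruct (two_disjoint_sub g a c u0 v0 u0 v0 u1 v1) as (p0 & q0 & p1 & q1 & P1 & P2 & P3 & P4 & P5 & D0 & D1); auto.
  destruct (two_disjoint_sub g a c u1 v1 u0 v0 u1 v1) as (p2 & q2 & p3 & q3 & Q1 & Q2 & Q3 & Q4 & Q5 & D2 & D3); auto.
  assert (Eg : forall x, iter (2 * (2 * n)) f x = iter 2 g x).
  { intros x. unfold g. rewrite !iter_mul. f_equal. lia. }
  assert (Hcov : forall p q, covers (iter 2 g) p q a c -> covers (iter (2 * (2 * n)) f) p q a c).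
  { intros p q H t Ht. destruct (H t Ht) as [s [Hs E]]. exists s. rewrite Eg. auto. }
  exists (2 * (2 * n))%nat, a, c, (fun i => match i with 0 => p0 | 1 => p1 | 2 => p2 | _ => p3 end)%nat,
    (fun i => match i with 0 => q0 | 1 => q1 | 2 => q2 | _ => q3 end)%nat.
  split; [lia|]. split; [exact Ha|]. split; [exact Hc|]. split; [|lra].
  intros i Hi. destruct i as [|[|[|[|i]]]]; try lia; (split; [lra|]; split; [lra|]; split; [lra|]; auto).
Qed.

(** * Entropy, IN-tuples and 3-scrambled tuples from a horseshoe *)

Section Horseshoe.
Variables (f : R -> R) (n : nat) (a c : R) (u v : nat -> R).
Hypothesis Hf : CII f.
Hypothesis HH : horseshoe4 f n a c u v.

Let g := iter n f.

Lemma hs_g : CII g.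
Proof. apply CII_iter, Hf. Qed.

Lemma hs_n : (1 <= n)%nat.
Proof. apply HH. Qed.

Lemma hs_I : inI a /\ inI c.
Proof. split; apply HH. Qed.

Lemma hs_piece i : (i < 4)%nat -> a <= u i /\ u i <= v i /\ v i <= c /\ covers g (u i) (v i) a c.
Proof. apply HH. Qed.

Lemma hs_pieceI i : (i < 4)%nat -> inI (u i) /\ inI (v i).
Proof. intros Hi. destruct (hs_piece i Hi) as (? & ? & ? & _). destruct hs_I. unfold inI in *. lra. Qed.

Lemma hs_ac : a <= c.
Proof. destruct (hs_piece 0) as (? & ? & ? & _); [lia|lra]. Qed.

Lemma hs_sep i j : (i < j < 4)%nat -> v i < u j.
Proof.
  intros Hij. destruct HH as (_ & _ & _ & _ & S0 & S1 & S2).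
  destruct (hs_piece 1) as (_ & ? & _); [lia|]. destruct (hs_piece 2) as (_ & ? & _); [lia|].
  destruct i as [|[|[|i]]]; destruct j as [|[|[|[|j]]]]; try lia; lra.
Qed.

Lemma hs_self k : covers (iter k g) a c a c.
Proof.
  induction k as [|k IH].
  - intros t Ht. exists t. split; [exact Ht|reflexivity].
  - apply (covers_comp g k 1 _ _ _ _ _ _ IH). destruct (hs_piece 0) as (? & ? & ? & C); [lia|].
    eapply covers_sub; [exact C| | | |]; lra.
Qed.

Lemma hs_extend l r t t' : (t <= t')%nat -> covers (iter t g) l r a c -> covers (iter t' g) l r a c.
Proof.
  intros Ht C. replace t' with ((t' - t) + t)%nat by lia. apply (covers_comp g _ _ _ _ _ _ _ _ C), hs_self.
Qed.

Definition full (t : nat) (l r : R) : Prop :=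
  inI l /\ inI r /\ (1 <= t)%nat /\ a <= l /\ r <= c /\ covers (iter t g) l r a c.

Lemma full_half t l r : full t l r -> l <= r -> exists t' l' r', (t < t')%nat /\ l <= l' /\ l' <= r' /\ r' <= r /\
     r' - l' <= (r - l) / 2 /\ full t' l' r'.
Proof.
  intros (Hl & Hr & Ht & H1 & H2 & C) Hlr.
  destruct (hs_piece 0) as (A1 & A2 & A3 & A4); [lia|]. destruct (hs_piece 1) as (B1 & B2 & B3 & B4); [lia|].
  pose proof (hs_sep 0 1 ltac:(lia)).
  destruct (half_sub (iter t g) l r (u 0%nat) (v 0%nat) (u 1%nat) (v 1%nat)) as (l' & r' & L1 & L2 & L3 & L4 & L5); auto;
    try (apply CII_iter, hs_g); try (eapply covers_sub; [exact C| | | |]; lra).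
  exists (S t), l', r'. split; [lia|]. repeat (split; [lra|]).
  split; [unfold inI in *; lra|]. split; [unfold inI in *; lra|]. split; [lia|]. split; [lra|]. split; [lra|].
  destruct L5 as [[_ L5]|[_ L5]]; [apply (covers_comp g t 1 _ _ _ _ _ _ L5 A4)|apply (covers_comp g t 1 _ _ _ _ _ _ L5 B4)].
Qed.

Lemma full_point i : (i < 4)%nat -> exists e, u i <= e <= v i /\ forall eps, 0 < eps -> exists t l r,
  full t l r /\ l <= r /\ e - eps < l /\ r < e + eps.
Proof.
  intros Hi. destruct (hs_piece i Hi) as (A1 & A2 & A3 & A4). destruct (hs_pieceI i Hi) as [I1 I2].
  destruct (shrinking_point full 1 (u i) (v i)) as (e & He & Hsh).
  - split; [exact I1|]. split; [exact I2|]. split; [lia|]. auto.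
  - exact A2.
  - unfold inI in *; lra.
  - apply full_half.
  - exists e. split; [exact He|]. intros eps Heps.
    destruct (Hsh 0%nat eps Heps) as (t & l & r & _ & G & _ & _ & H & H'). exists t, l, r. split; [exact G|]. lra.
Qed.

(** The binary digits of [k < 2^m] serve as an itinerary through pieces 0 and 1, which gives [2^m]
    points over time [n m] and growth rate [ln 2 / n]. Half the gap is taken because separation is
    strict. *)
Lemma horseshoe_entropy : pos_entropy f.
Proof.
  pose proof (hs_sep 0 1 ltac:(lia)) as Hgap.
  set (gap := u 1%nat - v 0%nat).
  exists (gap / 2). split; [unfold gap; lra|].
  assert (Hn : 0 < INR n) by (apply lt_0_INR; pose proof hs_n; lia).
  assert (Hln : 0 < ln 2) by (rewrite <- ln_1; apply ln_increasing; lra).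
  exists (ln 2 / INR n). split; [apply Rdiv_lt_0_compat; assumption|].
  intros N.
  set (pc := fun b : bool => if b then 1%nat else 0%nat).
  assert (Hpc : forall b, (pc b < 4)%nat) by (intros []; simpl; lia).
  assert (Hpt : forall k : nat, exists x, inI x /\ forall i,
     u (pc (Nat.testbit k i)) <= iter (n * i) f x <= v (pc (Nat.testbit k i))).
  { intros k. destruct (itinerary_point f (fun i => (u (pc (Nat.testbit k i)), v (pc (Nat.testbit k i)))) (fun _ => n) Hf) as (x & Hx & Hi).
    - intros i. cbn [fst snd]. destruct (hs_pieceI _ (Hpc (Nat.testbit k i))). destruct (hs_piece _ (Hpc (Nat.testbit k i))). tauto.
    - intros i. cbn [fst snd]. destruct (hs_piece _ (Hpc (Nat.testbit k i))) as (_ & _ & _ & C).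
      destruct (hs_piece _ (Hpc (Nat.testbit k (S i)))) as (? & ? & ? & _).
      eapply covers_sub; [exact C| | | |]; lra.
    - exists x. split; [exact Hx|]. intros i. specialize (Hi i). cbn [fst snd] in Hi.
      replace (n * i)%nat with (cumul (fun _ => n) i); [exact Hi|]. clear. induction i; simpl; lia. }
  destruct (fun_choice _ Hpt) as [x Hx].
  set (m := S N).
  assert (Hdiff : forall k k', (k < 2 ^ m)%nat -> (k' < 2 ^ m)%nat -> k <> k' -> exists i, (i < m)%nat /\
     gap <= dist_n f (x k) (x k') (n * i)).
  { intros k k' Hk Hk' Hne.
    assert (Hb : exists i, (i < m)%nat /\ Nat.testbit k i <> Nat.testbit k' i).
    { apply NNPP. intros C. apply Hne. apply Nat.bits_inj. intros i.
      destruct (Compare_dec.le_lt_dec m i) as [Hi|Hi].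
      - rewrite <- (Nat.mod_small k (2 ^ m)), <- (Nat.mod_small k' (2 ^ m)) by assumption.
        rewrite !Nat.mod_pow2_bits_high by exact Hi. reflexivity.
      - destruct (Bool.bool_dec (Nat.testbit k i) (Nat.testbit k' i)) as [E|E]; [exact E|].
        exfalso. apply C. exists i. auto. }
    destruct Hb as (i & Hi & Hb). exists i. split; [exact Hi|]. unfold dist_n.
    pose proof (proj2 (Hx k) i) as X1. pose proof (proj2 (Hx k') i) as X2.
    destruct (Nat.testbit k i), (Nat.testbit k' i); try congruence; unfold pc in X1, X2; unfold gap, Rabs; destruct (Rcase_abs _); lra. }
  exists (n * m)%nat. split; [pose proof hs_n; unfold m; nia|].
  exists (map x (seq 0 (2 ^ m))). split; [split; [|split]|].
  - apply FinFun.Injective_map_NoDup_in; [|apply seq_NoDup].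
    intros k k' Hk Hk' E. apply in_seq in Hk, Hk'. destruct (Nat.eq_dec k k') as [|Hne]; [assumption|]. exfalso.
    destruct (Hdiff k k' ltac:(lia) ltac:(lia) Hne) as (i & _ & Hd). rewrite E in Hd. unfold dist_n in Hd.
    rewrite Rminus_diag, Rabs_R0 in Hd. unfold gap in Hd. lra.
  - intros y Hy. apply in_map_iff in Hy. destruct Hy as [k [<- _]]. apply Hx.
  - intros y y' Hy Hy' Hne. apply in_map_iff in Hy, Hy'. destruct Hy as [k [<- Hk]]. destruct Hy' as [k' [<- Hk']].
    apply in_seq in Hk, Hk'.
    destruct (Hdiff k k' ltac:(lia) ltac:(lia)) as (i & Hi & Hd); [intros ->; contradiction|].
    exists (n * i)%nat. split; [pose proof hs_n; nia|]. unfold gap in *. lra.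
  - rewrite length_map, length_seq, mult_INR, pow_INR.
    replace (ln 2 / INR n * (INR n * INR m)) with (INR m * ln 2) by (field; lra).
    rewrite exp_mul_nat, exp_ln by lra. replace (INR 2) with 2 by (simpl; lra). lra.
Qed.

(** Each neighbourhood contains a small interval covering [[a, c]]. After a common time [T] all
    three do so, hence the multiples of [n T] form independence sets of any length. *)
Lemma horseshoe_IN : exists x1 x2 x3, essential_IN_tuple3 f x1 x2 x3.
Proof.
  destruct (full_point 0) as (e0 & B0 & F0); [lia|]. destruct (full_point 1) as (e1 & B1 & F1); [lia|].
  destruct (full_point 2) as (e2 & B2 & F2); [lia|].
  pose proof (hs_sep 0 1 ltac:(lia)). pose proof (hs_sep 0 2 ltac:(lia)). pose proof (hs_sep 1 2 ltac:(lia)).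
  destruct (hs_pieceI 0) as [I0 J0]; [lia|]. destruct (hs_pieceI 1) as [I1 J1]; [lia|].
  destruct (hs_pieceI 2) as [I2 J2]; [lia|].
  exists e0, e1, e2. split; [|repeat split; lra].
  split; [unfold inI in *; lra|]. split; [unfold inI in *; lra|]. split; [unfold inI in *; lra|].
  intros U0 U1 U2 N0 N1 N2 m.
  assert (Hnb : forall U e, neighbourhood U e -> (forall eps, 0 < eps -> exists t l r, full t l r /\ l <= r /\ e - eps < l /\ r < e + eps) ->
     exists t l r, full t l r /\ l <= r /\ forall x, l <= x <= r -> U x).
  { intros U e [d Hd] F. destruct (F d (cond_pos d)) as (t & l & r & G & Hlr & G1 & G2).
    exists t, l, r. split; [exact G|]. split; [exact Hlr|]. intros x Hx. apply Hd. unfold disc. apply Rabs_lt_iff. lra. }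
  destruct (Hnb U0 e0 N0 F0) as (t0 & l0 & r0 & G0 & L0 & V0).
  destruct (Hnb U1 e1 N1 F1) as (t1 & l1 & r1 & G1 & L1 & V1).
  destruct (Hnb U2 e2 N2 F2) as (t2 & l2 & r2 & G2 & L2 & V2).
  set (T := (t0 + t1 + t2)%nat).
  set (K := fun j : nat => match j with 0 => (l0, r0) | 1 => (l1, r1) | _ => (l2, r2) end%nat).
  assert (HK : forall j, inI (fst (K j)) /\ inI (snd (K j)) /\ fst (K j) <= snd (K j) /\ a <= fst (K j) /\ snd (K j) <= c /\
     covers (iter T g) (fst (K j)) (snd (K j)) a c).
  { intros j. destruct G0 as (X1 & X2 & X3 & X4 & X5 & X6). destruct G1 as (Y1 & Y2 & Y3 & Y4 & Y5 & Y6).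
    destruct G2 as (Z1 & Z2 & Z3 & Z4 & Z5 & Z6).
    destruct j as [|[|j]]; simpl; repeat (split; [assumption|]);
    (eapply hs_extend; [|eassumption]; unfold T; lia). }
  assert (HT : (1 <= T)%nat) by (destruct G0 as (_ & _ & ? & _); unfold T; lia).
  exists (map (fun i => (n * (T * i))%nat) (seq 0 m)). split; [|split].
  - apply FinFun.Injective_map_NoDup; [|apply seq_NoDup]. intros i j E. pose proof hs_n.
    apply Nat.mul_cancel_l in E; [|lia]. apply Nat.mul_cancel_l in E; lia.
  - rewrite length_map, length_seq. lia.
  - intros F s _ HFJ _.
    destruct (itinerary_point g (fun i => K (s (n * (T * i))%nat)) (fun _ => T) hs_g) as (x & Hx & Hi).
    + intros i. destruct (HK (s (n * (T * i))%nat)). tauto.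
    + intros i. destruct (HK (s (n * (T * i))%nat)) as (_ & _ & _ & _ & _ & C).
      destruct (HK (s (n * (T * S i))%nat)) as (_ & _ & _ & ? & ? & _).
      eapply covers_sub; [exact C| | | |]; lra.
    + exists x. split; [exact Hx|]. intros i HiF. pose proof (HFJ i HiF) as HiJ.
      apply in_map_iff in HiJ. destruct HiJ as [j [<- _]]. specialize (Hi j). simpl in Hi.
      assert (E : cumul (fun _ => T) j = (T * j)%nat) by (clear; induction j; simpl; lia).
      rewrite E in Hi. unfold g in Hi. rewrite iter_mul, (Nat.mul_comm (T * j) n) in Hi.
      split; [apply iter_inI; assumption|].
      destruct (s (n * (T * j))%nat) as [|[|k]]; simpl in Hi; auto.
Qed.

Lemma cumul_ge m i : (forall j, (1 <= m j)%nat) -> (i <= cumul m i)%nat.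
Proof. intros Hm. induction i as [|i IH]; simpl; [lia|]. specialize (Hm i). lia. Qed.

(** Even stages bring all three points into intervals shrinking to [e] in piece 3, odd stages send
    them to pieces 0, 1 and 2. The durations depend on the stage only, so the three orbits are
    synchronous. *)
Lemma horseshoe_scrambled3 : exists x1 x2 x3, scrambled3 f x1 x2 x3.
Proof.
  destruct (full_point 3) as (e & _ & F); [lia|].
  assert (HF : forall k : nat, exists w : nat * (R * R), full (fst w) (fst (snd w)) (snd (snd w)) /\
     fst (snd w) <= snd (snd w) /\ e - / INR (S k) < fst (snd w) /\ snd (snd w) < e + / INR (S k)).
  { intros k. destruct (F (/ INR (S k))) as (t & l & r & G); [apply Rinv_0_lt_compat, lt_0_INR; lia|].
    exists (t, (l, r)). exact G. }
  destruct (fun_choice _ HF) as [w Hw].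
  set (m := fun i => if Nat.even i then fst (w (i / 2)%nat) else 1%nat).
  assert (Hm : forall i, (1 <= m i)%nat).
  { intros i. unfold m. destruct (Nat.even i); [|lia]. apply (Hw (i / 2)%nat). }
  assert (HX : forall j, (j < 4)%nat -> exists x, inI x /\ forall k,
     fst (snd (w k)) <= iter (cumul m (2 * k)) g x <= snd (snd (w k)) /\
     u j <= iter (cumul m (S (2 * k))) g x <= v j).
  { intros j Hj. destruct (hs_pieceI j Hj) as [I1 I2]. destruct (hs_piece j Hj) as (P1 & P2 & P3 & P4).
    set (B := fun i => if Nat.even i then snd (w (i / 2)%nat) else (u j, v j)).
    assert (Bac : forall i, a <= fst (B i) /\ snd (B i) <= c).
    { intros i. unfold B. destruct (Nat.even i); cbn [fst snd]; [|lra]. destruct (Hw (i / 2)%nat) as ((_ & _ & _ & ? & ? & _) & _). lra. }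
    destruct (itinerary_point g B m hs_g) as (x & Hx & Hi).
    - intros i. unfold B. destruct (Nat.even i); cbn [fst snd]; [|auto].
      destruct (Hw (i / 2)%nat) as ((? & ? & _) & ? & _). auto.
    - intros i. destruct (Bac (S i)).
      assert (C : covers (iter (m i) g) (fst (B i)) (snd (B i)) a c).
      { unfold m, B. destruct (Nat.even i); [|exact P4]. destruct (Hw (i / 2)%nat) as ((_ & _ & _ & _ & _ & C) & _). exact C. }
      eapply covers_sub; [exact C| | | |]; lra.
    - exists x. split; [exact Hx|]. intros k. split.
      + specialize (Hi (2 * k)%nat). unfold B in Hi.
        rewrite Nat.even_mul in Hi. simpl Nat.even in Hi. cbv iota in Hi.
        rewrite (Nat.mul_comm 2 k), Nat.div_mul in Hi by lia. rewrite (Nat.mul_comm 2 k). exact Hi.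
      + specialize (Hi (S (2 * k))%nat). unfold B in Hi. rewrite Nat.even_succ, Nat.odd_mul in Hi. exact Hi. }
  destruct (HX 0%nat) as (x0 & X0 & Y0); [lia|]. destruct (HX 1%nat) as (x1 & X1 & Y1); [lia|].
  destruct (HX 2%nat) as (x2 & X2 & Y2); [lia|].
  assert (Hiter : forall k x, iter (cumul m k) g x = iter (cumul m k * n) f x) by (intros; apply iter_mul).
  pose proof hs_n as Hn.
  exists x0, x1, x2. split; [exact X0|]. split; [exact X1|]. split; [exact X2|]. split.
  - intros eps Heps N. destruct (INR_unbounded (2 / eps)) as [k0 Hk0].
    set (k := (k0 + N)%nat). exists (cumul m (2 * k) * n)%nat. split.
    + pose proof (cumul_ge m (2 * k) Hm). unfold k in *. nia.
    + assert (Hk : 2 * / INR (S k) < eps).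
      { assert (Hp : 0 < INR (S k)) by (apply lt_0_INR; lia).
        assert (INR k0 <= INR (S k)) by (apply le_INR; unfold k; lia).
        apply (Rmult_lt_reg_r (INR (S k))); [exact Hp|]. rewrite Rmult_assoc, Rinv_l by lra.
        assert (2 / eps * eps = 2) by (field; lra).
        assert (2 / eps * eps < INR (S k) * eps) by (apply Rmult_lt_compat_r; lra). lra. }
      destruct (Hw k) as (_ & _ & W1 & W2).
      destruct (Y0 k) as [Z0 _]. destruct (Y1 k) as [Z1 _]. destruct (Y2 k) as [Z2 _].
      rewrite Hiter in Z0, Z1, Z2. unfold dist_n, max3.
      apply Rmax_lub_lt; [|apply Rmax_lub_lt]; apply Rabs_lt_iff; lra.
  - set (gap := Rmin (u 1%nat - v 0%nat) (u 2%nat - v 1%nat)).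
    pose proof (hs_sep 0 1 ltac:(lia)). pose proof (hs_sep 1 2 ltac:(lia)).
    assert (Hgap : 0 < gap) by (apply Rmin_pos; lra).
    pose proof (Rmin_l (u 1%nat - v 0%nat) (u 2%nat - v 1%nat)). pose proof (Rmin_r (u 1%nat - v 0%nat) (u 2%nat - v 1%nat)).
    fold gap in H1, H2.
    destruct (hs_piece 1) as (_ & P1 & _); [lia|].
    exists gap. split; [exact Hgap|]. intros N. exists (cumul m (S (2 * N)) * n)%nat. split.
    + pose proof (cumul_ge m (S (2 * N)) Hm). nia.
    + destruct (Y0 N) as [_ Z0]. destruct (Y1 N) as [_ Z1]. destruct (Y2 N) as [_ Z2].
      rewrite Hiter in Z0, Z1, Z2. unfold dist_n, min3.
      apply Rmin_glb; [|apply Rmin_glb]; unfold Rabs; destruct (Rcase_abs _); lra.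
Qed.
End Horseshoe.

(** * A transitive subsystem and a non-transitive proximal triple *)

Section Horseshoe2.
Variables (f : R -> R) (n : nat) (a c : R) (u v : nat -> R).
Hypothesis Hf : CII f.
Hypothesis HH : horseshoe4 f n a c u v.

Let g := iter n f.
Let Hg : CII g := hs_g f n Hf.
Let Hn : (1 <= n)%nat := hs_n f n a c u v HH.
Let Hpiece := hs_piece f n a c u v HH.
Let HpieceI := hs_pieceI f n a c u v HH.
Let Hsep := hs_sep f n a c u v HH.

(** The interval is covered by an image of [[a, c]] and spreads back over it. It is not asked to lie
    in [[a, c]], because the resulting set has to be invariant under [f] and not only under
    [f^n]. *)
Definition reachable (t : nat) (l r : R) : Prop :=
  inI l /\ inI r /\ (exists s, covers (iter s f) a c l r) /\ covers (iter t f) l r a c.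

Lemma f_self : covers (iter n f) a c a c.
Proof. destruct (Hpiece 0) as (? & ? & ? & C); [lia|]. eapply covers_sub; [exact C| | | |]; lra. Qed.

Lemma reachable_half t l r : reachable t l r -> l <= r -> exists t' l' r', (t < t')%nat /\ l <= l' /\ l' <= r' /\ r' <= r /\
     r' - l' <= (r - l) / 2 /\ reachable t' l' r'.
Proof.
  intros (Hl & Hr & [s Cs] & C) Hlr.
  destruct (Hpiece 0) as (A1 & A2 & A3 & A4); [lia|]. destruct (Hpiece 1) as (B1 & B2 & B3 & B4); [lia|].
  pose proof (Hsep 0 1 ltac:(lia)).
  destruct (half_sub (iter t f) l r (u 0%nat) (v 0%nat) (u 1%nat) (v 1%nat)) as (l' & r' & L1 & L2 & L3 & L4 & L5); auto;
    try (apply CII_iter, Hf); try (eapply covers_sub; [exact C| | | |]; lra).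
  exists (n + t)%nat, l', r'. split; [lia|]. repeat (split; [lra|]).
  split; [unfold inI in *; lra|]. split; [unfold inI in *; lra|]. split.
  - exists s. eapply covers_sub; [exact Cs| | | |]; lra.
  - destruct L5 as [[_ L5]|[_ L5]]; [apply (covers_comp f t n _ _ _ _ _ _ L5 A4)|apply (covers_comp f t n _ _ _ _ _ _ L5 B4)].
Qed.

Definition rec_set (e : R) : Prop := forall eps, 0 < eps -> exists t l r,
  reachable t l r /\ l <= r /\ e - eps < l /\ r < e + eps.

Lemma rec_set_meets t l r : reachable t l r -> l <= r -> exists e, rec_set e /\ l <= e <= r.
Proof.
  intros HG Hlr.
  destruct (shrinking_point reachable t l r HG Hlr) as (e & He & Hsh).
  - destruct HG as (? & ? & _). unfold inI in *; lra.
  - apply reachable_half.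
  - exists e. split; [|exact He]. intros eps Heps.
    destruct (Hsh 0%nat eps Heps) as (t' & l' & r' & _ & G & _ & _ & Hi & Hi'). exists t', l', r'.
    split; [exact G|]. lra.
Qed.

Lemma rec_setI e : rec_set e -> inI e.
Proof.
  intros H. unfold inI. split.
  - destruct (Rle_lt_dec 0 e) as [|Hlt]; [assumption|]. destruct (H (- e)) as (t & l & r & (Hl & Hr & _) & H1 & H2 & H3); [lra|].
    unfold inI in *; lra.
  - destruct (Rle_lt_dec e 1) as [|Hlt]; [assumption|]. destruct (H (e - 1)) as (t & l & r & (Hl & Hr & _) & H1 & H2 & H3); [lra|].
    unfold inI in *; lra.
Qed.

Lemma rec_set_closed : closed_set rec_set.
Proof.
  intros e He. unfold complementary in He. apply not_all_ex_not in He. destruct He as [eps He].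
  apply imply_to_and in He. destruct He as [Heps He].
  assert (H2 : 0 < eps / 2) by lra. exists (mkposreal _ H2). intros e' He' Hrec. apply He.
  destruct (Hrec (eps / 2) H2) as (t & l & r & G & Hlr & G1 & G2). exists t, l, r.
  unfold disc in He'. simpl in He'. apply Rabs_lt_iff in He'. split; [exact G|]. lra.
Qed.

Lemma rec_set_inv e : rec_set e -> rec_set (f e).
Proof.
  intros He eps Heps. assert (Ie := rec_setI e He).
  destruct (proj2 Hf e Ie eps Heps) as (d & Hd & U).
  destruct (He d Hd) as (t & l & r & (Hl & Hr & [s Cs] & C) & Hlr & G1 & G2).
  destruct (image_interval f l r Hf Hl Hr Hlr) as (p & q & Hpq & Ip & Iq & Hin & Hcov).
  (* Passing to the [f]-image costs one step. As [t] may be 0, a return of length [n >= 1] from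
     [[a, c]] to itself is appended beforehand. *)
  exists (n + t - 1)%nat, p, q.
  assert (Hclose : forall w, p <= w <= q -> Rabs (w - f e) < eps).
  { intros w Hw. destruct (Hcov w Hw) as [x [Hx <-]]. apply U; [unfold inI in *; lra|]. apply Rabs_lt_iff. lra. }
  split; [|split; [exact Hpq|]].
  - split; [exact Ip|]. split; [exact Iq|]. split.
    + exists (1 + s)%nat. apply (covers_comp f s 1 _ _ _ _ _ _ Cs Hcov).
    + intros w Hw. destruct (covers_comp f t n _ _ _ _ _ _ C f_self w Hw) as [x [Hx E]].
      exists (f x). split; [apply Hin, Hx|]. rewrite <- E. change (f x) with (iter 1 f x). rewrite <- iter_add.
      f_equal. lia.
  - pose proof (Hclose p ltac:(lra)) as P1. pose proof (Hclose q ltac:(lra)) as P2.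
    apply Rabs_lt_iff in P1, P2. lra.
Qed.

Lemma rec_set_nearby O e : open_set O -> O e -> rec_set e -> exists t l r, reachable t l r /\ l <= r /\
  forall x, l <= x <= r -> O x.
Proof.
  intros HO Oe He. destruct (open_ball_inside O e HO Oe) as (eps & Heps & Hb).
  destruct (He eps Heps) as (t & l & r & G & Hlr & G1 & G2). exists t, l, r. split; [exact G|]. split; [exact Hlr|].
  intros x Hx. apply Hb. apply Rabs_lt_iff. lra.
Qed.

(** A small reachable interval spreads over [[a, c]] and from there over any reachable interval. A
    subinterval mapped onto the target is again reachable and so contains a point of [rec_set].
    Sensitivity steers three such points into three pieces at the common time [n + t], where the
    extra [n] makes the time positive. *)
Lemma horseshoe_sensitive3 : exists Y, subsystem f Y /\ transitive_sub f Y /\ sensitive3_sub f Y.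
Proof.
  assert (Hinv : forall k e, rec_set e -> rec_set (iter k f e)).
  { induction k as [|k IH]; intros e He; [exact He|]. simpl. apply rec_set_inv, IH, He. }
  destruct (hs_I f n a c u v HH) as [Ia Ic]. pose proof (hs_ac f n a c u v HH) as Hac.
  exists rec_set. split; [|split].
  - split; [intros e He; apply rec_setI, He|]. split; [|split; [apply rec_set_closed|apply rec_set_inv]].
    destruct (rec_set_meets 0 a c) as (e & He & _); [|exact Hac|exists e; exact He].
    split; [exact Ia|]. split; [exact Ic|].
    split; [exists 0%nat|]; intros w Hw; exists w; (split; [exact Hw|reflexivity]).
  - intros O1 O2 HO1 HO2 (y1 & Y1 & Q1) (y2 & Y2 & Q2).
    destruct (rec_set_nearby O1 y1 HO1 Q1 Y1) as (t1 & l1 & r1 & (I1 & J1 & [s1 S1] & C1) & L1 & V1).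
    destruct (rec_set_nearby O2 y2 HO2 Q2 Y2) as (t2 & l2 & r2 & (I2 & J2 & [s2 S2] & C2) & L2 & V2).
    pose proof (covers_comp f _ _ _ _ _ _ _ _ C1 S2) as D.
    destruct (onto_sub _ _ _ _ _ (CII_iter f _ Hf) I1 J1 L2 D) as (l & r & A1 & A2 & A3 & A4 & A5).
    destruct (rec_set_meets (t2 + (s2 + t1)) l r) as (x & Hx & Hxlr); [|exact A2|].
    + split; [unfold inI in *; lra|]. split; [unfold inI in *; lra|]. split.
      * exists s1. eapply covers_sub; [exact S1| | | |]; lra.
      * apply (covers_comp f _ _ _ _ _ _ _ _ A5 C2).
    + exists (s2 + t1)%nat, x. split; [exact Hx|]. split; [apply V1; lra|]. split; [apply Hinv, Hx|].
      apply V2, A4, Hxlr.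
  - set (gap := Rmin (u 1%nat - v 0%nat) (u 2%nat - v 1%nat)).
    pose proof (Hsep 0 1 ltac:(lia)) as S01. pose proof (Hsep 1 2 ltac:(lia)) as S12.
    assert (Hgap : 0 < gap) by (apply Rmin_pos; lra).
    pose proof (Rmin_l (u 1%nat - v 0%nat) (u 2%nat - v 1%nat)) as M1.
    pose proof (Rmin_r (u 1%nat - v 0%nat) (u 2%nat - v 1%nat)) as M2. fold gap in M1, M2.
    destruct (Hpiece 1) as (_ & P1 & _); [lia|].
    exists gap. split; [exact Hgap|]. intros O HO (y & Hy & Oy).
    destruct (rec_set_nearby O y HO Oy Hy) as (t & l & r & (Il & Ir & [s S] & C) & L & V).
    pose proof (covers_comp f _ _ _ _ _ _ _ _ C f_self) as D.
    assert (Hj : forall j, (j < 4)%nat -> exists x, rec_set x /\ O x /\ u j <= iter (n + t) f x <= v j).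
    { intros j Hj. destruct (Hpiece j Hj) as (B1 & B2 & B3 & B4).
      destruct (onto_sub (iter (n + t) f) l r (u j) (v j)) as (l' & r' & A1 & A2 & A3 & A4 & A5); auto;
        [apply CII_iter, Hf|eapply covers_sub; [exact D| | | |]; lra|].
      destruct (rec_set_meets (n + (n + t)) l' r') as (x & Hx & Hxlr); [|exact A2|].
      - split; [unfold inI in *; lra|]. split; [unfold inI in *; lra|]. split.
        + exists s. eapply covers_sub; [exact S| | | |]; lra.
        + apply (covers_comp f _ _ _ _ _ _ _ _ A5 B4).
      - exists x. split; [exact Hx|]. split; [apply V; lra|]. apply A4, Hxlr. }
    destruct (Hj 0%nat) as (x0 & R0 & O0 & E0); [lia|]. destruct (Hj 1%nat) as (x1 & R1 & O1 & E1); [lia|].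
    destruct (Hj 2%nat) as (x2 & R2 & O2 & E2); [lia|].
    exists x0, x1, x2, (n + t)%nat. repeat (split; [assumption|]).
    split; [intros ->; lra|]. split; [intros ->; lra|]. split; [intros ->; lra|]. split; [lia|].
    unfold dist_n, min3. apply Rmin_glb; [|apply Rmin_glb]; unfold Rabs; destruct (Rcase_abs _); lra.
Qed.

(** Besides spreading at time [t], the whole interval stays in the hull of pieces [i] and [j] until
    then. This keeps limit points of such intervals in the hull forever. *)
Definition confined (i j t : nat) (l r : R) : Prop :=
  inI l /\ inI r /\ (forall k x, (k <= t)%nat -> l <= x <= r -> u i <= iter k g x <= v j) /\
  covers (iter t g) l r (u i) (v j).

Lemma confined_half i j t l r : (i < j < 4)%nat -> confined i j t l r -> l <= r ->
  exists t' l' r', (t < t')%nat /\ l <= l' /\ l' <= r' /\ r' <= r /\ r' - l' <= (r - l) / 2 /\ confined i j t' l' r'.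
Proof.
  intros Hij (Hl & Hr & Hst & C) Hlr.
  destruct (Hpiece i) as (A1 & A2 & A3 & A4); [lia|]. destruct (Hpiece j) as (B1 & B2 & B3 & B4); [lia|].
  destruct (HpieceI i) as [IA JA]; [lia|]. destruct (HpieceI j) as [IB JB]; [lia|].
  pose proof (Hsep i j Hij) as Hs.
  destruct (onto_sub g (u i) (v i) (u i) (v j)) as (p0 & q0 & P1 & P2 & P3 & P4); auto; try lra;
    [eapply covers_sub; [exact A4| | | |]; lra|].
  destruct (onto_sub g (u j) (v j) (u i) (v j)) as (p1 & q1 & Q1 & Q2 & Q3 & Q4); auto; try lra;
    [eapply covers_sub; [exact B4| | | |]; lra|].
  destruct (half_sub (iter t g) l r p0 q0 p1 q1) as (l' & r' & L1 & L2 & L3 & L4 & L5); auto; try lra;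
    try (apply CII_iter, Hg); try (eapply covers_sub; [exact C| | | |]; lra).
  exists (S t), l', r'. split; [lia|]. repeat (split; [lra|]).
  split; [unfold inI in *; lra|]. split; [unfold inI in *; lra|].
  split.
  - intros k x Hk Hx. destruct (Nat.eq_dec k (S t)) as [->|Hne]; [|apply Hst; [lia|lra]].
    simpl. destruct L5 as [[L5 _]|[L5 _]]; [apply P4, L5, Hx|apply Q4, L5, Hx].
  - destruct L5 as [[_ L5]|[_ L5]]; [apply (covers_comp g t 1 _ _ _ _ _ _ L5 (proj2 P4))|
      apply (covers_comp g t 1 _ _ _ _ _ _ L5 (proj2 Q4))].
Qed.

Lemma confined_point i j : (i < j < 4)%nat -> exists e, inI e /\ (forall k, u i <= iter k g e <= v j) /\
  forall N eps, 0 < eps -> exists t l r, (t >= N)%nat /\ confined i j t l r /\ l <= e <= r /\ e - eps < l /\ r < e + eps.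
Proof.
  intros Hij. destruct (Hpiece i) as (A1 & A2 & A3 & A4); [lia|]. destruct (Hpiece j) as (B1 & B2 & B3 & B4); [lia|].
  destruct (HpieceI i) as [IA JA]; [lia|]. destruct (HpieceI j) as [IB JB]; [lia|].
  pose proof (Hsep i j Hij) as Hs.
  destruct (shrinking_point (confined i j) 0 (u i) (v j)) as (e & He & Hsh).
  - split; [exact IA|]. split; [exact JB|]. split.
    + intros k x Hk Hx. replace k with 0%nat by lia. exact Hx.
    + intros w Hw. exists w. split; [exact Hw|reflexivity].
  - lra.
  - unfold inI in *; lra.
  - intros t l r. apply confined_half, Hij.
  - exists e. split; [unfold inI in *; lra|]. split.
    + intros k. destruct (Hsh k 1 Rlt_0_1) as (t & l & r & Ht & (_ & _ & Hst & _) & _ & _ & Hb & _). apply Hst; [lia|exact Hb].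
    + intros N eps Heps. destruct (Hsh N eps Heps) as (t & l & r & Ht & G & _ & _ & Hb & H1 & H2).
      exists t, l, r. auto.
Qed.

(** A confined interval chosen small enough is still within [eps] of the orbit of [e] after [tau]
    steps, and still has to spread. One further step, through piece [i], enlarges the covered hull
    to [[a, c]]. *)
Lemma confined_image i j e tau eps : (i < j < 4)%nat -> inI e -> 0 < eps ->
  (forall N eps, 0 < eps -> exists t l r, (t >= N)%nat /\ confined i j t l r /\ l <= e <= r /\ e - eps < l /\ r < e + eps) ->
  exists m p q, (1 <= m)%nat /\ p <= q /\ a <= p /\ q <= c /\ covers (iter m g) p q a c /\
    iter tau g e - eps < p /\ q < iter tau g e + eps.
Proof.
  intros Hij Ie Heps He.
  destruct (Hpiece i) as (A1 & A2 & A3 & A4); [lia|]. destruct (Hpiece j) as (B1 & B2 & B3 & B4); [lia|].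
  pose proof (Hsep i j Hij) as Hs.
  destruct (unif_cont_iter g tau eps Hg Heps) as (d & Hd & U).
  destruct (He (S tau) d Hd) as (t & l & r & Ht & (Il & Ir & Hst & C) & Hb & H1 & H2).
  destruct (image_interval (iter tau g) l r (CII_iter g _ Hg) Il Ir) as (p & q & Hpq & Ip & Iq & Hin & Hcov); [lra|].
  assert (Hw : forall w, p <= w <= q -> u i <= w <= v j /\ Rabs (w - iter tau g e) < eps).
  { intros w Hw. destruct (Hcov w Hw) as [x [Hx <-]]. split; [apply Hst; [lia|exact Hx]|].
    apply U; auto; [unfold inI in *; lra|]. apply Rabs_lt_iff. lra. }
  pose proof (Hw p ltac:(lra)) as [W1 W2]. pose proof (Hw q ltac:(lra)) as [W3 W4]. apply Rabs_lt_iff in W2, W4.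
  exists (1 + (t - tau))%nat, p, q. split; [lia|]. repeat (split; [lra|]). split; [|lra].
  assert (C' : covers (iter (t - tau) g) p q (u i) (v j)).
  { intros w Hw'. destruct (C w Hw') as [x [Hx E]]. exists (iter tau g x). split; [apply Hin, Hx|].
    rewrite <- iter_add. replace (t - tau + tau)%nat with t by lia. exact E. }
  apply (covers_comp g (t - tau) 1 _ _ _ _ _ _ C').
  eapply covers_sub; [exact A4| | | |]; lra.
Qed.

(** [x] stays in the hull of pieces 0 and 1 and [z] in that of pieces 2 and 3, so they are kept
    apart by the gap. The orbit of [y] is steered close to the orbit of [x] at even stages and to
    that of [z] at odd stages, with errors [1/(k+1)]. *)
Lemma horseshoe_not_transitive : exists x y z, proximal f x y /\ proximal f y z /\ ~ proximal f x z.
Proof.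
  destruct (confined_point 0 1) as (x & Ix & Kx & Cx); [lia|].
  destruct (confined_point 2 3) as (z & Iz & Kz & Cz); [lia|].
  pose proof (Hsep 1 2 ltac:(lia)) as Hgap.
  destruct (hs_I f n a c u v HH) as [Ia Ic].
  set (tgt := fun k => if Nat.even k then x else z).
  assert (Himg : forall k tau, exists m p q, (1 <= m)%nat /\ p <= q /\ a <= p /\ q <= c /\ covers (iter m g) p q a c /\
    iter tau g (tgt k) - / INR (S k) < p /\ q < iter tau g (tgt k) + / INR (S k)).
  { intros k tau. assert (He : 0 < / INR (S k)) by (apply Rinv_0_lt_compat, lt_0_INR; lia).
    unfold tgt. destruct (Nat.even k).
    - apply (confined_image 0 1 x); auto.
    - apply (confined_image 2 3 z); auto. }
  (* The state of stage [k] consists of the arrival time [tau], the time [m] needed to spread over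
     [[a, c]], and the target interval near the orbit of [x] or [z] at time [tau]. Targets move, so
     each depends on the previous durations. *)
  set (P := fun k (w : (nat * nat) * (R * R)) => let '((tau, m), (p, q)) := w in
     (1 <= m)%nat /\ p <= q /\ a <= p /\ q <= c /\ covers (iter m g) p q a c /\
     iter tau g (tgt k) - / INR (S k) < p /\ q < iter tau g (tgt k) + / INR (S k)).
  destruct (Himg 0%nat 0%nat) as (m0 & p0 & q0 & H0).
  destruct (dep_choice P (fun k w w' => fst (fst w') = (snd (fst w) + fst (fst w))%nat) ((0, m0), (p0, q0))%nat) as (w & Hw0 & Hw).
  { exact H0. }
  { intros k [[tau m] [p q]] _. destruct (Himg (S k) (m + tau)%nat) as (m' & p' & q' & H').
    exists ((m + tau, m')%nat, (p', q')). split; [exact H'|reflexivity]. }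
  set (m := fun k => snd (fst (w k))).
  assert (Htau : forall k, fst (fst (w k)) = cumul m k).
  { induction k as [|k IH]; [rewrite Hw0; reflexivity|]. simpl. rewrite <- IH. apply Hw. }
  assert (HP : forall k, (1 <= m k)%nat /\ fst (snd (w k)) <= snd (snd (w k)) /\ a <= fst (snd (w k)) /\ snd (snd (w k)) <= c /\
     covers (iter (m k) g) (fst (snd (w k))) (snd (snd (w k))) a c /\
     iter (cumul m k) g (tgt k) - / INR (S k) < fst (snd (w k)) /\ snd (snd (w k)) < iter (cumul m k) g (tgt k) + / INR (S k)).
  { intros k. destruct (Hw k) as [H _]. rewrite <- Htau. unfold m, P in *. destruct (w k) as [[tau' m'] [p' q']]. exact H. }
  destruct (itinerary_point g (fun k => snd (w k)) m Hg) as (y & Iy & Hy).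
  { intros k. destruct (HP k) as (_ & H1 & H2 & H3 & _). unfold inI in *. lra. }
  { intros k. destruct (HP k) as (_ & _ & _ & _ & C & _). destruct (HP (S k)) as (_ & _ & H2 & H3 & _).
    eapply covers_sub; [exact C| | | |]; lra. }
  assert (Hclose : forall k, dist_n f (tgt k) y (cumul m k * n) < / INR (S k)).
  { intros k. destruct (HP k) as (_ & _ & _ & _ & _ & H1 & H2). specialize (Hy k).
    unfold dist_n, g in *. rewrite iter_mul in *. apply Rabs_lt_iff. lra. }
  assert (Hm : forall k, (1 <= m k)%nat) by (intros k; apply HP).
  assert (Hprox : forall e b, inI e -> (forall k, tgt (2 * k + b)%nat = e) -> proximal f e y).
  { intros e b Ie Hb. split; [exact Ie|]. split; [exact Iy|]. intros eps Heps N.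
    destruct (INR_unbounded (/ eps)) as [k0 Hk0].
    set (k := (2 * (k0 + N) + b)%nat). exists (cumul m k * n)%nat. split.
    - pose proof (cumul_ge m k Hm). unfold k in *. nia.
    - specialize (Hclose k). unfold k in Hclose at 1. rewrite Hb in Hclose.
      eapply Rlt_trans; [exact Hclose|]. rewrite <- (Rinv_inv eps). apply Rinv_lt_contravar.
      + apply Rmult_lt_0_compat; [apply Rinv_0_lt_compat, Heps|apply lt_0_INR; lia].
      + eapply Rlt_le_trans; [exact Hk0|]. apply le_INR. unfold k. lia. }
  exists x, y, z. split; [|split].
  - apply (Hprox x 0%nat Ix). intros k. unfold tgt. rewrite Nat.add_0_r, Nat.even_mul. reflexivity.
  - apply proximal_sym. apply (Hprox z 1%nat Iz). intros k. unfold tgt.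
    rewrite Nat.even_add, Nat.even_mul. reflexivity.
  - intros Hp. destruct (far_all_times f n 0 (u 2%nat - v 1%nat) Hf Hn) as (d & Hd & Hfar); [lra|].
    apply (proximal_not_far f x z d Hp Hd). apply Hfar; auto. exists 0%nat. intros k _. simpl (iter 0 f _).
    specialize (Kx k). specialize (Kz k). fold g. unfold Rabs. destruct (Rcase_abs _); lra.
Qed.
End Horseshoe2.

(** * Maximal scrambled sets through a non-transitive triple *)

(** Zorn's lemma is applied to the sets [A] whose union with [S0] is scrambled. Thus the empty chain
    has an admissible union too, and the maximal set obtained contains [S0]. *)
Lemma maximal_extension f S0 : scrambled_set f S0 -> exists S, maximal_scrambled f S /\ forall x, S0 x -> S x.
Proof.
  intros HS0.
  destruct (@classical_sets.Zorn_bigcup R (fun A : R -> Prop => scrambled_set f (fun x => S0 x \/ A x))) as (A & HA & Hmax).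
  - intros F HF Htot. split.
    + intros x [Hx|[X HX Hx]]; [apply HS0, Hx|]. apply (HF X HX). right. exact Hx.
    + assert (Hc : forall x y X, F X -> X x -> (S0 y \/ X y) -> x <> y -> scrambled_pair f x y).
      { intros x y X HX Hx Hy Hxy. apply (HF X HX); auto. }
      assert (Hsym : forall x y, scrambled_pair f x y -> scrambled_pair f y x).
      { intros x y [Hp [d [Hd Hl]]]. split; [apply proximal_sym, Hp|]. exists d. split; [exact Hd|].
        intros N. destruct (Hl N) as [k [Hk Hdk]]. exists k. split; [exact Hk|]. unfold dist_n in *.
        rewrite Rabs_minus_sym. exact Hdk. }
      intros x y [Hx|[X HX Hx]] [Hy|[Y HY Hy]] Hxy.
      * apply HS0; assumption.
      * apply Hsym. apply (Hc y x Y); auto.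
      * apply (Hc x y X); auto.
      * destruct (Htot X Y HX HY) as [L|L].
        -- apply (Hc x y Y); auto.
        -- apply (Hc x y X); auto.
  - exists (fun x => S0 x \/ A x). split; [|auto]. split; [exact HA|].
    intros S' HS' Hsub x Hx. apply NNPP. intros C. apply (Hmax S').
    + split; [intros y Hy; apply Hsub; right; exact Hy|]. intros L. apply C. right. apply L, Hx.
    + destruct HS' as [H1 H2]. split.
      * intros y [Hy|Hy]; apply H1; auto.
      * intros y y' [Hy|Hy] [Hy'|Hy'] Hne; apply H2; auto.
Qed.

(** Two maximal sets containing [x, y] and [y, z] share [y] and so are not separable. An equivalence
    would provide a point of the second set asymptotic to [x]; being proximal to [z], it would make
    [x] proximal to [z]. *)
Lemma not_transitive_maximal_sets f x y z : proximal f x y -> proximal f y z -> ~ proximal f x z ->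
  exists S T, maximal_scrambled f S /\ maximal_scrambled f T /\ ~ equivalent_sets f S T /\ ~ separable_sets f S T.
Proof.
  intros Hxy Hyz Hxz.
  assert (Ix : inI x) by apply Hxy. assert (Iy : inI y) by apply Hxy. assert (Iz : inI z) by apply Hyz.
  assert (Hpair : forall p q, proximal f p q -> ~ asym f p q -> scrambled_set f (fun t => t = p \/ t = q)).
  { intros p q Hp Ha. assert (inI p) by apply Hp. assert (inI q) by apply Hp. split.
    - intros t [->| ->]; assumption.
    - intros s t [->| ->] [->| ->] Hne; try contradiction.
      + split; [exact Hp|apply not_asym_limsup, Ha].
      + split; [apply proximal_sym, Hp|apply not_asym_limsup]. intros C. apply Ha, asym_sym, C. }
  destruct (maximal_extension f (fun t => t = x \/ t = y)) as (S & HS & Sxy).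
  { apply Hpair; [exact Hxy|]. intros C. apply Hxz. apply (asym_proximal f x y z); assumption. }
  destruct (maximal_extension f (fun t => t = y \/ t = z)) as (T & HT & Tyz).
  { apply Hpair; [exact Hyz|]. intros C. apply Hxz. apply proximal_sym.
    apply (asym_proximal f z y x); auto; [apply asym_sym, C|apply proximal_sym, Hxy]. }
  exists S, T. split; [exact HS|]. split; [exact HT|]. split.
  - intros (phi & P1 & _ & _ & P4).
    assert (Ha : asym f x (phi x)).
    { apply asym_sym. intros e He. destruct (P4 x (Sxy x (or_introl eq_refl)) e He) as [N HN'].
      exists N. intros k Hk. specialize (HN' k Hk). rewrite Rabs_Rabsolu in HN'. exact HN'. }
    apply Hxz. apply (asym_proximal f x (phi x) z); auto.
    apply (scrambled_proximal f T); [apply HT| |]; auto.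
  - intros (d & Hd & H). specialize (H y y (Sxy y (or_intror eq_refl)) (Tyz y (or_introl eq_refl)) (d / 2) ltac:(lra)).
    destruct H as [N HN']. specialize (HN' N (Nat.le_refl _)). unfold dist_n in HN'.
    rewrite Rminus_diag, Rabs_R0 in HN'. lra.
Qed.

Theorem mainTheorem17 (f : R -> R) (hf : CII f) :
  (pos_entropy f <-> ~ is_equivalence_on_I (proximal f)) /\
  (pos_entropy f <-> exists S T, maximal_scrambled f S /\ maximal_scrambled f T /\
                        ~ equivalent_sets f S T /\ ~ separable_sets f S T) /\
  (pos_entropy f <-> exists x1 x2 x3, scrambled3 f x1 x2 x3) /\
  (pos_entropy f <-> exists Y, subsystem f Y /\ transitive_sub f Y /\ sensitive3_sub f Y) /\
  (pos_entropy f <-> exists x1 x2 x3, essential_IN_tuple3 f x1 x2 x3).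
Proof.
  assert (Hent : ~ NT f -> pos_entropy f).
  { intros H. destruct (turb_horseshoe4 f hf H) as (n & a & c & u & v & HH).
    apply (horseshoe_entropy f n a c u v hf HH). }
  assert (Hturb : pos_entropy f -> exists n a c u v, horseshoe4 f n a c u v).
  { intros H. apply turb_horseshoe4; [exact hf|]. intros HN. apply (NT_no_entropy f hf HN H). }
  split; [|split; [|split; [|split]]]; split; intros H.
  - destruct (Hturb H) as (n & a & c & u & v & HH).
    destruct (horseshoe_not_transitive f n a c u v hf HH) as (x & y & z & Hxy & Hyz & Hxz).
    intros (_ & _ & Htr). apply Hxz. apply (Htr x y z); auto; (apply Hxy || apply Hyz).
  - apply Hent. intros HN. apply H, NT_prox_equiv; assumption.
  - destruct (Hturb H) as (n & a & c & u & v & HH).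
    destruct (horseshoe_not_transitive f n a c u v hf HH) as (x & y & z & Hxy & Hyz & Hxz).
    apply (not_transitive_maximal_sets f x y z); assumption.
  - apply Hent. intros HN. destruct H as (S & T & HS & HT & Hne & Hns).
    apply Hns, NT_maximal_sets; assumption.
  - destruct (Hturb H) as (n & a & c & u & v & HH). apply (horseshoe_scrambled3 f n a c u v hf HH).
  - apply Hent. intros HN. apply (NT_no_scrambled3 f hf HN H).
  - destruct (Hturb H) as (n & a & c & u & v & HH). apply (horseshoe_sensitive3 f n a c u v hf HH).
  - apply Hent. intros HN. apply (NT_no_sensitive3 f hf HN H).
  - destruct (Hturb H) as (n & a & c & u & v & HH). apply (horseshoe_IN f n a c u v hf HH).
  - apply Hent. intros HN. apply (NT_no_IN f hf HN H).
Qed.
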